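(* There is a deterministic algorithm which, given as input a finite list of polynomials $f_1,\dots,f_s\in\mathbb{Q}[x_1,\dots,x_n]$ (with $n$ and $s$ arbitrary and part of the input), always terminates and correctly decides whether the ideal $I=\langle f_1,\dots,f_s\rangle\subset\mathbb{Q}[x_1,\dots,x_n]$ contains a nonzero binomial. In other words, the decision problem ''does $\langle f_1,\dots,f_s\rangle$ contain a nonzero binomial?'' is algorithmically decidable.
   Context: A binomial is a polynomial with at most two terms, i.e. of the form $\mu\,\mathbf{x}^u-\lambda\,\mathbf{x}^v$ with $\lambda,\mu$ in the coefficient field and $\mathbf{x}^u,\mathbf{x}^v$ monomials, where $\mathbf{x}^a=\prod_i x_i^{a_i}$; in particular, monomials count as binomials. Polynomials over $\mathbb{Q}$ are encoded in the usual way as finite lists of exponent vectors with rational coefficients. *)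

(* Defs.v *)
From mathcomp Require Import all_boot all_order all_algebra.
From mathcomp Require Export mpoly.

Set Implicit Arguments.
Unset Strict Implicit.
Unset Printing Implicit Defensive.

Import GRing.Theory.
Local Open Scope ring_scope.

(* "Algorithm" means partial (mu-)recursive function.  [recf n] is the syntax
   of the n-ary partial recursive functions. *)
Inductive recf : nat -> Type :=
| Zero n : recf n
| Succ : recf 1
| Proj n (i : 'I_n) : recf n
| Comp m n (f : recf m) (g : 'I_m -> recf n) : recf n
| Prec n (f : recf n) (g : recf n.+2) : recf n.+1
| Mu n (f : recf n.+1) : recf n.

(* [recf_eval f xs y]: on input xs, f halts with output y.  In [Prec] the
   first argument is the recursion variable, and the step function receives
   (counter, previous value, parameters).  [Mu f] searches for the least y with
   f (y, xs) = 0 and diverges unless f halts on all smaller arguments. *)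
Fixpoint recf_eval n (f : recf n) : n.-tuple nat -> nat -> Prop :=
  match f in recf n return n.-tuple nat -> nat -> Prop with
  | Zero _ => fun _ y => y = 0%N
  | Succ => fun xs y => y = (thead xs).+1
  | Proj _ i => fun xs y => y = tnth xs i
  | Comp m _ f g => fun xs y =>
      exists2 zs : m.-tuple nat,
        forall i, recf_eval (g i) xs (tnth zs i) & recf_eval f zs y
  | Prec _ f g => fun xs =>
      let ps := behead_tuple xs in
      (fix iter k := if k is k'.+1 then
           fun y => exists2 z, iter k' z
                             & recf_eval g (cons_tuple k' (cons_tuple z ps)) y
         else recf_eval f ps) (thead xs)
  | Mu _ f => fun xs y =>
      recf_eval f (cons_tuple y xs) 0%N /\
      forall z, (z < y)%N -> exists v, recf_eval f (cons_tuple z xs) v.+1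
  end.

(* P is decidable for inputs in T presented through the code enc: a single
   program halts on every (code of an) input, answering 1 if P holds and 0
   otherwise. *)
Definition algorithmically_decidable (T : Type) (enc : T -> nat)
    (P : T -> Prop) : Prop :=
  exists d : recf 1, forall x : T, exists b : bool,
    recf_eval d [tuple enc x] b /\ (b <-> P x).

(* A polynomial is input as a list of terms (exponent vector, coefficient), in
   any order; repeated exponent vectors and zero coefficients are allowed. *)
Definition poly_data (n : nat) : Type := seq ('X_{1..n} * rat).

Definition poly_of_data n (p : poly_data n) : {mpoly rat[n]} :=
  \sum_(t <- p) t.2 *: 'X_[t.1].

(* The number of variables together with the list of generators. *)
Definition ideal_data : Type := {n : nat & seq (poly_data n)}.

(* [CodeSeq.code] is the library's bijection from [seq nat] to [nat]. *)
Definition rat_code (q : rat) : nat :=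
  CodeSeq.code [:: nat_of_bool (q < 0); `|numq q|%N; `|denq q|%N].

Definition term_code n (t : 'X_{1..n} * rat) : nat :=
  CodeSeq.code [:: CodeSeq.code (t.1 : seq nat); rat_code t.2].

Definition poly_code n (p : poly_data n) : nat :=
  CodeSeq.code [seq term_code t | t <- p].

Definition ideal_code (I : ideal_data) : nat :=
  CodeSeq.code
    [:: projT1 I; CodeSeq.code [seq poly_code p | p <- projT2 I]].

Definition in_ideal n (F : seq {mpoly rat[n]}) (p : {mpoly rat[n]}) : Prop :=
  exists h : 'I_(size F) -> {mpoly rat[n]}, p = \sum_(i < size F) h i * F`_i.

Definition is_binomial n (p : {mpoly rat[n]}) : Prop :=
  exists (mu lambda : rat) (u v : 'X_{1..n}),
    p = mu *: 'X_[u] - lambda *: 'X_[v].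

Definition contains_nonzero_binomial (I : ideal_data) : Prop :=
  exists p : {mpoly rat[projT1 I]},
    [/\ in_ideal [seq poly_of_data f | f <- projT2 I] p,
        is_binomial p & p != 0].

(* Main.v *)
(* Both answers have finite certificates that a program can check, so a search
   through all candidates terminates and decides the problem.

   A nonzero binomial in I is certified by its cofactors.  Suppose that there is
   none.  Then the ideal of Laurent polynomials generated by I contains no
   x^u - lambda with u in Z^n nonzero, and it can be enlarged to an ideal J of
   finite codimension with the same property: the exponents u with some
   x^u - lambda in J form a subgroup, whose rank drops when J is intersected
   with another suitable ideal of finite codimension.  Multiplication by
   x_i modulo J gives commuting invertible rational matrices M_i = S_i exp(T_i),
   with S_i semisimple and T_i nilpotent, at which all elements of I vanish, and
   x^u - lambda lies in J for some lambda iff sum_i u_i T_i = 0 and S^u is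
   scalar.  To certify that no nonzero u has these two properties, note that
   such a u can be rescaled and rounded to a v in Z^n of sup norm R for which
   sum_i v_i T_i and the power sums of the eigenvalue ratios of S^v, multiplied
   by fixed constants, are integers with bounds that do not depend on R.  The
   certificate is an R for which every v of sup norm R violates this.  It exists:
   otherwise two such v, for distinct R, have the same values, and then their
   difference is a relation u. *)

From HB Require Import structures.
Require Import Defs.
From mathcomp Require Import all_boot all_order all_algebra all_field.
From mathcomp Require Import ring_quotient generic_quotient.
From mathcomp Require Import ring zify.
From Stdlib Require Import ClassicalEpsilon FunctionalExtensionality.

Set Implicit Arguments.
Unset Strict Implicit.
Unset Printing Implicit Defensive.

Import Order.TTheory GRing.Theory Num.Theory.
Local Open Scope ring_scope.

(** The hard direction is the absence of binomials, where infinitely many exponents u must be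
    excluded at once. In Laurent polynomials monomials are units, so the exponents in question form
    a group; in finite codimension the quotient is described by finitely many rational matrices,
    which a program can inspect. What is left is to exclude multiplicative relations among algebraic
    numbers. A bound, known in advance, on the size of a least relation would need height estimates.
    The radius R replaces it: a relation rescaled to any radius leaves a rounding error no larger
    than the relation itself, hence values from a fixed finite set, and the pigeonhole principle
    gives the converse. Ratios of eigenvalues occur because S^u is scalar exactly when all of them
    are 1, and their power sums because these are rational, being products of traces: the program
    never computes with an eigenvalue. That a certificate exists is shown by classical reasoning;
    checking one is an explicit recursive function. *)

(** * Choice and Dickson's lemma *)

Lemma choice_fun (A B : Type) (R : A -> B -> Prop) :
  (forall a, exists b, R a b) -> exists f : A -> B, forall a, R a (f a).
Proof.
move=> h; exists (fun a => proj1_sig (constructive_indefinite_description _ (h a))).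
by move=> a; case: constructive_indefinite_description.
Qed.

Lemma seq_argmin (h : nat -> nat) m :
  exists i, (m <= i)%N /\ forall j, (m <= j)%N -> (h i <= h j)%N.
Proof.
suff H v i : (m <= i)%N -> (h i <= v)%N ->
    exists i, (m <= i)%N /\ forall j, (m <= j)%N -> (h i <= h j)%N.
  exact: (H (h m) m).
elim: v i => [|v IH] i mi hi.
  by exists i; split=> // j _; move: hi; rewrite leqn0 => /eqP->.
case: (classic (exists j, (m <= j)%N /\ (h j <= v)%N)) => [[j [mj hj]]|no].
  exact: IH mj hj.
exists i; split=> // j mj; apply: leq_trans hi _; rewrite ltnNge.
by apply/negP=> hj; apply: no; exists j.
Qed.

Lemma incr_homo (g : nat -> nat) : (forall i, (g i < g i.+1)%N) ->
  forall i j, (i < j)%N -> (g i < g j)%N.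
Proof.
move=> hg i; elim=> // j IH; rewrite ltnS leq_eqVlt => /orP[/eqP->|/IH] //.
by move/ltn_trans; apply.
Qed.

(** Each chosen index minimises [h] over all indices beyond the previous one, so no later value is
    smaller. *)
Lemma nondecreasing_subsequence (h : nat -> nat) :
  exists g : nat -> nat, (forall i, (g i < g i.+1)%N) /\
    forall i j, (i <= j)%N -> (h (g i) <= h (g j))%N.
Proof.
have [m hm] := choice_fun (seq_argmin h).
pose g := fix g k := if k is k'.+1 then m (g k').+1 else m 0%N.
have gS i : (g i < g i.+1)%N by have [] := hm (g i).+1.
exists g; split=> // i j; rewrite leq_eqVlt => /orP[/eqP->//|ij].
have [b gE] : exists b, g i = m b by case: i {ij} => [|i]; [exists 0%N|exists (g i).+1].
have lebg : (b <= g i)%N by rewrite gE; have [] := hm b.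
have lt := incr_homo gS ij.
by rewrite gE; have [_] := hm b; apply; exact: leq_trans lebg (ltnW lt).
Qed.

(** Subsequences are extracted one coordinate at a time; those coordinates already treated stay
    nondecreasing. *)
Lemma dickson n (f : nat -> 'X_{1..n}) :
  exists i j, (i < j)%N /\ (f i <= f j)%MM.
Proof.
suff H (s : seq 'I_n) : exists g : nat -> nat, (forall i, (g i < g i.+1)%N) /\
    forall k, k \in s -> forall i j, (i <= j)%N -> (f (g i) k <= f (g j) k)%N.
  have [g [gS hg]] := H (enum 'I_n).
  exists (g 0%N), (g 1%N); split=> //; apply/mnm_lepP => k.
  by apply: hg; rewrite ?mem_enum.
elim: s => [|k s [g [gS hg]]]; first by exists id.
have [h [hS hh]] := nondecreasing_subsequence (fun i => f (g i) k).
exists (g \o h); split=> [i|k']; first exact: (incr_homo gS).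
rewrite inE => /orP[/eqP->|ks] i j ij; first exact: hh.
apply: hg => //; move: ij; rewrite leq_eqVlt => /orP[/eqP->//|ij].
exact/ltnW/(incr_homo hS ij).
Qed.

(** * Ideals and the Nullstellensatz *)

Definition ideal (R : comNzRingType) (J : R -> Prop) : Prop :=
  [/\ J 0, forall a b, J a -> J b -> J (a + b) & forall r a, J a -> J (r * a)].

Section IdealTheory.
Variables (R : comNzRingType) (J : R -> Prop).
Hypothesis idJ : ideal J.

Lemma ideal0 : J 0. Proof. by case: idJ. Qed.
Lemma idealD a b : J a -> J b -> J (a + b). Proof. by case: idJ => _ + _; apply. Qed.
Lemma idealMl r a : J a -> J (r * a). Proof. by case: idJ => _ _; apply. Qed.
Lemma idealMr r a : J a -> J (a * r). Proof. by rewrite mulrC; apply: idealMl. Qed.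
Lemma idealN a : J a -> J (- a). Proof. by rewrite -mulN1r; apply: idealMl. Qed.
Lemma idealB a b : J a -> J b -> J (a - b).
Proof. by move=> Ja Jb; apply/idealD/idealN. Qed.
Lemma ideal_eq a b : J (a - b) -> J a <-> J b.
Proof.
move=> h; split=> h'; last by rewrite -(subrK b a); apply: idealD.
by rewrite -(subKr a b); apply: idealB.
Qed.
Lemma ideal_sum (I : Type) (r : seq I) (P : pred I) F :
  (forall i, P i -> J (F i)) -> J (\sum_(i <- r | P i) F i).
Proof.
by move=> h; elim/big_ind: _ => //; [apply: ideal0 | apply: idealD].
Qed.
Lemma ideal1 a : J 1 -> J a. Proof. by rewrite -[a]mulr1; apply: idealMl. Qed.

Lemma ideal_colon (a : R) : ideal (fun b => J (b * a)).
Proof.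
split=> [|b c|r b]; rewrite ?mul0r ?mulrDl -?mulrA.
- exact: ideal0.
- exact: idealD.
- exact: idealMl.
Qed.

Lemma ideal_add (K : R -> Prop) : ideal K ->
  ideal (fun c => exists a b, [/\ J a, K b & c = a + b]).
Proof.
move=> [K0 KD KM]; split.
- by exists 0, 0; rewrite addr0; split=> //; apply: ideal0.
- move=> c c' [a [b [Ja Kb ->]]] [a' [b' [Ja' Kb' ->]]].
  by exists (a + a'), (b + b'); rewrite addrACA; split; [apply: idealD|apply: KD|].
- move=> r c [a [b [Ja Kb ->]]]; exists (r * a), (r * b).
  by rewrite mulrDr; split; [apply: idealMl|apply: KM|].
Qed.

Lemma ideal_meet (K : R -> Prop) : ideal K -> ideal (fun c => J c /\ K c).
Proof.
move=> [K0 KD KM]; split.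
- by split=> //; apply: ideal0.
- by move=> a b [? ?] [? ?]; split; [apply: idealD|apply: KD].
- by move=> r a [? ?]; split; [apply: idealMl|apply: KM].
Qed.

End IdealTheory.

Lemma ideal_mulr (R : comNzRingType) (J : R -> Prop) (a : R) : ideal J ->
  ideal (fun c => exists2 b, J b & c = a * b).
Proof.
move=> idJ; split.
- by exists 0; rewrite ?mulr0 //; apply: ideal0.
- by move=> _ _ [b Jb ->] [c Jc ->]; exists (b + c); rewrite ?mulrDr //; apply: idealD.
- by move=> r _ [b Jb ->]; exists (r * b); rewrite ?(mulrCA r) //; apply: idealMl.
Qed.

Lemma ideal_principal (R : comNzRingType) (a : R) : ideal (fun c => exists r, c = r * a).
Proof.
split=> [|b c [r ->] [s ->]|r b [s ->]].
- by exists 0; rewrite mul0r.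
- by exists (r + s); rewrite mulrDl.
- by exists (r * s); rewrite mulrA.
Qed.

(** The Noetherian property as a maximality principle. In a strictly increasing chain choose at each
    step a new element with least leading monomial. By Dickson's lemma one of these monomials
    divides a later one; cancelling it there gives a new element with a smaller leading monomial. *)
Lemma ideal_max (K : fieldType) n (Phi : ({mpoly K[n]} -> Prop) -> Prop)
    (J0 : {mpoly K[n]} -> Prop) :
    (forall J, Phi J -> ideal J) -> Phi J0 ->
  exists J, [/\ Phi J, forall a, J0 a -> J a &
    forall J', Phi J' -> (forall a, J a -> J' a) -> forall a, J' a -> J a].
Proof.
move=> PhiI Phi0; apply: NNPP => no.
pose T := {J | Phi J /\ forall a, J0 a -> J a}.
have next (t : T) : exists t' : T, (forall a, proj1_sig t a -> proj1_sig t' a) /\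
    exists a, proj1_sig t' a /\ ~ proj1_sig t a.
  apply: NNPP => nn; case: t nn => [J [PJ sJ]] /= nn; apply: no; exists J; split=> //.
  move=> J' PJ' sJ' a J'a; apply: NNPP => nJa; apply: nn.
  have J'T : Phi J' /\ forall a, J0 a -> J' a by split=> // b /sJ /sJ'.
  by exists (exist _ J' J'T); split=> //=; exists a.
have [nx hnx] := choice_fun next.
have t0 : T by exists J0.
pose C := fix C k := if k is k'.+1 then nx (C k') else t0.
pose I k := proj1_sig (C k).
have idI k : ideal (I k) by rewrite /I; have [PJ _] := proj2_sig (C k); apply: PhiI.
have mono i j : (i <= j)%N -> forall a, I i a -> I j a.
  elim: j => [|j IH]; first by rewrite leqn0 => /eqP->.
  rewrite leq_eqVlt => /orP[/eqP->//|/IH h] a Ia; move: (h a Ia).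
  by have [+ _] := hnx (C j); apply.
have ex k : exists p, [/\ I k.+1 p, ~ I k p &
    forall q, I k.+1 q -> ~ I k q -> ~~ (mlead q < mlead p)%O].
  have [_ [a]] := hnx (C k).
  have [m am] : exists m, m = mlead a by exists (mlead a).
  elim: m / (ltom_wf m) a am => m _ IH a am [h1 h2].
  case: (classic (exists q, [/\ I k.+1 q, ~ I k q & (mlead q < mlead a)%O])).
    by move=> [q [q1 q2 q3]]; apply: (IH (mlead q) _ q) => //; rewrite am.
  move=> nq; exists a; split=> // q q1 q2; apply/negP=> q3; apply: nq.
  by exists q; split.
have [p hp] := choice_fun ex.
have [i [j [ij le]]] := dickson (fun k => mlead (p k)).
have [pi1 pi2 _] := hp i; have [pj1 pj2 pj3] := hp j.
have nz k : p k != 0.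
  by apply/eqP=> pk; have [_ + _] := hp k; rewrite pk; apply; apply: ideal0.
pose q := p j - (mleadc (p j) / mleadc (p i)) *: ('X_[mlead (p j) - mlead (p i)] * p i).
have Ji : I j (p i) by apply: (mono i.+1).
have Jr : I j ((mleadc (p j) / mleadc (p i)) *: ('X_[mlead (p j) - mlead (p i)] * p i)).
  by rewrite scalerAl; apply: idealMl.
have q1 : I j.+1 q by apply: idealB => //; apply: (mono j).
have q2 : ~ I j q by move=> h; apply: pj2; rewrite -(subrK ((mleadc (p j) / mleadc (p i)) *: ('X_[mlead (p j) - mlead (p i)] * p i)) (p j)); apply: idealD.
have q0 : q != 0 by apply/eqP=> qz; apply: q2; rewrite qz; apply: ideal0.
have := pj3 q q1 q2; rewrite lt_neqAle negb_and negbK => /orP[/eqP e|/negP]; last first.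
  apply; apply: le_trans (mleadB_le _ _) _; rewrite leUx lexx /=.
  apply: le_trans (mleadZ_le _ _) _; rewrite mleadM ?mpolyX_neq0 ?nz //.
    by rewrite mleadXm submK.
  by rewrite -mleadc_eq0 mleadXm mcoeffX eqxx oner_eq0.
have E : ('X_[mlead (p j) - mlead (p i)] * p i)@_(mlead (p j)) = mleadc (p i).
  by rewrite -[X in _@_X](submK le) mulrC mcoeffMX.
move: (mlead_supp q0); rewrite e mcoeff_msupp /q mcoeffB mcoeffZ E.
by rewrite divfK ?mleadc_eq0 ?nz // subrr eqxx.
Qed.

Definition ring_generated (R F : comNzRingType) (phi : R -> F) n (a : 'I_n -> F) :=
  forall S : F -> Prop, (forall r, S (phi r)) -> (forall i, S (a i)) ->
    (forall x y, S x -> S y -> S (x + y)) ->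
    (forall x y, S x -> S y -> S (x * y)) -> forall x, S x.

(** Modulo h = 1 + X g the product - X g is 1, so g is a unit there. If h divided a power of g, it
    would divide 1, against its positive degree. *)
Lemma one_addXM_ndvd (K : idomainType) (g : {poly K}) : g != 0 ->
  forall k q, g ^+ k <> (1 + 'X * g) * q.
Proof.
move=> g0 k q e; pose h := 1 + 'X * g.
have sh : (1 < size h)%N.
  have sX : size ('X * g) = (size g).+1 by rewrite mulrC size_mulX.
  by rewrite /h addrC size_polyDl ?size_poly1 sX ?ltnS ?lt0n ?size_poly_eq0.
have [z ez] : exists z, (1 - h) ^+ k = 1 + h * z.
  elim: k {e} => [|k [z IH]]; first by exists 0; rewrite mulr0 addr0.
  by exists (z - 1 - h * z); rewrite exprS IH; ring.
have e1 : 1 = h * ((- 'X) ^+ k * q - z).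
  rewrite mulrBr mulrCA -e -exprMn mulNr.
  have -> : - ('X * g) = 1 - h by rewrite /h; ring.
  by rewrite ez addrK.
have : h %| 1 by rewrite [X in _ %| X]e1; apply: dvdp_mulr.
rewrite dvdp1 => /eqP s1; by rewrite s1 in sh.
Qed.

(** With l the leading coefficient and D + 1 the degree of f, multiplying f(x) = 0 by l^D gives a
    monic equation for l x. *)
Lemma integral_lead (R : idomainType) (F : comNzRingType) (phi : {rmorphism R -> F})
    (f : {poly R}) (x : F) : injective phi ->
  f != 0 -> root (map_poly phi f) x -> integralOver phi (phi (lead_coef f) * x).
Proof.
move=> inj f0 fx; set l := lead_coef f.
have [D sf] : exists D, size f = D.+2.
  case sf : (size f) => [|[|D]]; last by exists D.
    by move/eqP: sf; rewrite size_poly_eq0 (negbTE f0).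
  have /size_poly1P[c c0 fc] : size f == 1 by rewrite sf.
  move: fx; rewrite fc map_polyC /root hornerC => /eqP fx.
  by case/eqP: c0; apply: inj; rewrite rmorph0 -fx.
have fl : f`_D.+1 = l by rewrite /l lead_coefE sf.
pose p := \poly_(j < D.+2) (if j == D.+1 then 1 else f`_j * l ^+ (D - j)).
have pl : p`_D.+1 = 1 by rewrite coef_poly ltnSn eqxx.
have sp : size p = D.+2 by rewrite size_poly_eq //= eqxx oner_eq0.
exists p; first by rewrite monicE lead_coefE sp pl.
rewrite /root /= horner_coef size_map_inj_poly ?rmorph0 // sp; apply/eqP.
move: fx; rewrite /root horner_coef size_map_inj_poly ?rmorph0 // sf => /eqP fx.
apply: (etrans _ (etrans (congr1 (fun y => phi l ^+ D * y) fx) (mulr0 _))).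
rewrite /= mulr_sumr.
apply: eq_bigr => i _; rewrite !coef_map /= coef_poly ltn_ord exprMn.
case: eqP => [->|/eqP ne].
  by rewrite rmorph1 mul1r fl exprS; ring.
have le : (i <= D)%N by rewrite -ltnS ltn_neqAle ne -ltnS ltn_ord.
by rewrite rmorphM rmorphXn /= -[X in _ = _ ^+ X * _](subnK le) exprD; ring.
Qed.

(* Munshi's proof of Zariski's lemma: a domain R embedded in a field that it
   generates as a ring together with n elements has a g that is divisible, up
   to powers, by every nonzero element; R = K[X] has no such g. *)
Lemma munshi n : forall (R : idomainType) (F : comNzRingType) (phi : {rmorphism R -> F})
    (a : 'I_n -> F), injective phi -> (forall x : F, x != 0 -> exists y, x * y = 1) ->
    ring_generated phi a ->
  exists2 g : R, g != 0 & forall h, h != 0 -> exists k q, g ^+ k = h * q.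
Proof.
elim: n => [|n IH] R F phi a inj inv gen.
  (* Without generators [phi] is onto, so R is a field and g = 1 will do. *)
  exists 1; rewrite ?oner_eq0 // => h h0.
  have ph0 : phi h != 0 by rewrite -(rmorph0 phi) (inj_eq inj).
  have [y hy] := inv _ ph0.
  have [r er] : exists r, y = phi r.
    elim/gen: y {hy} => [r|[]//|_ _ [r ->] [s ->]|_ _ [r ->] [s ->]].
    - by exists r.
    - by exists (r + s); rewrite rmorphD.
    - by exists (r * s); rewrite rmorphM.
  exists 0%N, r; apply: inj; by rewrite expr0 rmorph1 rmorphM /= -er hy.
(* If some [a i] is transcendental over R, then F is generated over R[X] by the other n elements,
   and the g that the induction hypothesis yields for R[X] cannot exist. *)
case: (classic (exists i, injective (horner_morph (fun x => mulrC (a i) (phi x))))).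
  move=> [i injphi]; exfalso.
  have gen' : ring_generated (horner_morph (fun x => mulrC (a i) (phi x))) (a \o lift i).
    move=> S S1 S2 S3 S4; apply: gen => // [r|j].
      by have := S1 r%:P; rewrite horner_morphC.
    by case: (unliftP i j) => [j' ->|->]; [apply: S2| have := S1 'X; rewrite horner_morphX].
  have [g g0 hg] := IH _ F _ _ injphi inv gen'.
  have [k [q e]] : exists k q, g ^+ k = (1 + 'X * g) * q.
    apply: hg; apply/eqP=> e; have := one_addXM_ndvd g0 (k := 1) (q := 0).
    have : size ('X * g) = (size g).+1 by rewrite mulrC size_mulX.
    move/eqP: e; rewrite addrC addr_eq0 => /eqP->; rewrite size_polyN size_poly1 => -[] /esym/eqP.
    by rewrite size_poly_eq0 (negbTE g0).
  exact: one_addXM_ndvd e.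
move=> ninj.
have alg i : exists f : {poly R}, f != 0 /\ root (map_poly phi f) (a i).
  apply: NNPP => no; apply: ninj; exists i => p q e; apply/eqP; rewrite -subr_eq0.
  apply/negPn/negP => pq; apply: no; exists (p - q); split=> //.
  rewrite /root rmorphB /= hornerD hornerN subr_eq0; exact/eqP.
have [f hf] := choice_fun alg.
(* All [a i] are algebraic, and F is integral over R[1/g]. A monic equation of degree D for g^k / h,
   multiplied by h^D, shows that h divides a power of g. *)
pose g := \prod_i lead_coef (f i).
have g0 : g != 0 by apply/prodf_neq0 => i _; rewrite lead_coef_eq0; have [] := hf i.
have int x : exists k, integralOver phi (phi (g ^+ k) * x).
  elim/gen: x => [r|i|x y [k hx] [l hy]|x y [k hx] [l hy]].
  - by exists 0%N; rewrite expr0 rmorph1 mul1r; apply: integral_id.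
  - exists 1%N; rewrite expr1 /g (bigD1 i) //= [lead_coef _ * _]mulrC rmorphM /= -mulrA.
    apply: integral_mul; first exact: integral_id.
    by apply: integral_lead => //; have [] := hf i.
  - exists (k + l)%N; rewrite exprD rmorphM /= mulrDr.
    apply: integral_add; [rewrite mulrAC mulrC | rewrite -mulrA];
      by apply: integral_mul => //; apply: integral_id.
  - exists (k + l)%N; rewrite exprD rmorphM /= mulrACA.
    exact: integral_mul.
exists g => // h h0.
have ph0 : phi h != 0 by rewrite -(rmorph0 phi) (inj_eq inj).
have [y hy] := inv _ ph0.
have [k [p mp]] := int y; rewrite /root horner_coef size_map_inj_poly ?rmorph0 // => /eqP py.
have sp0 : (0 < size p)%N by rewrite lt0n size_poly_eq0 monic_neq0.
have sp : size p = (size p).-1.+1 by rewrite prednK.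
set D := (size p).-1 in sp.
rewrite sp in py.
have e : \sum_(i < D.+1) p`_i * (g ^+ k) ^+ i * h ^+ (D - i) = 0.
  apply: inj; rewrite rmorph0 rmorph_sum /=.
  apply: (etrans _ (etrans (congr1 (fun z => phi h ^+ D * z) py) (mulr0 _))).
  rewrite /= mulr_sumr.
  apply: eq_bigr => i _; rewrite coef_map /= !rmorphM /= !(rmorphXn phi) /=.
  have le : (i <= D)%N by rewrite -ltnS.
  rewrite -[X in _ = _ ^+ X * _](subnK le) exprD exprMn.
  have -> : phi p`_i * (phi g ^+ k) ^+ i * phi h ^+ (D - i) =
     phi p`_i * (phi g ^+ k) ^+ i * phi h ^+ (D - i) * (phi h * y) ^+ i.
    by rewrite hy expr1n mulr1.
  by rewrite exprMn; ring.
exists (k * D)%N, (- \sum_(i < D) p`_i * (g ^+ k) ^+ i * h ^+ (D - i).-1).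
move: e; rewrite big_ord_recr /= subnn expr0 mulr1.
have -> : p`_D = 1 by move: mp; rewrite monicE lead_coefE => /eqP.
rewrite mul1r exprM => /eqP; rewrite addrC addr_eq0 => /eqP->.
rewrite mulrN mulr_sumr; congr (- _); apply: eq_bigr => i _.
by rewrite -{1}(prednK (_ : 0 < D - i)%N) ?subn_gt0 // exprS; ring.
Qed.

Section Quotient.
Variables (R : comNzRingType) (J : R -> Prop).
Hypotheses (idJ : ideal J) (pJ : ~ J 1).

(** The quotient construction takes a boolean membership predicate; excluded middle turns [J] into
    one. *)
Definition idealb : {pred R} :=
  fun a => if excluded_middle_informative (J a) then true else false.

Lemma idealbP a : reflect (J a) (a \in idealb).
Proof.
rewrite unfold_in /idealb; case: excluded_middle_informative => h.
  exact: ReflectT.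
exact: ReflectF.
Qed.

Lemma idealb_closed : idealr_closed idealb.
Proof.
split; first by apply/idealbP; apply: ideal0.
  by apply/idealbP.
move=> a u v /idealbP Ju /idealbP Jv; apply/idealbP.
by apply: idealD => //; apply: idealMl.
Qed.

HB.instance Definition _ := isIdealr.Build R idealb idealb_closed.

Lemma quotient_ring_ex : exists (F : comNzRingType) (pi : {rmorphism R -> F}),
  (forall x, exists a, x = pi a) /\ forall a, pi a = 0 <-> J a.
Proof.
exists {ideal_quot idealb}, (\pi_{ideal_quot idealb})%qT; split=> [x|a].
  by exists (repr x); apply/esym/reprK.
split=> [/eqP|/idealbP h].
  rewrite -(rmorph0 (\pi_{ideal_quot idealb})%qT) /= -Quotient.idealrBE subr0.
  by move/idealbP.
apply/eqP; rewrite -(rmorph0 (\pi_{ideal_quot idealb})%qT) /= -Quotient.idealrBE subr0.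
exact: h.
Qed.

End Quotient.

Section Zariski.
Variables (K : fieldType) (N : nat).
Local Notation P := {mpoly K[N]}.
Implicit Types (J m : P -> Prop) (t : P).

Definition algebraic_mod J t := exists2 p : {poly K}, p != 0 & J (horner_alg t p).

Definition maximal_ideal m := [/\ ideal m, ~ m 1 & forall s, ~ m s -> exists r, m (r * s - 1)].

(** If t were transcendental modulo m, then K[t] would embed into the field of residues modulo m,
    which the variables generate over it. [munshi] would give a g in K[t] that [one_addXM_ndvd]
    forbids. *)
Lemma zariski m t : maximal_ideal m -> algebraic_mod m t.
Proof.
move=> [idm pm mm]; apply: NNPP => nalg.
have [F [pi [sur ker]]] := quotient_ring_ex idm pm.
have inv (x : F) : x != 0 -> exists y, x * y = 1.
  have [a ->] := sur x; move=> /eqP x0.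
  have [|r mr] := mm a; first by move/ker.
  exists (pi r); apply/eqP; rewrite -rmorphM /= mulrC -(rmorph1 pi) -subr_eq0 -rmorphB /=.
  exact/eqP/ker.
pose phi : {rmorphism {poly K} -> F} := pi \o horner_alg t.
have inj : injective phi.
  move=> p q e; apply/eqP; rewrite -subr_eq0; apply/negPn/negP => pq; apply: nalg.
  exists (p - q) => //; apply/ker; rewrite rmorphB /=; apply/eqP.
  by rewrite rmorphB subr_eq0 /=; apply/eqP; exact: e.
have gen : ring_generated phi (fun i => pi 'X_i).
  move=> S S1 S2 S3 S4 x; have [a ->] := sur x.
  elim/mpolyind: a => [|c m' a _ _ IH].
    by have := S1 0; rewrite !rmorph0.
  rewrite rmorphD /=; apply: (S3) => //.
  have -> : c *: 'X_[m'] = (horner_alg t c%:P) * 'X_[m'].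
    by rewrite horner_algC mulr_algl.
  rewrite rmorphM /=; apply: (S4); first exact: S1.
  rewrite mpolyXE_id rmorph_prod /=.
  have S11 : S 1 by have := S1 1; rewrite rmorph1.
  apply: big_ind => // i _.
  rewrite rmorphXn /=; elim: (m' i) => [|k IHk]; first by rewrite expr0.
  by rewrite exprS; apply: (S4).
have [g g0 hg] := munshi inj inv gen.
have [|k [q e]] := hg (1 + 'X * g); last exact: one_addXM_ndvd e.
apply/eqP=> e; have : size ('X * g) = (size g).+1 by rewrite mulrC size_mulX.
move/eqP: e; rewrite addrC addr_eq0 => /eqP->; rewrite size_polyN size_poly1 => -[] /esym/eqP.
by rewrite size_poly_eq0 (negbTE g0).
Qed.

Lemma maximal_above J : ideal J -> ~ J 1 ->
  exists m, maximal_ideal m /\ forall a, J a -> m a.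
Proof.
move=> idJ pJ.
have [|m [[idm pm] sm mm]] := ideal_max (Phi := fun J => ideal J /\ ~ J 1) _ (conj idJ pJ).
  by move=> ? [].
exists m; split=> //; split=> // s ms.
have idm' := ideal_add idm (ideal_principal s).
case: (classic (exists a b, [/\ m a, exists r, b = r * s & 1 = a + b])).
  move=> [a [_ [ma [r ->] e]]]; exists r.
  by rewrite e opprD addrC subrK; apply: idealN.
move=> nm; exfalso; apply: ms; apply: (mm _ (conj idm' nm)) => [a ma|].
  by exists a, 0; rewrite addr0; split=> //; exists 0; rewrite mul0r.
by exists 0, s; rewrite add0r; split=> //; [apply: ideal0 | exists 1; rewrite mul1r].
Qed.

(** Finite codimension, expressed by one polynomial for each variable. In this form intersections
    only require multiplying polynomials. *)
Definition cofinite J := ideal J /\ forall i : 'I_N, algebraic_mod J 'X_i.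

Lemma cofinite_meet J J' : cofinite J -> cofinite J' -> cofinite (fun a => J a /\ J' a).
Proof.
move=> [idJ h] [idJ' h']; split=> [|i]; first exact: ideal_meet.
have [p p0 Jp] := h i; have [q q0 Jq] := h' i.
exists (p * q); first by rewrite mulf_neq0.
by rewrite rmorphM /=; split; [apply: idealMr|apply: idealMl].
Qed.

(* J is maximal among the ideals above J0 that avoid a.  Then (J : a) is a
   maximal ideal, and a nonzero polynomial in x_i lying in it has a power in J. *)
Lemma residual J0 (a : P) : ideal J0 -> ~ J0 a ->
  exists J, [/\ cofinite J, forall b, J0 b -> J b, ~ J a &
    maximal_ideal (fun b => J (b * a))].
Proof.
move=> id0 a0.
have [|J [[idJ Ja] sJ mJ]] := ideal_max (Phi := fun J => ideal J /\ ~ J a) _ (conj id0 a0).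
  by move=> ? [].
have key s : ~ J s -> exists r, J (r * s - a).
  move=> Js; have id' := ideal_add idJ (ideal_principal s).
  case: (classic (exists b c, [/\ J b, exists r, c = r * s & a = b + c])).
    move=> [b [_ [Jb [r ->] e]]]; exists r.
    by rewrite e opprD addrC subrK; apply: idealN.
  move=> nJ; exfalso; apply: Js; apply: (mJ _ (conj id' nJ)) => [b Jb|].
    by exists b, 0; rewrite addr0; split=> //; exists 0; rewrite mul0r.
  by exists 0, s; rewrite add0r; split=> //; [apply: ideal0 | exists 1; rewrite mul1r].
have mm : maximal_ideal (fun b => J (b * a)).
  split; [exact: ideal_colon|by rewrite mul1r|] => s Js.
  by have [r Jr] := key _ Js; exists r; rewrite mulrBl mul1r -mulrA.
exists J; split=> //; split=> // i.
have [p p0 mp] := zariski 'X_i mm.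
set x := horner_alg 'X_i p in mp.
suff [k Jk] : exists k, J (x ^+ k).
  by exists (p ^+ k); rewrite ?expf_neq0 // rmorphXn.
(* The colon ideals J : x^k become stationary at some k. If x^k were outside J, then a = r x^k
   modulo J for some r; since a x is in J, so is r x^(k+1), hence r x^k by stationarity, hence a. *)
have [||J' [[k J'E] _ mJ']] := @ideal_max _ _ (fun J' => exists k, J' = fun b => J (b * x ^+ k))
    (fun b => J (b * x ^+ 0)).
- by move=> _ [k ->]; apply: ideal_colon.
- by exists 0%N.
exists k; apply: NNPP => /key [r Jr]; apply: Ja.
have JJ : J (r * x ^+ k.+1).
  apply/(ideal_eq idJ (b := a * x)); last by rewrite mulrC.
  by rewrite exprSr mulrA -mulrBl; apply: idealMr.
have := mJ' (fun b => J (b * x ^+ k.+1)) (ex_intro _ k.+1 erefl).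
rewrite J'E => h; have {}h : J (r * x ^+ k).
  by apply: h JJ => b Jb; rewrite exprSr mulrA; apply: idealMr.
by rewrite -(subKr (r * x ^+ k) a); apply: idealB.
Qed.

End Zariski.

Section MinimalPolynomial.
Variables (K : fieldType) (N : nat).
Local Notation P := {mpoly K[N]}.

Lemma minpoly_mod (J : P -> Prop) t : ideal J -> algebraic_mod J t ->
  exists p : {poly K}, [/\ p != 0, J (horner_alg t p) &
    forall r, J (horner_alg t r) -> p %| r].
Proof.
move=> idJ [p p0 Jp].
have [d] : exists d, (size p <= d)%N by exists (size p).
elim: d p p0 Jp => [|d IH] p p0 Jp sp.
  by move: p0; rewrite -size_poly_eq0 -leqn0 sp.
case: (classic (forall r, J (horner_alg t r) -> p %| r)) => [h|no]; first by exists p.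
have [r nr] := not_all_ex_not _ _ no.
have [Jr /negP ndv] := imply_to_and _ _ nr.
apply: (IH (r %% p)); first by rewrite -/(dvdp p r).
  have -> : r %% p = r - r %/ p * p by rewrite {2}(divp_eq r p) addrC addKr.
  by rewrite rmorphB rmorphM /=; apply: idealB => //; apply: idealMl.
by rewrite -ltnS; apply: leq_trans sp; rewrite ltn_modp.
Qed.

End MinimalPolynomial.

(** A p whose square divides f = X^k - l divides both f and f', hence X f' - k f, which is the
    nonzero constant k l. *)
Lemma sqr_dvd_XnsubC (p : {poly rat}) k (l : rat) : (0 < k)%N -> l != 0 ->
  p * p %| 'X^k - l%:P -> size p = 1%N.
Proof.
move=> k0 l0 /dvdpP[g e].
have ph : p %| 'X^k - l%:P by rewrite e mulrA dvdp_mull.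
have pd : p %| ('X^k - l%:P)^`().
  have -> : ('X^k - l%:P)^`() = (g^`() * p + g * p^`() + g * p^`()) * p.
    by rewrite e !derivM; ring.
  exact: dvdp_mull.
have : p %| (k%:R * l)%:P.
  have -> : (k%:R * l)%:P = 'X * ('X^k - l%:P)^`() - k%:R%:P * ('X^k - l%:P).
    rewrite derivB derivC derivXn subr0 mulrnAr -exprS prednK // polyCM !rmorph_nat.
    by rewrite -mulr_natl; ring.
  by apply: dvdp_sub; apply: dvdp_mull.
have c0 : k%:R * l != 0 by rewrite mulf_neq0 // pnatr_eq0 -lt0n.
move=> /dvdp_leq; rewrite polyC_eq0 c0 => /(_ isT); rewrite size_polyC c0 => s1.
have p0 : p != 0.
  apply/eqP=> p0; move: e; rewrite p0 !mulr0 => /eqP; rewrite subr_eq0 => /eqP e.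
  by have := congr1 (size \o polyseq) e; rewrite /= size_polyXn size_polyC l0 => -[k1]; move: k0; rewrite k1.
by apply/eqP; rewrite eqn_leq s1 lt0n size_poly_eq0.
Qed.

(** * Enlarging an ideal to finite codimension without creating relations *)

Section Lines.
Variable N : nat.
Local Notation P := {mpoly rat[N]}.
Implicit Types (J : P -> Prop) (t : P).

Definition scalar_mod J t := exists l : rat, J (t - l%:A).

(* Take q such that (J0 : q(t)) is maximal, a maximal ideal m above it, the
   minimal polynomial p of t modulo m, and J maximal among the ideals that
   contain (J0 : q(t)) and p(t)m but not p(t), so that (J : p(t)) = m.  If
   t^k - l were in J, then p^2 would divide the separable X^k - l. *)
Lemma line_transcendental J0 t t' : ideal J0 -> J0 (t * t' - 1) ->
  ~ algebraic_mod J0 t ->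
  exists J, [/\ cofinite J, forall b, J0 b -> J b, ~ J 1 &
    forall k, (0 < k)%N -> ~ scalar_mod J (t ^+ k)].
Proof.
move=> id0 tt' nalg.
pose ann (q : {poly rat}) := fun b : P => J0 (b * horner_alg t q).
have [||I [[q [q0 IE]] _ mI]] := @ideal_max _ _ (fun I => exists q, q != 0 /\ I = ann q) (ann 1).
- by move=> _ [q [_ ->]]; apply: ideal_colon.
- by exists 1; rewrite oner_eq0.
have idI : ideal I by rewrite IE; apply: ideal_colon.
have I1 : ~ I 1 by rewrite IE /ann mul1r => h; apply: nalg; exists q.
have sI b : J0 b -> I b by rewrite IE => h; apply: idealMr.
have [m [mm Im]] := maximal_above idI I1.
have [idm pm mmax] := mm.
have [p [p0 mp pmin]] := minpoly_mod idm (zariski t mm).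
set a := horner_alg t p in mp.
have id1 := ideal_add idI (ideal_mulr a idm).
have [|J [cJ sJ Ja [idm' pm' _]]] := residual (a := a) id1.
  (* If p(t) were in the sum, (1 - b) p(t) would lie in I for some b in m. Then 1 - b annihilates (p
     q)(t) modulo J0, so it lies in I by the maximal choice of q, and 1 would be in m. *)
  move=> [n [_ [In [b mb ->]] e]]; apply: pm.
  rewrite -(subrK b 1); apply: idealD => //; apply: Im.
  apply: (mI (ann (p * q))); first by exists (p * q); rewrite mulf_neq0.
    move=> c; rewrite IE /ann rmorphM /= mulrCA; exact: idealMl.
  rewrite /ann rmorphM /= mulrA mulrC -/a.
  have -> : (1 - b) * a = n by rewrite mulrBl mul1r [X in X - _]e mulrC addrK.
  by rewrite mulrC; move: In; rewrite IE.
have idJ := cJ.1.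
have sub0 b : J0 b -> J b.
  move=> h; apply: sJ; exists b, 0; rewrite addr0; split=> //; first exact: sI.
  by exists 0; rewrite ?mulr0 //; apply: ideal0.
have m'm b : J (b * a) -> m b.
  move=> h; apply: NNPP => /mmax[r mr]; apply: pm'.
  have : J ((r * b - 1) * a).
    apply: sJ; exists 0, (a * (r * b - 1)); split; [exact: (ideal0 idI)| |by rewrite add0r mulrC].
    by exists (r * b - 1).
  rewrite mulrBl => h'; apply/(ideal_eq idJ h').
  by rewrite -mulrA; apply: idealMl.
have J1 : ~ J 1 by move=> /(idealMl idJ a); rewrite mulr1.
exists J; split=> // k k0 [l Jl].
(* The case l = 0 is outside the scope of [sqr_dvd_XnsubC], but t is a unit modulo J. *)
have [l0|l0] := eqVneq l 0.
  apply: J1; move: Jl; rewrite l0 scale0r subr0 => Jt.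
  have Jtt : J (1 - (t * t') ^+ k).
    rewrite -opprB; apply: idealN => //.
    by rewrite subrX1; apply: idealMr => //; apply: sub0.
  by apply/(ideal_eq idJ Jtt); rewrite exprMn; apply: idealMr.
have hE : horner_alg t ('X^k - l%:P) = t ^+ k - l%:A.
  by rewrite rmorphB rmorphXn /= horner_algX horner_algC.
(* One factor p comes from J being contained in m, the second from J : p(t) being contained in m,
   applied to the cofactor g(t). *)
have /pmin /dvdpP[g eg] : m (horner_alg t ('X^k - l%:P)).
  by apply: m'm; rewrite hE; apply: idealMr.
have : m (horner_alg t g).
  by apply: m'm; rewrite /a -rmorphM /= -eg hE.
move=> /pmin /dvdpP[g' eg']; rewrite eg' -mulrA in eg.
have s1 : size p = 1%N.
  by apply: (sqr_dvd_XnsubC k0 l0); rewrite eg dvdp_mull.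
have /size_poly1P[c c0 pc] : size p == 1%N by rewrite s1.
apply: pm; move: mp; rewrite /a pc horner_algC => /(idealMl idm (c^-1)%:A).
by rewrite -scalerAl mul1r scalerA mulVf // scale1r.
Qed.

(* Enlarge the degree of the minimal polynomial of t modulo J by meeting J with
   residual ideals; it is bounded by the degree of q. *)
Lemma line_algebraic J0 t : ideal J0 -> ~ J0 1 -> algebraic_mod J0 t ->
  exists J, [/\ cofinite J, forall b, J0 b -> J b, ~ J 1 &
    forall p, J (horner_alg t p) -> J0 (horner_alg t p)].
Proof.
move=> id0 J01 [q q0 Jq].
suff H d : forall J p, cofinite J -> (forall b, J0 b -> J b) -> ~ J 1 -> p != 0 -> J (horner_alg t p) ->
  (forall r, J (horner_alg t r) -> p %| r) -> (size q - size p < d)%N ->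
  exists J, [/\ cofinite J, forall b, J0 b -> J b, ~ J 1 &
    forall p, J (horner_alg t p) -> J0 (horner_alg t p)].
  have [J [cJ sJ J1 _]] := residual id0 J01.
  have [|p [p0 Jp mp]] := minpoly_mod (t := t) cJ.1; first by exists q => //; apply: sJ.
  exact: (H _ J p).
elim: d => // d IH J p cJ sJ J1 p0 Jp mp le.
case: (classic (J0 (horner_alg t p))) => [J0p|nJ0p].
  by exists J; split=> // r /mp /dvdpP[g ->]; rewrite rmorphM /=; apply: idealMl.
have [J' [cJ' sJ' J'p _]] := residual id0 nJ0p.
have cJJ := cofinite_meet cJ cJ'.
have Jq' : J (horner_alg t q) /\ J' (horner_alg t q) by split; [apply: sJ|apply: sJ'].
have [|p' [p'0 [Jp' J'p'] mp']] := minpoly_mod (t := t) cJJ.1; first by exists q.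
have le' : (size p' <= size q)%N by apply: dvdp_leq => //; apply: mp'.
have lt : (size p < size p')%N.
  have pp' := mp _ Jp'; rewrite ltn_neqAle dvdp_leq // andbT.
  rewrite dvdp_size_eqp //; apply/negP => /eqpP[[c1 c2] /= /andP[c10 c20] e].
  apply: J'p; have -> : p = (c2 / c1)%:P * p'.
    by rewrite mul_polyC mulrC -scalerA -e scalerA mulVf // scale1r.
  by rewrite rmorphM; apply: idealMl => //; case: cJ'.
apply: (IH _ p' cJJ) => //.
- by move=> b Jb; split; [apply: sJ | apply: sJ'].
- by case.
- by rewrite ltnS in le; apply: leq_trans le; rewrite ltn_sub2l // (leq_trans lt).
Qed.

Lemma line_cofinite J0 t t' : ideal J0 -> J0 (t * t' - 1) ->
  (forall k, (0 < k)%N -> ~ scalar_mod J0 (t ^+ k)) ->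
  exists J, [/\ cofinite J, forall b, J0 b -> J b, ~ J 1 &
    forall k, (0 < k)%N -> ~ scalar_mod J (t ^+ k)].
Proof.
move=> id0 tt' no; case: (classic (algebraic_mod J0 t)); last exact: line_transcendental id0 tt'.
have J01 : ~ J0 1 by move=> h; apply: (no 1%N) => //; exists 0; exact: (ideal1 id0 _ h).
move=> /(line_algebraic id0 J01)[J [cJ sJ J1 h]]; exists J; split=> // k k0 [l Jl].
apply: (no k k0); exists l.
have hE : horner_alg t ('X^k - l%:P) = t ^+ k - l%:A.
  by rewrite rmorphB rmorphXn /= horner_algX horner_algC.
by rewrite -hE; apply: h; rewrite hE.
Qed.

Lemma scalar_modM J s t : ideal J -> scalar_mod J s -> scalar_mod J t -> scalar_mod J (s * t).
Proof.
move=> idJ [l Jl] [k Jk]; exists (l * k).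
have -> : s * t - (l * k)%:A = (s - l%:A) * t + l%:A * (t - k%:A).
  by rewrite mulrBl mulrBr -scalerA -[k *: 1]mul1r -!scalerAl !mul1r; ring.
by apply: idealD => //; [apply: idealMr|apply: idealMl].
Qed.

Lemma scalar_mod_eq J s t : ideal J -> J (s - t) -> scalar_mod J s -> scalar_mod J t.
Proof.
move=> idJ Jst [l Jl]; exists l.
have -> : t - l%:A = (s - l%:A) - (s - t) by ring.
exact: idealB.
Qed.

Lemma scale_int_eq0 n (z : int) (u : 'rV[int]_n) : (z *: u == 0) = (z == 0) || (u == 0).
Proof.
apply/eqP/orP => [e|[]/eqP->]; rewrite ?scale0r ?scaler0 //.
have [z0|z0] := eqVneq z 0; [by left|right]; apply/eqP/rowP => i.
by have /rowP/(_ i)/eqP := e; rewrite !mxE mulf_eq0 (negbTE z0) => /eqP.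
Qed.

(* T u plays the role of the Laurent monomial x^u. *)
Section RankLowering.
Variables (n : nat) (T : 'rV[int]_n -> P) (J0 : P -> Prop).
Hypotheses (id0 : ideal J0) (pJ0 : ~ J0 1).
Hypothesis TD : forall u v, J0 (T (u + v) - T u * T v).
Hypothesis T0 : J0 (T 0 - 1).
Hypothesis T_nonscalar : forall u, scalar_mod J0 (T u) -> u = 0.

Section Above.
Variable J : P -> Prop.
Hypotheses (idJ : ideal J) (sJ : forall b, J0 b -> J b) (pJ : ~ J 1).

Lemma scalarT0 : scalar_mod J (T 0).
Proof. by exists 1; rewrite scale1r; apply: sJ. Qed.

Lemma scalarTD u v : scalar_mod J (T u) -> scalar_mod J (T v) -> scalar_mod J (T (u + v)).
Proof.
move=> hu hv; apply: (scalar_mod_eq idJ _ (scalar_modM idJ hu hv)).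
by rewrite -opprB; apply: idealN => //; apply/sJ/TD.
Qed.

Lemma scalarTN u : scalar_mod J (T u) -> scalar_mod J (T (- u)).
Proof.
move=> [l Jl].
have h : J (1 - T u * T (- u)).
  have -> : 1 - T u * T (- u) = (T (u - u) - T u * T (- u)) - (T 0 - 1) by rewrite subrr; ring.
  by apply: idealB => //; apply: sJ => //; apply: TD.
have [l0|l0] := eqVneq l 0.
  case: pJ; move: Jl; rewrite l0 scale0r subr0 => Jl.
  by apply/(ideal_eq idJ h); apply: idealMr.
exists l^-1.
have -> : T (- u) - (l^-1)%:A = - ((l^-1)%:A * (T u - l%:A) * T (- u)) - (l^-1)%:A * (1 - T u * T (- u)).
  have e : (l^-1)%:A * l%:A = 1 :> P by rewrite -scalerAl mul1r scalerA mulVf // scale1r.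
  by rewrite mulrBr e; ring.
by apply: idealB; rewrite // ?mulNr; [apply: idealN => //; apply: idealMr => //|]; apply: idealMl.
Qed.

Lemma scalarTZ u (z : int) : scalar_mod J (T u) -> scalar_mod J (T (z *: u)).
Proof.
move=> hu; have pos k : scalar_mod J (T (k%:Z *: u)).
  elim: k => [|k IH]; first by rewrite scale0r; apply: scalarT0.
  by rewrite intS scalerDl scale1r; apply: scalarTD.
by case: z => k //; rewrite NegzE scaleNr; apply/scalarTN.
Qed.

End Above.

Lemma TX u k : J0 (T (k%:Z *: u) - T u ^+ k).
Proof.
elim: k => [|k IH]; first by rewrite scale0r expr0.
rewrite intS scalerDl scale1r exprS.
have -> : T (u + k%:Z *: u) - T u * T u ^+ k =
  (T (u + k%:Z *: u) - T u * T (k%:Z *: u)) + T u * (T (k%:Z *: u) - T u ^+ k) by ring.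
by apply: idealD => //; apply: idealMl.
Qed.

Lemma line_T u : u != 0 -> exists J, [/\ cofinite J, forall b, J0 b -> J b, ~ J 1 &
  forall z : int, z != 0 -> ~ scalar_mod J (T (z *: u))].
Proof.
move=> u0.
have tt' : J0 (T u * T (- u) - 1).
  have -> : T u * T (- u) - 1 = (T 0 - 1) - (T (u - u) - T u * T (- u)) by rewrite subrr; ring.
  by apply: idealB => //; apply: TD.
have [|J [cJ sJ J1 h]] := line_cofinite id0 tt'.
  move=> k k0 sc; have : scalar_mod J0 (T (k%:Z *: u)).
    by apply: (scalar_mod_eq id0 _ sc); rewrite -opprB; apply: idealN => //; apply: TX.
  move/T_nonscalar/eqP; rewrite scale_int_eq0 (negbTE u0) orbF => /eqP[] k00.
  by rewrite k00 in k0.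
exists J; split=> //.
have pos k : (0 < k)%N -> ~ scalar_mod J (T (k%:Z *: u)).
  by move=> k0 sc; apply: (h k k0); apply: (scalar_mod_eq cJ.1 _ sc); apply: sJ; apply: TX.
case=> k z0; first by apply: pos; case: k z0.
by rewrite NegzE scaleNr => /(scalarTN cJ.1 sJ J1); rewrite opprK; apply: pos.
Qed.

(** Otherwise there are, for every k, an ideal J and a k-dimensional rational subspace U containing
    no nonzero relation of J, which is absurd for k = n + 1. To enlarge U, take a nonzero relation u
    of J, necessarily outside U, and meet J with a J' for which no nonzero multiple of u is a
    relation; then U + Q u serves. *)
Lemma rank_lowering : exists J, [/\ cofinite J, forall b, J0 b -> J b, ~ J 1 &
  forall u, scalar_mod J (T u) -> u = 0].
Proof.
apply: NNPP => no.
suff H k : exists J (U : 'M[rat]_(k, n)), [/\ cofinite J, forall b, J0 b -> J b, ~ J 1, row_free U &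
    forall w : 'rV[int]_n, (map_mx intr w <= U)%MS -> scalar_mod J (T w) -> w = 0].
  have [J [U [_ _ _ fU _]]] := H n.+1.
  by move: fU; rewrite /row_free => /eqP e; have := rank_leq_col U; rewrite e ltnn.
have injw : injective (map_mx intr : 'rV[int]_n -> 'rV[rat]_n).
  by move=> u v /rowP e; apply/rowP => i; have := e i; rewrite !mxE => /intr_inj.
elim: k => [|k [J [U [cJ sJ J1 fU hU]]]].
  have [J [cJ sJ J1 _]] := residual id0 pJ0; exists J, 0; split=> //.
    by rewrite /row_free mxrank0.
  by move=> w /submx0null w0 _; apply: injw; rewrite w0 map_mx0.
case: (classic (exists2 u, scalar_mod J (T u) & u != 0)) => [[u su u0]|nu]; last first.
  case: no; exists J; split=> // u su; apply/eqP/negPn/negP => u0; apply: nu; by exists u.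
have [J' [cJ' sJ' J'1 hJ']] := line_T u0.
exists (fun a => J a /\ J' a).
suff [U' fU' hU'] : exists2 U' : 'M[rat]_(k.+1, n), row_free U' &
    forall w : 'rV[int]_n, (map_mx intr w <= U')%MS ->
      exists (p q : int), q != 0 /\ (map_mx intr (q *: w - p *: u) <= U)%MS.
  exists U'; split=> //.
  - exact: cofinite_meet.
  - by move=> b Jb; split; [apply: sJ|apply: sJ'].
  - by case.
  move=> w /hU'[p [q [q0 wU]]] [l [Jl J'l]].
  have sw : scalar_mod J (T w) by exists l.
  (* Both w and u are relations of J, and this combination lies in U. From q w = p u, a relation of
     J', then follows p = 0. *)
  have e0 : q *: w - p *: u = 0.
    apply: hU wU _; apply: (scalarTD cJ.1 sJ); first exact: (scalarTZ cJ.1 sJ J1).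
    by apply: (scalarTN cJ.1 sJ J1); apply: (scalarTZ cJ.1 sJ J1).
  have e : q *: w = p *: u by apply/eqP; rewrite -subr_eq0 e0.
  have p0 : p = 0.
    apply/eqP/negPn/negP => /hJ'; apply; rewrite -e; apply: (scalarTZ cJ'.1 sJ' J'1).
    by exists l.
  by move: e; rewrite p0 scale0r => /eqP; rewrite scale_int_eq0 (negbTE q0) => /eqP.
have nuU : ~~ (map_mx intr u <= U)%MS by apply/negP => /hU/(_ su)/eqP; rewrite (negbTE u0).
rewrite -[k.+1]addn1; exists (col_mx U (map_mx intr u)).
  apply: inj_row_free => v; rewrite -(hsubmxK v) mul_row_col => e.
  have [c e2] : exists c, rsubmx v = c%:M.
    by exists (rsubmx v 0 0); apply/matrixP => i j; rewrite !ord1 !mxE mulr1n.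
  rewrite e2 mul_scalar_mx in e *.
  have c0 : c = 0.
    apply/eqP/negPn/negP => c0; case/negP: nuU.
    have -> : map_mx intr u = (- c^-1 *: lsubmx v) *m U.
      apply/eqP; rewrite -scalemxAl scaleNr -addr_eq0 addrC; apply/eqP.
      move: e => /(congr1 (fun x => c^-1 *: x)).
      by rewrite /= scaler0 scalerDr scalerA mulVf // scale1r.
    exact: submxMl.
  move: e; rewrite c0 scale0r addr0 => e.
  have -> : lsubmx v = 0 by apply: (row_free_inj fU); rewrite mul0mx.
  by rewrite raddf0 row_mx0.
move=> w; rewrite -addsmxE => /sub_addsmxP[[a c] /= e].
have [c' e2] : exists c', c = c'%:M.
  by exists (c 0 0); apply/matrixP => i j; rewrite !ord1 !mxE mulr1n.
exists (numq c'), (denq c'); split; first exact: denq_neq0.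
have -> : map_mx intr (denq c' *: w - numq c' *: u) = ((denq c')%:~R *: a) *m U :> 'rV[rat]_n.
  rewrite map_mxB !map_mxZ /= e e2 mul_scalar_mx scalerDr -scalemxAl scalerA.
  by rewrite mulrC -numqE addrK.
exact: submxMl.
Qed.

End RankLowering.
End Lines.

(** * Commuting matrices: exponential, Jordan decomposition, joint spectrum *)

Section FiniteDimensional.
Variables (K : fieldType) (N : nat).
Local Notation P := {mpoly K[N]}.
Variable J : P -> Prop.
Hypotheses (cJ : cofinite J) (pJ : ~ J 1).
Let idJ : ideal J := cJ.1.

Definition lincomb d (e : 'I_d -> P) (c : 'rV[K]_d) : P := \sum_i c 0 i *: e i.

Lemma lincombD d (e : 'I_d -> P) a b : lincomb e (a + b) = lincomb e a + lincomb e b.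
Proof. by rewrite -big_split; apply: eq_bigr => i _; rewrite !mxE scalerDl. Qed.

Lemma lincombZ d (e : 'I_d -> P) c a : lincomb e (c *: a) = c *: lincomb e a.
Proof. by rewrite scaler_sumr; apply: eq_bigr => i _; rewrite !mxE scalerA. Qed.

Lemma lincombB d (e : 'I_d -> P) a b : lincomb e (a - b) = lincomb e a - lincomb e b.
Proof. by rewrite lincombD -scaleN1r lincombZ scaleN1r. Qed.

Lemma lincomb_delta d (e : 'I_d -> P) i : lincomb e (delta_mx 0 i) = e i.
Proof.
rewrite /lincomb (bigD1 i) //= !mxE !eqxx scale1r big1 ?addr0 // => j ji.
by rewrite !mxE (negbTE ji) scale0r.
Qed.

Lemma idealZ c (a : P) : J a -> J (c *: a).
Proof. by rewrite -[c *: a]mulr_algl; apply: idealMl. Qed.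

Definition spans d (e : 'I_d -> P) := forall p, exists c, J (p - lincomb e c).

(** Let D_i be the degree of a polynomial in x_i lying in J. The monomials of degree at most the sum
    of the D_i span: any other has some exponent at least D_i, and that polynomial rewrites it in
    monomials of lower degree. *)
Lemma spans_ex : exists d (e : 'I_d -> P), spans e.
Proof.
have alg i : exists p : {poly K}, p != 0 /\ J (horner_alg 'X_i p).
  by have [p p0 Jp] := cJ.2 i; exists p.
have [p hp] := choice_fun alg.
pose D i := (size (p i)).-1; pose b := (\sum_i D i).+1.
pose E : seq 'X_{1..N} := [seq val m | m <- enum {: 'X_{1..N < b}}].
pose e (i : 'I_(size E)) : P := 'X_[tnth (in_tuple E) i].
exists (size E), e.
have sX m : exists c, J ('X_[m] - lincomb e c).
  have [k] : exists k, (mdeg m < k)%N by exists (mdeg m).+1.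
  elim: k m => // k IH m; rewrite ltnS => mk.
  case: (ltnP (mdeg m) b) => [mb|bm].
    have mE : m \in E by apply: (map_f val (x := BMultinom mb)); rewrite mem_enum.
    have [i ei] := tnthP (in_tuple E) m mE.
    exists (delta_mx 0 i); rewrite lincomb_delta /e -ei subrr; exact: ideal0.
  have [i Di] : exists i, (D i <= m i)%N.
    apply: NNPP => no; move: bm; rewrite ltnNge => /negP; apply.
    rewrite mdegE; apply: leq_sum => i _; rewrite leqNgt; apply/negP => h.
    by apply: no; exists i; apply: ltnW.
  have [pi0 Jpi] := hp i.
  have sp : size (p i) = (D i).+1 by rewrite prednK // lt0n size_poly_eq0.
  pose m' := (m - U_(i) *+ D i)%MM.
  have mE k' : 'X_[m' + U_(i) *+ k'] = 'X_[m'] * 'X_i ^+ k' :> P.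
    by rewrite mpolyXD mpolyXn.
  have mm : m = (m' + U_(i) *+ D i)%MM.
    apply/mnmP => j; rewrite mnmDE mnmBE mulmnE mnm1E.
    by case: eqP => [<-|_]; rewrite ?mul1n ?mul0n ?subn0 ?addn0 // subnK.
  have dm k' : mdeg (m' + U_(i) *+ k')%MM = (mdeg m' + k')%N.
    by rewrite mdegD mdegMn mdeg1 mul1n.
  have lower (k' : 'I_(D i)) : exists c, J ('X_[m' + U_(i) *+ k'] - lincomb e c).
    by apply: IH; rewrite dm; apply: leq_trans mk; rewrite [X in (_ < mdeg X)%N]mm dm ltn_add2l.
  have [c hc] := choice_fun lower.
  exists (- \sum_(k' < D i) ((p i)`_k' / lead_coef (p i)) *: c k').
  have -> : lincomb e (- \sum_(k' < D i) ((p i)`_k' / lead_coef (p i)) *: c k') =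
    - \sum_(k' < D i) ((p i)`_k' / lead_coef (p i)) *: lincomb e (c k').
    rewrite -scaleN1r lincombZ scaleN1r; congr (- _).
    elim/big_rec2: _ => [|k' x y _ <-]; last by rewrite lincombD lincombZ.
    by rewrite -(scale0r (0 : 'rV_(size E))) lincombZ scale0r.
  have l0 : lead_coef (p i) != 0 by rewrite lead_coef_eq0.
  have h1 : J ('X_[m'] * ((lead_coef (p i))^-1 *: horner_alg 'X_i (p i))).
    by apply: idealMl => //; apply: idealZ.
  have h2 : J (\sum_(k' < D i) ((p i)`_k' / lead_coef (p i)) *: ('X_[m' + U_(i) *+ k'] - lincomb e (c k'))).
    by apply: ideal_sum => // k' _; apply: idealZ.
  have : J ('X_[m'] * ((lead_coef (p i))^-1 *: horner_alg 'X_i (p i)) -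
      \sum_(k' < D i) ((p i)`_k' / lead_coef (p i)) *: ('X_[m' + U_(i) *+ k'] - lincomb e (c k'))).
    exact: idealB.
  congr (J _); rewrite opprK.
  have -> : horner_alg 'X_i (p i) = \sum_(k' < (D i).+1) (p i)`_k' *: 'X_i ^+ k' :> P.
    rewrite -sp -{1}(coefK (p i)) poly_def rmorph_sum /=. apply: eq_bigr => j _.
    by rewrite linearZ /= rmorphXn /= horner_algX mulr_algl.
  rewrite big_ord_recr /= scalerDr mulrDr scalerA -[(p i)`__](lead_coefE (p i)) mulVf // scale1r.
  rewrite [X in _ = 'X_[X] + _]mm mE addrAC addrC. congr (_ + _).
  rewrite scaler_sumr mulr_sumr -sumrB; apply: eq_bigr => k' _.
  by rewrite scalerBr mE opprB scalerA -scalerAr [_^-1 * _]mulrC addrC subrK.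
move=> q; elim/mpolyind: q => [|a m q _ _ [c hc]].
  exists 0; rewrite /lincomb big1 ?subrr; first exact: ideal0.
  by move=> i _; rewrite mxE scale0r.
have [c' hc'] := sX m; exists (a *: c' + c).
rewrite lincombD lincombZ opprD addrACA -scalerBr.
by apply: idealD => //; apply: idealZ.
Qed.

Lemma basis_ex : exists d (e : 'I_d -> P), spans e /\ forall c, J (lincomb e c) -> c = 0.
Proof.
have [d [e se]] := spans_ex.
elim: d e se => [|d IH] e se; first by exists 0%N, e; split=> // c _; apply/rowP => -[].
case: (classic (forall c, J (lincomb e c) -> c = 0)) => [h|no]; first by exists d.+1, e.
have [c nc] := not_all_ex_not _ _ no.
have [Jc /eqP/rV0Pn[i ci]] := imply_to_and _ _ nc.
apply: (IH (e \o lift i)) => p; have [a Ja] := se p.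
exists (\row_j (a - (a 0 i / c 0 i) *: c) 0 (lift i j)).
have -> : lincomb (e \o lift i) (\row_j (a - (a 0 i / c 0 i) *: c) 0 (lift i j)) =
    lincomb e (a - (a 0 i / c 0 i) *: c).
  rewrite /lincomb (bigD1_ord i) //= !mxE divfK // subrr scale0r add0r.
  by apply: eq_bigr => j _; rewrite !mxE.
rewrite lincombB lincombZ opprB addrCA.
by apply: idealD => //; apply: idealZ.
Qed.

End FiniteDimensional.

(** The matrices of multiplication by x_i modulo J, acting on rows of coordinates. A polynomial that
    acts as 0 sends 1 to 0, so it lies in J. *)
Lemma matrix_representation (K : fieldType) N (J : {mpoly K[N]} -> Prop) :
    cofinite J -> ~ J 1 ->
  exists d (M : 'I_N -> 'M[K]_d.+1), (forall i j, GRing.comm (M i) (M j)) /\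
    forall p, J p <-> mmap (@scalar_mx K d.+1) M p = 0.
Proof.
move=> cJ pJ; have idJ := cJ.1.
have [d0 [e0 [se0 ie0]]] := basis_ex cJ.
(* The dimension is positive because 1 is not in J; this makes the matrices a nonzero ring. *)
have [d [e [se ie]]] : exists d (e : 'I_d.+1 -> {mpoly K[N]}), spans J e /\ forall c, J (lincomb e c) -> c = 0.
  case: d0 e0 se0 ie0 => [|d] e se ie; last by exists d, e.
  by case: pJ; have [c] := se 1; rewrite /lincomb big_ord0 subr0.
have [phi hphi] := choice_fun se.
have phiE p c : J (p - lincomb e c) -> phi p = c.
  move=> h; apply/eqP; rewrite -subr_eq0; apply/eqP/ie.
  rewrite lincombB; have -> : lincomb e (phi p) - lincomb e c =
    (p - lincomb e c) - (p - lincomb e (phi p)) by ring.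
  exact: idealB.
have phiD p q : phi (p + q) = phi p + phi q.
  by apply: phiE; rewrite lincombD opprD addrACA; apply: idealD.
have phiZ c p : phi (c *: p) = c *: phi p.
  by apply: phiE; rewrite lincombZ -scalerBr; apply: idealZ.
have phi0 : phi 0 = 0 by rewrite -(scale0r 0) phiZ scale0r.
have phiJ p : J p <-> phi p = 0.
  have e00 : lincomb e 0 = 0 by rewrite /lincomb big1 // => i _; rewrite mxE scale0r.
  split=> [Jp|p0]; first by apply: phiE; rewrite e00 subr0.
  by have := hphi p; rewrite p0 e00 subr0.
have phie k : phi (e k) = delta_mx 0 k.
  by apply: phiE; rewrite lincomb_delta subrr; apply: ideal0.
pose M i : 'M[K]_d.+1 := \matrix_k phi ('X_i * e k).
have phiM q i : phi ('X_i * q) = phi q *m M i.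
  have -> : phi ('X_i * q) = phi ('X_i * lincomb e (phi q)).
    apply/eqP; rewrite -subr_eq0 -scaleN1r -phiZ -phiD scaleN1r -mulrBr; apply/eqP/phiJ.
    exact: idealMl.
  rewrite /lincomb mulr_sumr mulmx_sum_row.
  have -> : phi (\sum_i0 'X_i * (phi q 0 i0 *: e i0)) = \sum_i0 phi ('X_i * (phi q 0 i0 *: e i0)).
    exact: (big_morph phi phiD phi0).
  by apply: eq_bigr => k _; rewrite -scalerAr phiZ rowK.
have comm i j : GRing.comm (M i) (M j).
  apply/row_matrixP => k; rewrite !rowE -!mulmxE !mulmxA -phie -!phiM.
  by rewrite mulrCA.
have phiXn q i k : phi ('X_i ^+ k * q) = phi q *m M i ^+ k.
  elim: k q => [|k IH] q; first by rewrite !expr0 mul1r mulmx1.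
  by rewrite exprSr -mulrA IH phiM exprS -mulmxE mulmxA.
have phiX q m : phi ('X_[m] * q) = phi q *m mmap1 M m.
  rewrite mpolyXE_id /mmap1; elim: (index_enum _) q => [|i r IH] q.
    by rewrite !big_nil mul1r mulmx1.
  by rewrite !big_cons -mulrA mulrCA IH phiXn -mulmxE mulmxA.
have phip q p : phi (p * q) = phi q *m mmap (@scalar_mx K d.+1) M p.
  elim/mpolyind: p q => [|c m p _ _ IH] q; first by rewrite mul0r phi0 raddf0 mulmx0.
  rewrite mulrDl phiD -scalerAl phiZ phiX IH raddfD /= mulmxDr; congr (_ + _).
  by rewrite mmapZ mmapX -mulmxE mulmxA mul_mx_scalar scalemxAl.
exists d, M; split=> // p; split=> [Jp|Mp]; last first.
  by apply/phiJ; rewrite -[p]mulr1 phip Mp mulmx0.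
apply/row_matrixP => k; rewrite rowE -phie -phip row0.
by apply/phiJ; apply: idealMr.
Qed.

Section CommutingProducts.
Variable A : nzRingType.

Lemma comm_prod (I : Type) (r : seq I) (F : I -> A) x :
  (forall i, GRing.comm x (F i)) -> GRing.comm x (\prod_(i <- r) F i).
Proof. by move=> h; elim/big_ind: _ => //; [apply: commr1|move=> *; apply: commrM]. Qed.

Lemma comm_prod_split (I : Type) (r : seq I) (F G : I -> A) :
  (forall i j, GRing.comm (F i) (G j)) ->
  \prod_(i <- r) (F i * G i) = (\prod_(i <- r) F i) * (\prod_(i <- r) G i).
Proof.
move=> h; elim: r => [|i r IH]; first by rewrite !big_nil mulr1.
rewrite !big_cons IH !mulrA; congr (_ * _); rewrite -!mulrA; congr (_ * _).
by apply/esym; rewrite commr_sym //; apply: comm_prod => j; rewrite /GRing.comm h.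
Qed.

Variable n : nat.
Implicit Types (M : 'I_n -> A) (m : 'X_{1..n}).

Lemma comm_mmap1D M m m' : (forall i j, GRing.comm (M i) (M j)) ->
  mmap1 M (m + m') = mmap1 M m * mmap1 M m'.
Proof.
move=> h; rewrite /mmap1 -comm_prod_split; last first.
  by move=> i j; apply/commrX/commr_sym/commrX/commr_sym.
by apply: eq_bigr => i _; rewrite mnmDE exprD.
Qed.

Lemma comm_mmap1M M M' m : (forall i j, GRing.comm (M i) (M' j)) ->
  mmap1 (fun i => M i * M' i) m = mmap1 M m * mmap1 M' m.
Proof.
move=> h; rewrite /mmap1 -comm_prod_split; last first.
  by move=> i j; apply/commrX/commr_sym/commrX/commr_sym.
by apply: eq_bigr => i _; rewrite exprMn_comm.
Qed.

Lemma mmap1_inv M M' m : (forall i j, GRing.comm (M i) (M' j)) ->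
  (forall i, M i * M' i = 1) -> mmap1 M m * mmap1 M' m = 1.
Proof.
move=> h e; rewrite -comm_mmap1M // /mmap1 big1 // => i _.
by rewrite e expr1n.
Qed.

End CommutingProducts.

(** * Exponential and logarithm of nilpotent and unipotent elements *)

Section Exponential.
Variable A : algType rat.
Implicit Types (T E : A).

Definition facV (k : nat) : rat := k`!%:R^-1.

Lemma facV0 : facV 0 = 1. Proof. by rewrite /facV fact0 invr1. Qed.
Lemma facV1 : facV 1 = 1. Proof. by rewrite /facV (factS 0) fact0 invr1. Qed.

Definition exp_trunc D T : A := \sum_(k < D) facV k *: T ^+ k.

(** A relation rather than a function of T: the order of truncation is any D that kills T, and
    [is_exp_uniq] shows that its choice does not matter. *)
Definition is_exp T E := exists2 D, T ^+ D = 0 & E = exp_trunc D T.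

Lemma expr_nil_ge D D' T : T ^+ D = 0 -> (D <= D')%N -> T ^+ D' = 0.
Proof. by move=> h le; rewrite -(subnKC le) exprD h mul0r. Qed.

Lemma exp_trunc_ext D D' T : T ^+ D = 0 -> (D <= D')%N -> exp_trunc D' T = exp_trunc D T.
Proof.
move=> h le; rewrite /exp_trunc -(big_mkord xpredT (fun k => facV k *: T ^+ k)).
rewrite (big_cat_nat (n := D)) //= big_mkord [X in _ + X]big_nat_cond [X in _ + X]big1 ?addr0 //.
by move=> k /andP[/andP[Dk _] _]; rewrite (expr_nil_ge h Dk) scaler0.
Qed.

Lemma is_exp_uniq T E E' : is_exp T E -> is_exp T E' -> E = E'.
Proof.
move=> [D TD ->] [D' TD' ->].
by rewrite -(exp_trunc_ext TD (leq_maxl D D')) -(exp_trunc_ext TD' (leq_maxr D D')).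
Qed.

Lemma is_exp0 : is_exp 0 1.
Proof.
exists 1%N; rewrite ?expr1 // /exp_trunc big_ord_recl big_ord0.
by rewrite expr0 facV0 scale1r addr0.
Qed.

Lemma is_exp_trunc D T : T ^+ D = 0 -> is_exp T (exp_trunc D T).
Proof. by exists D. Qed.

Lemma comm_exp_trunc D T x : GRing.comm x T -> GRing.comm x (exp_trunc D T).
Proof.
move=> h; rewrite /exp_trunc; elim/big_ind: _ => [|u v|k _]; [exact: commr0|exact: commrD|].
by rewrite /GRing.comm -scalerAr -scalerAl; congr (_ *: _); apply: commrX.
Qed.

(** The Cauchy product. With a common nilpotency order D and all sums cut at D + D, the terms
    outside the triangle i + j < D + D vanish. *)
Lemma is_expD T T' E E' : GRing.comm T T' -> is_exp T E -> is_exp T' E' ->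
  is_exp (T + T') (E * E').
Proof.
move=> cTT [D0 TD0 ->] [D0' TD0' ->]; pose D := maxn D0 D0'.
have TD : T ^+ D = 0 by apply: expr_nil_ge TD0 (leq_maxl _ _).
have TD' : T' ^+ D = 0 by apply: expr_nil_ge TD0' (leq_maxr _ _).
have le2 : (D <= D + D)%N by apply: leq_addr.
rewrite -(exp_trunc_ext TD0 (leq_maxl D0 D0')) -(exp_trunc_ext TD0' (leq_maxr D0 D0')) -/D.
have van i j : (D + D <= i + j)%N -> T ^+ i * T' ^+ j = 0.
  move=> h; case: (leqP D i) => Di; first by rewrite (expr_nil_ge TD Di) mul0r.
  rewrite (expr_nil_ge TD' (_ : D <= j)%N) ?mulr0 //.
  by rewrite -(leq_add2l D); apply: leq_trans h _; rewrite leq_add2r ltnW.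
exists (D + D)%N.
  rewrite exprDn_comm // big1 // => i _; rewrite van ?mul0rn // subnK //.
  by rewrite -ltnS.
rewrite -(exp_trunc_ext TD le2) -(exp_trunc_ext TD' le2) /exp_trunc.
pose F i j := (facV i * facV j) *: (T ^+ i * T' ^+ j).
have -> : (\sum_(k < D + D) facV k *: T ^+ k) * (\sum_(k < D + D) facV k *: T' ^+ k)
    = \sum_(0 <= j < D + D) \sum_(0 <= i < D + D) F i j.
  rewrite big_mkord mulr_sumr; apply: eq_bigr => j _; rewrite mulr_suml big_mkord.
  by apply: eq_bigr => i _; rewrite /F -scalerAl -scalerAr scalerA.
have -> : \sum_(k < D + D) facV k *: (T + T') ^+ k =
    \sum_(0 <= k < D + D) \sum_(0 <= j < D + D | (j <= k)%N) F (k - j)%N j.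
  rewrite [RHS]big_mkord; apply: eq_bigr => k _; rewrite exprDn_comm // scaler_sumr.
  rewrite -(big_mkord xpredT (fun j => facV k *: (T ^+ (k - j) * T' ^+ j *+ 'C(k, j)))).
  rewrite [RHS](big_cat_nat (n := k.+1)) //= [X in _ = _ + X]big_nat_cond [X in _ = _ + X]big1 ?addr0; last first.
    by move=> j /andP[/andP[+ _] +]; rewrite leqNgt => /negbTE; rewrite ltnS => ->.
  rewrite big_nat_cond [RHS]big_nat_cond; apply: eq_big => [j|j]; first by rewrite /= ltnS; case: (j <= k)%N.
  rewrite ltnS => /andP[jk _]; rewrite /F /facV -scaler_nat scalerA; congr (_ *: _).
  have f0 m : (m`!%:R : rat) != 0 by rewrite pnatr_eq0 -lt0n fact_gt0.
  rewrite -(bin_fact jk) !natrM.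
  have := f0 j; have := f0 (k - j)%N; have : 'C(k, j)%:R != 0 :> rat by rewrite pnatr_eq0 -lt0n bin_gt0.
  by move: ('C(k, j)%:R) (j`!%:R) ((k - j)`!%:R) => x y z x0 y0 z0; field; rewrite x0 y0 z0.
rewrite [RHS](exchange_big_dep xpredT) //=; apply: eq_big_nat => j /andP[_ jD].
rewrite (big_cat_nat (n := (D + D - j)%N)) ?leq_subr //= [X in _ + X = _]big_nat_cond [X in _ + X = _]big1 ?addr0; last first.
  move=> i /andP[/andP[ge _] _]; rewrite /F van ?scaler0 //.
  by rewrite [(i + j)%N]addnC -leq_subLR.
rewrite [RHS](big_cat_nat (n := j)) ?(ltnW jD) //= [X in _ = X + _]big_nat_cond [X in _ = X + _]big1 ?add0r; last first.
  by move=> i /andP[/andP[_ lt]]; rewrite leqNgt lt.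
have eqadd := @big_addn A 0 +%R 0 (D + D) j (fun k => (j <= k)%N) (fun k => F (k - j)%N j).
rewrite add0n in eqadd; rewrite [RHS]eqadd.
by apply: eq_big => i; rewrite ?addnK // leq_addl.
Qed.

Lemma is_expN T : (exists D, T ^+ D = 0) -> exists E, is_exp (- T) E.
Proof.
move=> [D TD]; exists (exp_trunc D (- T)); apply: is_exp_trunc.
by rewrite exprNn TD mulr0.
Qed.

Lemma is_exp_mulV T E E' : is_exp T E -> is_exp (- T) E' -> E * E' = 1.
Proof.
move=> h h'; apply: is_exp_uniq is_exp0; rewrite -(subrr T).
by apply: is_expD => //; apply: commrN.
Qed.

Lemma is_expX T E k : is_exp T E -> is_exp (T *+ k) (E ^+ k).
Proof.
move=> h; elim: k => [|k IH]; first by rewrite mulr0n expr0; apply: is_exp0.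
by rewrite mulrS exprS; apply: is_expD => //; apply: commrMn.
Qed.

Lemma is_exp_sum (I : Type) (r : seq I) (T E : I -> A) :
  (forall i j, GRing.comm (T i) (T j)) -> (forall i, is_exp (T i) (E i)) ->
  is_exp (\sum_(i <- r) T i) (\prod_(i <- r) E i).
Proof.
move=> c h; elim: r => [|i r IH]; first by rewrite !big_nil; apply: is_exp0.
rewrite !big_cons; apply: is_expD => //.
by elim/big_ind: _ => //; [apply: commr0 | move=> *; apply: commrD].
Qed.

Lemma exp_trunc_sub1 D T : exists2 z, GRing.comm T z & exp_trunc D.+1 T = 1 + T * z.
Proof.
exists (\sum_(k < D) facV k.+1 *: T ^+ k).
  elim/big_ind: _ => [|u v|k _]; [exact: commr0|exact: commrD|].
  by rewrite /GRing.comm -scalerAr -scalerAl -exprS -exprSr.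
rewrite /exp_trunc big_ord_recl expr0 facV0 scale1r mulr_sumr; congr (_ + _).
by apply: eq_bigr => k _; rewrite -scalerAr -exprS.
Qed.

Lemma is_exp_unipotent T E : is_exp T E -> exists D, (E - 1) ^+ D = 0.
Proof.
move=> [D TD ->]; exists D.
rewrite -(exp_trunc_ext TD (leqnSn D)); have [z cz ->] := exp_trunc_sub1 D T.
by rewrite addrC addKr exprMn_comm // TD mul0r.
Qed.

(** If T^(j+2) = 0, then T^j (exp T - 1) = T^(j+1), so exp T = 1 lowers the nilpotency order step by
    step. *)
Lemma is_exp1 T : is_exp T 1 -> T = 0.
Proof.
move=> [D TD e].
have H j : T ^+ j.+1 = 0 -> T = 0.
  elim: j => [|j IH] Tj; first by rewrite -[T]expr1.
  apply: IH.
  have := e; rewrite -(exp_trunc_ext TD (leqW (leqnSn D))) /exp_trunc 2!big_ord_recl.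
  rewrite expr0 facV0 scale1r => /(congr1 (fun x => T ^+ j * (x - 1))).
  rewrite subrr mulr0 addrC addKr mulrDr expr1 facV1 scale1r -exprSr mulr_sumr.
  rewrite big1 ?addr0 // => k _.
  rewrite -scalerAr -exprD (expr_nil_ge Tj) ?scaler0 //.
  by rewrite /bump /= -addn2 leq_add2l.
by apply: (H D); rewrite exprS TD mulr0.
Qed.

(* Divide 1 + nu^k q by exp(nu^k q), which leaves a unit of higher order. *)
Lemma log_ex (nu : A) : (exists N, nu ^+ N = 0) ->
  exists p, is_exp (horner_alg nu p) (1 + nu).
Proof.
move=> [N nuN].
suff H d : forall k q, (N - k <= d)%N -> (0 < k)%N ->
    exists p, is_exp (horner_alg nu ('X * p)) (1 + horner_alg nu ('X^k * q)).
  have [p hp] := H N 1%N 1 (leq_subr _ _) isT.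
  by exists ('X * p); move: hp; rewrite mulr1 expr1 (horner_algX nu).
have nil (q : {poly rat}) : (horner_alg nu ('X * q)) ^+ N = 0.
  by rewrite -rmorphXn exprMn rmorphM /= rmorphXn /= horner_algX nuN mul0r.
have base k q : (N <= k)%N -> exists p, is_exp (horner_alg nu ('X * p)) (1 + horner_alg nu ('X^k * q)).
  move=> Nk; exists 0; rewrite mulr0 rmorph0 rmorphM rmorphXn /= horner_algX.
  by rewrite (expr_nil_ge nuN Nk) mul0r addr0; apply: is_exp0.
elim: d => [|d IH] k q le k0.
  by apply: base; rewrite -subn_eq0 -leqn0.
case: (leqP N k) => [|kN]; first exact: base.
case: k k0 le kN => // k _ le kN.
pose eta : {poly rat} := 'X^(k.+1) * q.
rewrite -/eta.
have etaE : eta = 'X * ('X^k * q) by rewrite /eta exprS mulrA.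
have commh u v : GRing.comm (horner_alg nu u) (horner_alg nu v).
  by rewrite /GRing.comm -!rmorphM mulrC.
have [z0 ez0] : exists z, exp_trunc N (- horner_alg nu eta) = horner_alg nu (1 - eta + eta * eta * z).
  have N2 : (N <= N.+2)%N by rewrite -addn2 leq_addr.
  exists (\sum_(i < N) facV i.+2 *: (- eta) ^+ i).
  have -> : exp_trunc N (- horner_alg nu eta) = exp_trunc N.+2 (- horner_alg nu eta).
    by rewrite (exp_trunc_ext _ N2) // exprNn etaE nil mulr0.
  rewrite /exp_trunc 2!big_ord_recl expr0 expr1 facV0 facV1 !scale1r addrA rmorphD rmorphB rmorph1 /=.
  congr (_ + _); rewrite mulr_sumr rmorph_sum; apply: eq_bigr => i _ /=.
  rewrite -scalerAr linearZ /= mulr_algl -rmorphN -rmorphXn /=; congr (_ *: horner_alg _ _).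
  by rewrite !exprS mulrA mulrNN.
(* Since exp(-eta) = 1 - eta + eta^2 z0, the quotient (1 + eta) exp(-eta) is 1 + eta^2 (-1 + z0 +
   eta z0). With eta = X^(k+1) q the correction is divisible by X^(k+2). *)
have [p hp] : exists p, is_exp (horner_alg nu ('X * p)) (1 + horner_alg nu ('X^(k.+2) * ('X^k * (q * q) * (-1 + z0 + eta * z0)))).
  by apply: IH => //; rewrite subnS; move: le; case: (N - k.+1)%N.
exists (p + 'X^k * q).
have -> : horner_alg nu ('X * (p + 'X^k * q)) = horner_alg nu ('X * p) + horner_alg nu eta.
  by rewrite -rmorphD mulrDr etaE.
have -> : 1 + horner_alg nu eta = (1 + horner_alg nu ('X^(k.+2) * ('X^k * (q * q) * (-1 + z0 + eta * z0)))) * exp_trunc N (horner_alg nu eta).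
  have E1 : exp_trunc N (- horner_alg nu eta) * exp_trunc N (horner_alg nu eta) = 1.
    apply: (is_exp_mulV (T := - horner_alg nu eta)); first by apply: is_exp_trunc; rewrite exprNn etaE nil mulr0.
    by rewrite opprK; apply: is_exp_trunc; rewrite etaE nil.
  have -> : 1 + horner_alg nu eta = (1 + horner_alg nu eta) * exp_trunc N (- horner_alg nu eta) * exp_trunc N (horner_alg nu eta).
    by rewrite -mulrA E1 mulr1.
  congr (_ * _); rewrite ez0 -(rmorph1 (horner_alg nu)) -!rmorphD -rmorphM /=; congr horner_alg.
  by rewrite /eta !exprS; ring.
by apply: is_expD => //; apply: is_exp_trunc; rewrite etaE nil.
Qed.

End Exponential.

(** * Jordan-Chevalley decomposition and diagonalizability *)

(** Square factors are removed one at a time: z r^2 becomes z r, whose square it divides. A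
    square-free polynomial is coprime to its derivative because, in characteristic 0, no nonconstant
    factor has derivative 0. *)
Lemma separable_radical (p : {poly rat}) : p != 0 ->
  exists g : {poly rat}, coprimep g g^`() /\ exists k, p %| g ^+ k.
Proof.
move=> p0.
suff H d : forall g : {poly rat}, g != 0 -> (exists k, p %| g ^+ k) -> (size g <= d)%N ->
    exists g : {poly rat}, separable_poly g /\ exists k, p %| g ^+ k.
  have [||g [sg hg]] := H (size p) p p0; first by exists 1%N; rewrite expr1.
    by [].
  by exists g; split=> //; move: sg; rewrite unlock.
elim: d => [|d IH] g g0 [k pg] sg; first by move: g0; rewrite -size_poly_eq0 -leqn0 sg.
case: (classic (exists2 r : {poly rat}, (1 < size r)%N & r * r %| g)) => [[r r1 /dvdpP[z gE]]|no].
  have zr0 : z * r != 0 by apply: contraNneq g0 => e; rewrite gE mulrA e mul0r.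
  have r0 : r != 0 by rewrite -size_poly_gt0 ltnW.
  apply: (IH (z * r)) => //.
    exists (k + k)%N; apply: (dvdp_trans pg); rewrite exprD -exprMn; apply: dvdp_exp2r.
    have -> : z * r * (z * r) = z * (z * (r * r)) by ring.
    by rewrite gE dvdp_mull.
  rewrite -ltnS; apply: leq_trans sg; rewrite gE mulrA (size_mul zr0 r0).
  by case: (size r) r1 => [|[|m]] // _; rewrite addnS /= addnS ltnS leq_addr.
exists g; split; last by exists k.
apply/separable_polyP; split=> [u v uvg|u ug u1].
  rewrite /coprimep eqn_leq; apply/andP; split.
    rewrite leqNgt; apply/negP => h; apply: no; exists (gcdp u v) => //.
    by apply: dvdp_trans uvg; apply: dvdp_mul; [apply: dvdp_gcdl|apply: dvdp_gcdr].
  rewrite size_poly_gt0 gcdp_eq0; apply/negP => /andP[/eqP u0 _].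
  by move: uvg; rewrite u0 mul0r dvd0p (negbTE g0).
apply/eqP => /(congr1 (fun q : {poly rat} => q`_(size u).-2)); rewrite coef_deriv coef0.
have -> : (size u).-2.+1 = (size u).-1 by case: (size u) u1 => [|[|m]].
move/eqP; rewrite mulrn_eq0 -lead_coefE lead_coef_eq0 -size_poly_eq0.
by case: (size u) u1 => [|[|m]].
Qed.

Lemma horner_taylor2 (R : comNzRingType) (p : {poly R}) x h :
  exists z, p.[x + h] = p.[x] + p^`().[x] * h + z * h ^+ 2.
Proof.
elim/poly_ind: p => [|p c [z IH]]; first by exists 0; rewrite !raddf0 !horner0; ring.
exists (z * (x + h) + p^`().[x]).
by rewrite derivD derivC addr0 derivM derivX mulr1 !hornerD !hornerM !hornerX !hornerC IH; ring.
Qed.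

Lemma comp_poly_taylor2 (p s h : {poly rat}) :
  exists z, p \Po (s + h) = p \Po s + (p^`() \Po s) * h + z * h ^+ 2.
Proof.
have [z e] := horner_taylor2 (map_poly polyC p) s h; exists z.
by rewrite !comp_polyE !hornerE /= in e *; rewrite -!comp_polyE; move: e; rewrite deriv_map.
Qed.

(** Newton's iteration for a root of g, started at X. If a g + b g' = 1, then b inverts g' modulo g,
    and passing from s to s - g(s) b(s) doubles the power of g known to divide g(s). *)
Lemma newton_semisimple (g : {poly rat}) : coprimep g g^`() ->
  forall k, exists s, g %| 'X - s /\ g ^+ k %| g \Po s.
Proof.
move=> /Bezout_eq1_coprimepP[[a b] /= ab].
suff H j : exists s, g %| 'X - s /\ g ^+ (2 ^ j) %| g \Po s.
  move=> k; have [s [s1 s2]] := H k; exists s; split=> //.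
  by apply: dvdp_trans s2; apply: dvdp_exp2l; apply/ltnW/ltn_expl.
elim: j => [|j [s [s1 s2]]].
  by exists 'X; rewrite subrr dvdp0 comp_polyXr expn0 expr1.
have gs : g %| g \Po s.
  by apply: dvdp_trans s2; rewrite -{1}[g]expr1 dvdp_exp2l // expn_gt0.
pose h := - ((g \Po s) * (b \Po s)).
have [z e] := comp_poly_taylor2 g s h.
exists (s + h); split.
  by rewrite opprD addrA; apply: dvdp_sub => //; rewrite dvdpNr dvdp_mulr.
have -> : g \Po (s + h) = (g \Po s) ^+ 2 * ((a \Po s) + z * (b \Po s) ^+ 2).
  rewrite e /h.
  have abs : (a \Po s) * (g \Po s) + (b \Po s) * (g^`() \Po s) = 1.
    by rewrite -!comp_polyM -comp_polyD ab comp_polyC.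
  have -> : g \Po s = (g \Po s) * ((a \Po s) * (g \Po s) + (b \Po s) * (g^`() \Po s)).
    by rewrite abs mulr1.
  move: abs; move: (g \Po s) (g^`() \Po s) (a \Po s) (b \Po s) => u u' x y xy.
  have -> : u * (x * u + y * u') = u by rewrite xy mulr1.
  have -> : u + u' * - (u * y) = u * (u * x).
    by rewrite -{1}[u]mulr1 -xy; ring.
  ring.
by rewrite expnSr exprM; apply: dvdp_mulr; apply: dvdp_exp2r.
Qed.

(** A power of the separable g is a multiple of the characteristic polynomial, so g(M) is nilpotent;
    Newton's s gives g(s(M)) = 0, while M - s(M) is a multiple of g(M). The polynomial w is kept as
    a rational witness of separability that can be checked by multiplication. *)
Lemma jordan_chevalley d (M : 'M[rat]_d.+1) : exists s g w : {poly rat},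
  let S := horner_mx M s in
  [/\ exists N, (M - S) ^+ N = 0, horner_mx S g = 0 &
      horner_mx S w * horner_mx S g^`() = 1].
Proof.
have cp0 : char_poly M != 0 by rewrite monic_neq0 ?char_poly_monic.
have [g [cg [k /dvdpP[q pg]]]] := separable_radical cp0.
have [s [/dvdpP[q' sX] /dvdpP[q'' sg]]] := newton_semisimple cg k.
have gM : horner_mx M g ^+ k = 0.
  by rewrite -rmorphXn pg rmorphM /= Cayley_Hamilton mulr0.
have /Bezout_eq1_coprimepP[[a w] /= ab] := cg.
exists s, g, w; set S := horner_mx M s.
have hS p : horner_mx S p = horner_mx M (p \Po s).
  rewrite /S; elim/poly_ind: p => [|p c IH]; first by rewrite comp_poly0 !rmorph0.
  by rewrite comp_polyD comp_polyM comp_polyX comp_polyC !rmorphD !rmorphM /= IH horner_mx_X !horner_mx_C.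
have gS : horner_mx S g = 0 by rewrite hS sg rmorphM rmorphXn /= gM mulr0.
split; [exists k| |].
- have -> : M - S = horner_mx M ('X - s) by rewrite rmorphB /= horner_mx_X.
  by rewrite -rmorphXn sX exprMn rmorphM !rmorphXn /= gM mulr0.
- exact: gS.
by have := congr1 (horner_mx S) ab; rewrite rmorphD !rmorphM /= gS mulr0 add0r rmorph1.
Qed.

Lemma map_ratr_inj m n : injective (map_mx ratr : 'M[rat]_(m, n) -> 'M[algC]_(m, n)).
Proof. exact: map_mx_inj. Qed.

(** The minimal polynomial divides g. A multiple root of it would be an eigenvalue r with g'(r) = 0,
    and the invertible matrix g'(S) would kill its eigenvector. *)
Lemma semisimple_diagonalizable d (S W : 'M[rat]_d.+1) (g : {poly rat}) :
  horner_mx S g = 0 -> W * horner_mx S g^`() = 1 ->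
  diagonalizable (map_mx ratr S : 'M[algC]_d.+1).
Proof.
move=> gS Wg; set A := map_mx ratr S; pose G : {poly algC} := map_poly ratr g.
have GA : horner_mx A G = 0 by rewrite -map_horner_mx gS map_mx0.
have G'A : horner_mx A G^`() *m map_mx ratr W = 1%:M.
  by apply: mulmx1C; rewrite deriv_map -map_horner_mx -map_mxM [W *m _]Wg map_mx1.
have /dvdpP[z Gz] : mxminpoly A %| G by apply: mxminpoly_min.
have qm := mxminpoly_monic A.
have sep : separable_poly (mxminpoly A).
  rewrite unlock /coprimep; apply/negPn/negP => /closed_rootP[r].
  rewrite root_gcd => /andP[qr q'r].
  have : eigenvalue A r by rewrite eigenvalue_root_min.
  move=> /eigenvalueP[v vA v0].
  have vh (p : {poly algC}) : v *m horner_mx A p = p.[r] *: v.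
    elim/poly_ind: p => [|p c IH]; first by rewrite rmorph0 mulmx0 horner0 scale0r.
    rewrite rmorphD rmorphM /= horner_mx_X horner_mx_C mulmxDr -mulmxE mulmxA IH -scalemxAl vA.
    by rewrite scalerA mul_mx_scalar hornerMXaddC scalerDl.
  have G'r : G^`().[r] = 0.
    by rewrite Gz derivM hornerD !hornerM (rootP qr) (rootP q'r) !mulr0 addr0.
  case/eqP: v0; rewrite -[v]mulmx1 -G'A mulmxA vh G'r scale0r mul0mx //.
have [rs qE] := closed_field_poly_normal (mxminpoly A).
rewrite (monicP qm) scale1r in qE.
apply/diagonalizableP; exists rs; last by rewrite -qE.
by rewrite -separable_prod_XsubC -qE.
Qed.

Section JointSpectrum.
Variables (n d : nat).
Implicit Types (S T M : 'I_n -> 'M[rat]_d.+1) (a b : 'X_{1..n}).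

(* The rows of P are common eigenvectors of the S_i; chi i k is the eigenvalue
   of S_i on the k-th one. *)
Definition joint_spectrum S (P : 'M[algC]_d.+1) (chi : 'I_n -> 'I_d.+1 -> algC) :=
  P \in unitmx /\ forall i, P *m map_mx ratr (S i) = diag_mx (\row_k chi i k) *m P.

Lemma joint_spectrum_ex S (W : 'I_n -> 'M[rat]_d.+1) (g : 'I_n -> {poly rat}) :
  (forall i j, GRing.comm (S i) (S j)) ->
  (forall i, horner_mx (S i) (g i) = 0) ->
  (forall i, W i * horner_mx (S i) (g i)^`() = 1) ->
  exists P chi, joint_spectrum S P chi.
Proof.
move=> cS gS Wg.
pose As : seq 'M[algC]_d.+1 := [seq map_mx ratr (S i) | i <- enum 'I_n].
have [P Pu /= /allP diagP] : codiagonalizable As.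
  apply/codiagonalizableP; split=> [A B /mapP[i _ ->] /mapP[j _ ->]|A /mapP[i _ ->]].
    by rewrite /comm_mx -!map_mxM; congr map_mx; apply: cS.
  exact: semisimple_diagonalizable (gS i) (Wg i).
have Pi i : exists D : 'rV_d.+1, P *m map_mx ratr (S i) = diag_mx D *m P.
  have /diagP /diagonalizable_forPex[D /(simmxP Pu) e] : map_mx ratr (S i) \in As.
    by apply: map_f; rewrite mem_enum.
  by exists D.
have [D hD] := choice_fun Pi.
exists P, (fun i k => D i 0 k); split=> // i; rewrite hD; congr (diag_mx _ *m _).
by apply/rowP => k; rewrite mxE.
Qed.

Section Spectrum.
Variables (S : 'I_n -> 'M[rat]_d.+1) (P : 'M[algC]_d.+1) (chi : 'I_n -> 'I_d.+1 -> algC).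
Hypothesis spec : joint_spectrum S P chi.

Let Pu : P \in unitmx := spec.1.

Lemma diag_mxD_mul (u v : 'rV[algC]_d.+1) :
  diag_mx u *m diag_mx v = diag_mx (\row_k (u 0 k * v 0 k)).
Proof.
rewrite mul_diag_mx; apply/matrixP => i j; rewrite !mxE.
by case: eqP => [->|_]; rewrite ?mulr1n // !mulr0n mulr0.
Qed.

Lemma spectrum_mmap1 a :
  P *m map_mx ratr (mmap1 S a) = diag_mx (\row_k mmap1 (chi^~ k) a) *m P.
Proof.
have hX i m : P *m map_mx ratr (S i ^+ m) = diag_mx (\row_k chi i k ^+ m) *m P.
  elim: m => [|m IH].
    rewrite expr0 map_mx1 mulmx1; have -> : \row_k chi i k ^+ 0 = const_mx 1 :> 'rV_d.+1.
      by apply/rowP => k; rewrite !mxE expr0.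
    by rewrite diag_const_mx mul1mx.
  rewrite exprS -mulmxE map_mxM /= mulmxA spec.2 -mulmxA IH mulmxA diag_mxD_mul.
  by congr (diag_mx _ *m _); apply/rowP => k; rewrite !mxE exprS.
rewrite /mmap1; elim: (index_enum _) => [|i r IH].
  rewrite big_nil map_mx1 mulmx1; set u := \row_k _.
  have -> : u = const_mx 1 by apply/rowP => k; rewrite !mxE big_nil.
  by rewrite diag_const_mx mul1mx.
rewrite big_cons -mulmxE map_mxM /= mulmxA hX -mulmxA IH mulmxA diag_mxD_mul.
by congr (diag_mx _ *m _); apply/rowP => k; rewrite !mxE big_cons.
Qed.

Lemma spectrum_conj (A : 'M[rat]_d.+1) u : P *m map_mx ratr A = diag_mx u *m P ->
  map_mx ratr A = invmx P *m diag_mx u *m P.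
Proof. by move=> e; rewrite -mulmxA -e mulKmx. Qed.

Lemma spectrum_trace (A : 'M[rat]_d.+1) u : P *m map_mx ratr A = diag_mx u *m P ->
  ratr (\tr A) = \sum_k u 0 k.
Proof.
move=> /spectrum_conj e; rewrite -trace_map_mx e mxtrace_mulC mulmxA mulmxV // mul1mx.
by rewrite mxtrace_diag.
Qed.

End Spectrum.

Lemma spectrum_inv S S' P chi : joint_spectrum S P chi -> (forall i, S i * S' i = 1) ->
  (forall i k, chi i k != 0) /\ joint_spectrum S' P (fun i k => (chi i k)^-1).
Proof.
move=> [Pu hS] SS'.
have dd i : diag_mx (\row_k chi i k) *m (P *m map_mx ratr (S' i)) = P.
  by rewrite mulmxA -hS -mulmxA -map_mxM [S i *m _]SS' map_mx1 mulmx1.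
have c0 i k : chi i k != 0.
  apply/eqP => c0; have : diag_mx (\row_k chi i k) \in unitmx.
    have : diag_mx (\row_k chi i k) *m (P *m map_mx ratr (S' i)) \in unitmx by rewrite dd.
    by rewrite unitmx_mul => /andP[].
  rewrite unitmxE det_diag (bigD1 k) //= mxE c0 mul0r unitr0 //.
split=> //; split=> // i.
rewrite -{2}(dd i) mulmxA diag_mxD_mul; set u := \row__ _.
have -> : u = const_mx 1 by apply/rowP => k; rewrite !mxE mulVf.
by rewrite diag_const_mx mul1mx.
Qed.

End JointSpectrum.

(* The last two conditions make S_i diagonalizable over algC: the W_i show that
   no eigenvalue of S_i is a multiple root of g_i. *)
Definition cert_algebra n d (S S' T W : 'I_n -> 'M[rat]_d.+1) (g : 'I_n -> {poly rat}) D :=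
  [/\ forall i, S i * S' i = 1,
      forall i j, [/\ GRing.comm (S i) (S j), GRing.comm (S i) (T j) & GRing.comm (T i) (T j)],
      forall i, T i ^+ D = 0,
      forall i, horner_mx (S i) (g i) = 0 &
      forall i, W i * horner_mx (S i) (g i)^`() = 1].

Section CertRelations.
Variables (n d : nat) (S S' T W : 'I_n -> 'M[rat]_d.+1) (g : 'I_n -> {poly rat}) (D : nat).
Hypothesis cert : cert_algebra S S' T W g D.
Let M i := S i * exp_trunc D (T i).
Variables (P : 'M[algC]_d.+1) (chi : 'I_n -> 'I_d.+1 -> algC).
Hypothesis spec : joint_spectrum S P chi.
Implicit Types (a b : 'X_{1..n}).

Definition wsum a : 'M[rat]_d.+1 := \sum_i T i *+ a i.

Let cSS i j : GRing.comm (S i) (S j). Proof. by case: cert => _ /(_ i j)[]. Qed.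
Let cST i j : GRing.comm (S i) (T j). Proof. by case: cert => _ /(_ i j)[]. Qed.
Let cTT i j : GRing.comm (T i) (T j). Proof. by case: cert => _ /(_ i j)[]. Qed.

Lemma comm_wsum x a : (forall i, GRing.comm x (T i)) -> GRing.comm x (wsum a).
Proof.
move=> h; rewrite /wsum; elim/big_ind: _ => [|u v|i _]; [exact: commr0|exact: commrD|].
exact: commrMn.
Qed.

Lemma is_exp_wsum a : is_exp (wsum a) (mmap1 (fun i => exp_trunc D (T i)) a).
Proof.
apply: is_exp_sum => [i j|i]; first by apply/commrMn/commr_sym/commrMn/commr_sym.
by apply: is_expX; apply: is_exp_trunc; case: cert.
Qed.

Lemma cert_mmap1 a : mmap1 M a = mmap1 S a * mmap1 (fun i => exp_trunc D (T i)) a.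
Proof. by apply: comm_mmap1M => i j; apply: comm_exp_trunc. Qed.

(** The matrix E = exp([wsum a - wsum b]) is unipotent, and by the relation it is a multiple of S^(b
    - a), hence diagonalizable. So E = 1; the exponents agree because exp is injective on
    nilpotents, and the eigenvalues of S^a and S^b are proportional. *)
Lemma cert_relation mu lambda a b : mu != 0 -> lambda != 0 ->
  mu *: mmap1 M a = lambda *: mmap1 M b ->
  wsum a = wsum b /\ exists2 rho, rho != 0 & forall k, mmap1 (chi^~ k) a = rho * mmap1 (chi^~ k) b.
Proof.
move=> mu0 la0 e; have [SS' _ TD _ _] := cert.
have [chi0 spec'] := spectrum_inv spec SS'.
have S'S i : S' i * S i = 1 by apply: mulmx1C; apply: SS'.
have cS'S i j : GRing.comm (S' i) (S j).
  by rewrite /GRing.comm -[LHS]mulr1 -(SS' i) mulrA -[_ * _ * S i]mulrA (cSS j i) !mulrA S'S mul1r.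
have [N TbN] : exists N, wsum b ^+ N = 0 by have [N hN _] := is_exp_wsum b; exists N.
have [F hF] := is_expN (ex_intro _ N TbN).
have cab : GRing.comm (wsum a) (- wsum b).
  by apply/commrN/comm_wsum => i; apply/commr_sym/comm_wsum.
have hE := is_expD cab (is_exp_wsum a) hF.
set E := _ * F in hE.
have EE : E = (lambda / mu) *: (mmap1 S' a * mmap1 S b).
  have := congr1 (fun x => mmap1 S' a * x * F) e.
  rewrite /= !cert_mmap1 -!scalerAr -!scalerAl !mulrA mmap1_inv // mul1r -/E => eE.
  have E1 : mmap1 (fun i => exp_trunc D (T i)) b * F = 1 by apply: is_exp_mulV (is_exp_wsum b) hF.
  apply: (scalerI mu0); rewrite scalerA mulrCA mulfV // mulr1.
  by rewrite -[mmap1 S' a * _]mulr1 -E1 !mulrA.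
pose u : 'rV[algC]_d.+1 := \row_k (ratr (lambda / mu) * (mmap1 (fun i => (chi i k)^-1) a * mmap1 (chi^~ k) b)).
have PE : P *m map_mx ratr E = diag_mx u *m P.
  rewrite EE map_mxZ /= -scalemxAr -mulmxE map_mxM /= mulmxA (spectrum_mmap1 spec').
  rewrite -mulmxA (spectrum_mmap1 spec) mulmxA diag_mxD_mul scalemxAl.
  congr (_ *m _); apply/matrixP => i j; rewrite !mxE.
  by case: eqP => _; rewrite ?mulr1n // !mulr0n mulr0.
have u1 k : u 0 k = 1.
  have [K hK] := is_exp_unipotent hE.
  have PE1 : P *m map_mx ratr (E - 1) = diag_mx (u - const_mx 1) *m P.
    rewrite map_mxB map_mx1 mulmxBr mulmx1 PE.
    have -> : diag_mx (u - const_mx 1) = diag_mx u - 1%:M by rewrite raddfB /= diag_const_mx.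
    by rewrite mulmxBl mul1mx.
  have PEK m : P *m map_mx ratr ((E - 1) ^+ m) = diag_mx (\row_k (u 0 k - 1) ^+ m) *m P.
    elim: m => [|m IH].
      rewrite expr0 map_mx1 mulmx1; set v := \row__ _.
      have -> : v = const_mx 1 by apply/rowP => i; rewrite !mxE expr0.
      by rewrite diag_const_mx mul1mx.
    rewrite exprS -mulmxE map_mxM /= mulmxA PE1 -mulmxA IH mulmxA diag_mxD_mul.
    by congr (diag_mx _ *m _); apply/rowP => i; rewrite !mxE exprS.
  have := PEK K; rewrite hK map_mx0 mulmx0 => /esym z.
  have {}z : diag_mx (\row_k (u 0 k - 1) ^+ K) = 0.
    by rewrite -[LHS](mulmxK spec.1) z mul0mx.
  move/matrixP/(_ k k): z; rewrite !mxE eqxx mulr1n => /eqP; rewrite expf_eq0 subr_eq0.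
  by move=> /andP[_ /eqP].
have E1 : E = 1.
  have := spectrum_conj spec PE; have -> : u = const_mx 1 by apply/rowP => k; rewrite u1 mxE.
  rewrite diag_const_mx mulmx1 mulVmx ?spec.1 // => e1.
  by apply: map_ratr_inj; rewrite e1 map_mx1.
split; first by apply/eqP; rewrite -subr_eq0; apply/eqP/is_exp1; rewrite -E1.
exists (ratr (lambda / mu)); first by rewrite fmorph_eq0 mulf_neq0 ?invr_eq0.
move=> k; have := u1 k; rewrite mxE => uk.
have inv : mmap1 (chi^~ k) a * mmap1 (fun i => (chi i k)^-1) a = 1.
  by apply: mmap1_inv => [i j|i]; [apply: mulrC | apply: mulfV].
transitivity (ratr (lambda / mu) * mmap1 (chi^~ k) b *
  (mmap1 (chi^~ k) a * mmap1 (fun i => (chi i k)^-1) a)); last by rewrite inv mulr1.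
by rewrite -[LHS]mulr1 -uk; ring.
Qed.

Lemma cert_relation_conv rho a b : wsum a = wsum b ->
  (forall k, mmap1 (chi^~ k) a = rho * mmap1 (chi^~ k) b) ->
  exists l, mmap1 M a = l *: mmap1 M b.
Proof.
move=> eab eS; have [SS' _ _ _ _] := cert.
have [chi0 spec'] := spectrum_inv spec SS'.
have eE : mmap1 (fun i => exp_trunc D (T i)) a = mmap1 (fun i => exp_trunc D (T i)) b.
  by apply: is_exp_uniq (is_exp_wsum a) _; rewrite eab; apply: is_exp_wsum.
have eSS : map_mx ratr (mmap1 S a) = rho *: map_mx ratr (mmap1 S b).
  rewrite (spectrum_conj spec (spectrum_mmap1 spec a)) (spectrum_conj spec (spectrum_mmap1 spec b)).
  have -> : \row_k mmap1 (chi^~ k) a = rho *: \row_k mmap1 (chi^~ k) b :> 'rV_d.+1.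
    by apply/rowP => k; rewrite !mxE.
  by rewrite linearZ /= -scalemxAr -scalemxAl.
(* [rho] is only known to be algebraic; the scalar is rational as a quotient of entries of two
   rational matrices. *)
suff [l hl] : exists l, mmap1 S a = l *: mmap1 S b.
  by exists l; rewrite !cert_mmap1 hl eE -scalerAl.
have b0 : mmap1 S b != 0.
  apply/eqP => b0; have := spectrum_mmap1 spec b; rewrite b0 map_mx0 mulmx0 => /esym z.
  have {}z : diag_mx (\row_k mmap1 (chi^~ k) b) = 0 by rewrite -[LHS](mulmxK spec.1) z mul0mx.
  move/matrixP/(_ 0 0): z; rewrite !mxE eqxx mulr1n => /eqP/prodf_eq0[i _].
  by rewrite expf_eq0 => /andP[_]; rewrite (negbTE (chi0 _ _)).
have [i [j bij]] : exists i j, mmap1 S b i j != 0.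
  apply: NNPP => no; case/eqP: b0; apply/matrixP => i j; rewrite mxE; apply/eqP/negPn/negP => h.
  by apply: no; exists i, j.
exists (mmap1 S a i j / mmap1 S b i j).
apply: map_ratr_inj; rewrite eSS map_mxZ /=; congr (_ *: _).
move/matrixP/(_ i j): eSS; rewrite !mxE => e.
by rewrite rmorphM fmorphV /= e mulfK // fmorph_eq0.
Qed.

End CertRelations.

(** * Certificates of absence of binomials *)

(** Tests for an integer of absolute value at most B by comparison with the finitely many
    candidates, so that no reduced fraction is required. *)
Definition smallint (B : nat) (x : rat) : bool :=
  has (fun z : nat => (x == z%:R) || (x + z%:R == 0)) (iota 0 B.+1).

Lemma smallintP B x : reflect (exists2 z : int, x = z%:~R & (`|z| <= B)%N) (smallint B x).
Proof.
apply: (iffP hasP) => [[z]|[z -> zB]].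
  rewrite mem_iota add0n ltnS => /andP[_ zB] /orP[/eqP->|]; first by exists z%:Z.
  rewrite addr_eq0 => /eqP->; by exists (- z%:Z); [rewrite rmorphN | rewrite abszN].
exists `|z|%N; first by rewrite mem_iota add0n ltnS.
case: z zB => z _ /=; first by rewrite eqxx.
by rewrite NegzE rmorphN /= addNr eqxx orbT.
Qed.

Lemma Aint_root (x : algC) m : (0 < m)%N -> x ^+ m \in Aint -> x \in Aint.
Proof.
move=> m0; rewrite /Aint unfold_in => h.
have [p [Dp mon_p] _] := minCpolyP (x ^+ m).
have X1 : (1 < size ('X^m : {poly algC}))%N by rewrite size_polyXn ltnS.
apply: (@root_monic_Aint (minCpoly (x ^+ m) \Po 'X^m)).
- by rewrite /root horner_comp hornerXn; apply: root_minCpoly.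
- by rewrite monicE lead_coef_comp // lead_coefXn expr1n mulr1 -monicE minCpoly_monic.
- by apply: polyOver_comp => //; apply: rpredX; apply: polyOverX.
Qed.

(** The characteristic polynomial is monic with integer coefficients, and the bound compares the
    sums of absolute values of the entries of v A and x v. *)
Lemma integer_eigenvalue d (A : 'M[rat]_d.+1) K (v : 'rV[algC]_d.+1) x :
  (forall i j, smallint K (A i j)) -> v *m map_mx ratr A = x *: v -> v != 0 ->
  x \in Aint /\ `|x| <= (d.+1 * K)%:R.
Proof.
move=> Aint_K vA v0; split.
  have Ai i : exists f : 'I_d.+1 -> int, forall j, A i j = (f j)%:~R.
    have /choice_fun[f hf] : forall j, exists z : int, A i j = z%:~R.
      by move=> j; have /smallintP[z -> _] := Aint_K i j; exists z.
    by exists f.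
  have [f hf] := choice_fun Ai.
  have AE : map_mx ratr A = map_mx intr (\matrix_(i, j) f i j) :> 'M[algC]_d.+1.
    by apply/matrixP => i j; rewrite !mxE hf ratr_int.
  apply: (@root_monic_Aint (char_poly (map_mx ratr A))).
  - by rewrite -eigenvalue_root_char; apply/eigenvalueP; exists v.
  - exact: char_poly_monic.
  - by rewrite AE -map_char_poly; apply/polyOverP => i; rewrite coef_map /= intr_int.
pose s := \sum_j `|v 0 j|.
have s0 : 0 < s.
  rewrite lt_neqAle sumr_ge0 // andbT eq_sym; apply: contraNneq v0 => /eqP.
  rewrite psumr_eq0 // => /allP h; apply/eqP/rowP => j; rewrite mxE.
  by have := h j (mem_index_enum _); rewrite normr_eq0 => /eqP.
rewrite -(ler_pM2r s0) {1}/s mulr_sumr.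
have -> : \sum_j `|x| * `|v 0 j| = \sum_j `|\sum_i v 0 i * ratr (A i j)|.
  apply: eq_bigr => j _; rewrite -normrM; congr `|_|.
  by have /rowP/(_ j) := vA; rewrite !mxE => <-; apply: eq_bigr => i _; rewrite mxE.
have -> : (d.+1 * K)%:R * s = \sum_(j < d.+1) \sum_i `|v 0 i| * K%:R.
  by rewrite sumr_const card_ord -mulr_suml -/s -mulr_natl natrM; ring.
apply: ler_sum => j _; apply: le_trans (ler_norm_sum _ _ _) _.
apply: ler_sum => i _; rewrite normrM ler_wpM2l //.
have /smallintP[z -> zK] := Aint_K i j.
by rewrite ratr_int -intr_norm -abszE ler_nat.
Qed.

(** * Rounding a multiplicative relation to a given radius *)

Section IntegerPowers.
Variable n : nat.
Implicit Types (psi : 'I_n -> algC) (u v : 'I_n -> int).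

Definition pw psi u : algC := \prod_i psi i ^ u i.

Lemma pwD psi u v : (forall i, psi i != 0) -> pw psi (fun i => u i + v i) = pw psi u * pw psi v.
Proof. by move=> h; rewrite -big_split; apply: eq_bigr => i _; rewrite expfzDr. Qed.

Lemma pwZ psi u z : pw psi (fun i => u i * z) = pw psi u ^ z.
Proof.
case: z => k; rewrite ?NegzE /pw.
  by rewrite -exprnP -prodrXl; apply: eq_bigr => i _; rewrite exprnP exprz_exp.
rewrite -exprnN -prodrXl -prodfV; apply: eq_bigr => i _.
by rewrite exprnN exprz_exp.
Qed.

Lemma pw_nat psi (w : 'X_{1..n}) : pw psi (fun i => (w i)%:Z) = mmap1 psi w.
Proof. by []. Qed.

Lemma pw_div psi psi' u : pw (fun i => psi i / psi' i) u = pw psi u / pw psi' u.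
Proof.
rewrite /pw -prodf_div; apply: eq_bigr => i _.
by rewrite expfzMl invr_expz exprz_inv.
Qed.

(** Put v = floor(R u / m) and e = m v - R u. As psi^u = 1, the m-th power of y is the product of
    the C^m psi_i^(e_i). Since |e_i| is at most m, each factor is an algebraic integer of absolute
    value at most K^m, and taking m-th roots removes both m and R. *)
Lemma height_bound psi u (C K R m : nat) :
    (0 < C)%N -> (0 < m)%N -> (forall i, psi i != 0) ->
    (forall i, [/\ C%:R * psi i \in Aint, C%:R * (psi i)^-1 \in Aint,
       `|C%:R * psi i| <= K%:R & `|C%:R * (psi i)^-1| <= K%:R]) ->
    pw psi u = 1 ->
  let y := (C ^ n)%:R * pw psi (fun i => (R%:Z * u i %/ m%:Z)%Z) in
  y \in Aint /\ `|y| <= (K ^ n)%:R.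
Proof.
move=> C0 m0 psi0 hpsi pu y.
pose v i := (R%:Z * u i %/ m%:Z)%Z; pose e i := v i * m%:Z - R%:Z * u i.
have em i : (`|e i| <= m)%N.
  have -> : e i = - (R%:Z * u i %% m%:Z)%Z by rewrite /e /v [X in _ - X](divz_eq _ m%:Z) opprD addrA subrr add0r.
  rewrite abszN -lez_nat abszE ger0_norm ?modz_ge0 ?ltW ?ltz_mod //; case: (m) m0 => //.
have ye : pw psi v ^+ m = pw psi e.
  rewrite exprnP -pwZ.
  have -> : pw psi (fun i => v i * m%:Z) = pw psi (fun i => e i + u i * R%:Z).
    by apply: eq_bigr => i _; congr (_ ^ _); rewrite /e; ring.
  by rewrite pwD // pwZ pu exp1rz mulr1.
have CK (i : 'I_n) : (C <= K)%N.
  have [_ _ h1 h2] := hpsi i.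
  have := ler_pM (normr_ge0 _) (normr_ge0 _) h1 h2.
  rewrite -normrM mulrACA mulfV // mulr1 ger0_norm ?mulr_ge0 ?ler0n //.
  by rewrite -!natrM ler_nat !mulnn leq_sqr.
have fac (i : 'I_n) : C%:R ^+ m * psi i ^ e i \in Aint /\ `|C%:R ^+ m * psi i ^ e i| <= K%:R ^+ m.
  have := em i; case: (e i) => k; rewrite ?NegzE ?abszN !absz_nat => km.
    have [h1 _ h2 _] := hpsi i.
    rewrite -exprnP -{1 2}(subnK km) exprD -mulrA -exprMn; split.
      by apply: rpredM; apply: rpredX => //; apply: Aint_Cnat; apply: rpred_nat.
    rewrite normrM -[X in _ <= _ ^+ X](subnK km) exprD !normrX.
    by apply: ler_pM; rewrite ?exprn_ge0 //; apply: lerXn2r; rewrite ?nnegrE // normr_nat ler_nat (CK i).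
  have [_ h1 _ h2] := hpsi i.
  rewrite -exprnN -exprVn -{1 2}(subnK km) exprD -mulrA -exprMn; split.
    by apply: rpredM; apply: rpredX => //; apply: Aint_Cnat; apply: rpred_nat.
  rewrite normrM -[X in _ <= _ ^+ X](subnK km) exprD !normrX.
  by apply: ler_pM; rewrite ?exprn_ge0 //; apply: lerXn2r; rewrite ?nnegrE // normr_nat ler_nat (CK i).
have yE : y ^+ m = \prod_i (C%:R ^+ m * psi i ^ e i).
  by rewrite exprMn ye big_split /= prodr_const card_ord natrX -!exprM mulnC.
split.
  apply: (Aint_root m0); rewrite yE; apply: rpred_prod => i _; exact: (fac i).1.
rewrite -(ler_pXn2r m0) ?nnegrE ?ler0n // -normrX yE normr_prod.
have -> : (K ^ n)%:R ^+ m = \prod_(i < n) (K%:R ^+ m) :> algC.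
  by rewrite prodr_const card_ord natrX -!exprM mulnC.
by apply: ler_prod => i _; rewrite normr_ge0 (fac i).2.
Qed.

End IntegerPowers.

(* Points v of sup norm R in Z^n are encoded by w = v + (R, .., R) in N^n, so
   that negative powers of the S_i never occur; [ones] is (R, .., R). *)
Section Passing.
Variables (n d : nat) (S S' T : 'I_n -> 'M[rat]_d.+1) (c K R : nat).
Implicit Types (w : 'X_{1..n}).

Definition ones : 'X_{1..n} := [multinom R | i < n].

(* tr (S^(jv)) tr (S^(-jv)), the sum of (x/y)^j over all eigenvalues x, y of S^v. *)
Definition tau j w : rat :=
  \tr (mmap1 S (w *+ j) * mmap1 S' (ones *+ j)) *
  \tr (mmap1 S' (w *+ j) * mmap1 S (ones *+ j)).

Definition nil_value w : 'M[rat]_d.+1 := c%:R *: (wsum T w - wsum T ones).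
(** In a ratio x / y of eigenvalues each of the n matrices contributes one factor c for x and one
    for the inverse of y. *)
Definition tau_value j w : rat := (((c ^ 2) ^ n) ^ j)%:R * tau j w.
(** There are (d+1)^2 ratios, and (d+1) K bounds c times an eigenvalue of any S_i or of its
    inverse. *)
Definition tau_bound j := (d.+1 ^ 2 * (((d.+1 * K) ^ 2) ^ n) ^ j)%N.

(** The range of j is the total length of two lists of (d+1)^2 ratios, which is enough for power
    sums to determine the set of values. The bound n K adds up n matrices with entries at most K. *)
Definition passes w :=
  (forall i j, smallint (n * K) (nil_value w i j)) /\
  forall j, (j <= 2 * d.+1 ^ 2)%N -> smallint (tau_bound j) (tau_value j w).

Definition on_sphere w := (forall i, (w i <= 2 * R)%N) /\ exists i, (w i == 0)%N || (w i == 2 * R)%N.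

End Passing.

Lemma mmap1Xn n (F : fieldType) (f : 'I_n -> F) w j : mmap1 f (w *+ j)%MM = mmap1 f w ^+ j.
Proof. by rewrite /mmap1 -prodrXl; apply: eq_bigr => i _; rewrite mulmnE exprM. Qed.

Lemma mmap1V n (F : fieldType) (f : 'I_n -> F) w : mmap1 (fun i => (f i)^-1) w = (mmap1 f w)^-1.
Proof. by rewrite /mmap1 -prodfV; apply: eq_bigr => i _; rewrite exprVn. Qed.

(** The last clause, exactness where |u| = m, is what puts the rounded vector on the sphere of
    radius R. *)
Lemma floor_div_bound (R m : nat) (u : int) : (0 < m)%N -> (`|u| <= m)%N ->
  let v := (R%:Z * u %/ m%:Z)%Z in
  [/\ (`|v| <= R)%N, (absz (v * m%:Z - R%:Z * u)%R <= m)%N & (`|u| = m -> `|v| = R)%N].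
Proof.
move=> m0 um v.
have mz : m%:Z != 0 by rewrite -lt0n.
split.
- have h1 : (v <= R%:Z) by rewrite /v; nia.
  have h2 : (- R%:Z <= v) by rewrite /v; nia.
  by lia.
- have -> : v * m%:Z - R%:Z * u = - (R%:Z * u %% m%:Z)%Z.
    by rewrite /v [X in _ - X](divz_eq _ m%:Z) opprD addrA subrr add0r.
  by rewrite abszN -lez_nat abszE ger0_norm ?modz_ge0 // ltW // ltz_mod.
- move=> e; rewrite /v; have [->|->] : u = m%:Z \/ u = - m%:Z by lia.
    by rewrite mulzK.
  by rewrite mulrN -mulNr mulzK // abszN.
Qed.

Section PassingTheory.
Variables (n d : nat) (S S' T W : 'I_n -> 'M[rat]_d.+1) (g : 'I_n -> {poly rat}) (D c K : nat).
Hypothesis cert : cert_algebra S S' T W g D.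
Variables (P : 'M[algC]_d.+1) (chi : 'I_n -> 'I_d.+1 -> algC).
Hypothesis spec : joint_spectrum S P chi.
Implicit Types (w a b : 'X_{1..n}).

Let SS' i : S i * S' i = 1. Proof. by case: cert. Qed.
Let chi0 i k : chi i k != 0. Proof. exact: (spectrum_inv spec SS').1. Qed.
Let spec' : joint_spectrum S' P (fun i k => (chi i k)^-1) := (spectrum_inv spec SS').2.

Lemma mmap1_chi_neq0 k w : mmap1 (chi^~ k) w != 0.
Proof. by apply/prodf_neq0 => i _; rewrite expf_neq0. Qed.

Definition eigval R w k : algC := mmap1 (chi^~ k) w / mmap1 (chi^~ k) (ones n R).

Lemma eigval_neq0 R w k : eigval R w k != 0.
Proof. by rewrite mulf_neq0 ?invr_neq0 ?mmap1_chi_neq0. Qed.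

Lemma tau_eigval R j w : ratr (tau S S' R j w) =
  \sum_k \sum_l (eigval R w k / eigval R w l) ^+ j.
Proof.
rewrite /tau rmorphM /=.
have prodE A B u v : P *m map_mx ratr A = diag_mx u *m P -> P *m map_mx ratr B = diag_mx v *m P ->
    P *m map_mx ratr (A * B) = diag_mx (\row_k (u 0 k * v 0 k)) *m P.
  by move=> hA hB; rewrite -mulmxE map_mxM /= mulmxA hA -mulmxA hB mulmxA diag_mxD_mul.
rewrite (spectrum_trace spec (prodE _ _ _ _ (spectrum_mmap1 spec _) (spectrum_mmap1 spec' _))).
rewrite (spectrum_trace spec (prodE _ _ _ _ (spectrum_mmap1 spec' _) (spectrum_mmap1 spec _))).
rewrite mulr_suml; apply: eq_bigr => k _; rewrite mulr_sumr; apply: eq_bigr => l _.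
rewrite !mxE !mmap1V !mmap1Xn /eigval invf_div -!exprVn -!exprMn.
by congr (_ ^+ j); ring.
Qed.

Section Sound.
Hypotheses (c0 : (0 < c)%N).
Hypothesis intS : forall i j k, smallint K ((c%:R *: S i) j k).
Hypothesis intS' : forall i j k, smallint K ((c%:R *: S' i) j k).
Hypothesis intT : forall i j k, smallint K ((c%:R *: T i) j k).

Lemma row_spectrum (S1 : 'I_n -> 'M[rat]_d.+1) (chi1 : 'I_n -> 'I_d.+1 -> algC) i k : joint_spectrum S1 P chi1 ->
  (forall j l, smallint K ((c%:R *: S1 i) j l)) ->
  c%:R * chi1 i k \in Aint /\ `|c%:R * chi1 i k| <= (d.+1 * K)%:R.
Proof.
move=> sp1 int1.
apply: (integer_eigenvalue (A := c%:R *: S1 i) (v := row k P)) => //.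
  rewrite map_mxZ /= -scalemxAr -row_mul sp1.2 rmorph_nat -scalerA; congr (_ *: _).
  by rewrite row_mul row_diag_mx -scalemxAl -rowE !mxE.
apply/eqP => r0; have /row_freeP[Q PQ] : row_free P by rewrite row_free_unit; exact: sp1.1.
have := congr1 (row k) PQ; rewrite row_mul r0 mul0mx => /rowP/(_ k).
by rewrite !mxE eqxx => /esym/eqP; rewrite oner_eq0.
Qed.

(* With u = a - b, m the sup norm of u and v = floor (R u / m), the error
   m v - R u is at most m in sup norm, and this error alone contributes to m
   times the additive and to the m-th power of the multiplicative quantities. *)
Lemma passes_ex R a b : a != b -> wsum T a = wsum T b ->
  (exists2 rho, rho != 0 & forall k, mmap1 (chi^~ k) a = rho * mmap1 (chi^~ k) b) ->
  exists w, on_sphere R w /\ passes S S' T c K R w.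
Proof.
move=> ab eT [rho rho0 eS].
pose u i : int := (a i)%:Z - (b i)%:Z.
have [i1 ui1] : exists i, u i != 0.
  apply: NNPP => no; case/eqP: ab; apply/mnmP => i; apply/eqP/negPn/negP => h.
  by apply: no; exists i; rewrite /u subr_eq0.
have [i0 _ umax] := @arg_maxnP _ i1 xpredT (fun i => `|u i|%N) isT.
set m := `|u i0|%N in umax.
have m0 : (0 < m)%N by apply: leq_trans (umax i1 isT); rewrite absz_gt0.
pose v i := (R%:Z * u i %/ m%:Z)%Z.
have hv i : [/\ (`|v i| <= R)%N, (absz (v i * m%:Z - R%:Z * u i)%R <= m)%N & (`|u i| = m -> `|v i| = R)%N].
  exact: floor_div_bound (umax i isT).
pose w : 'X_{1..n} := [multinom absz (v i + R%:Z)%R | i < n].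
have wE i : (w i)%:Z = v i + R%:Z.
  by rewrite mnmE; have [] := hv i; lia.
exists w; split.
  split=> [i|]; first by have := wE i; have [] := hv i; lia.
  exists i0; have := wE i0; have [_ _ /(_ erefl)] := hv i0.
  by move=> h1 h2; apply/orP; case: (lerP 0 (v i0)) => h3; [right|left]; apply/eqP; lia.
split=> [x y|j _].
- have hz i : exists z : int, c%:R * T i x y = z%:~R /\ (`|z| <= K)%N.
    by have /smallintP[z zE zK] := intT i x y; exists z; move: zE; rewrite mxE.
  have [z hzz] := choice_fun hz.
  have wsE a' : c%:R * wsum T a' x y = (\sum_i z i * (a' i)%:Z)%:~R.
    rewrite /wsum summxE mulr_sumr rmorph_sum; apply: eq_bigr => i _ /=.
    by rewrite mulmxnE -[T i x y *+ _]mulr_natr mulrA (hzz i).1 rmorphM.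
  apply/smallintP; exists (\sum_i z i * v i).
    rewrite /nil_value !mxE mulrBr !wsE -rmorphB /=; congr _%:~R.
    by rewrite -sumrB; apply: eq_bigr => i _; rewrite wE mnmE; ring.
  have su : \sum_i z i * u i = 0.
    have : c%:R * wsum T a x y = c%:R * wsum T b x y by rewrite eT.
    rewrite !wsE => /intr_inj e.
    have -> : \sum_i z i * u i = \sum_i z i * (a i)%:Z - \sum_i z i * (b i)%:Z.
      by rewrite -sumrB; apply: eq_bigr => i _; rewrite /u; ring.
    by rewrite e subrr.
  have e : (\sum_i z i * v i) * m%:Z = \sum_i z i * (v i * m%:Z - R%:Z * u i).
    transitivity ((\sum_i z i * v i) * m%:Z - R%:Z * \sum_i z i * u i).
      by rewrite su mulr0 subr0.
    by rewrite mulr_sumr mulr_suml -sumrB; apply: eq_bigr => i _; ring.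
  rewrite -(leq_pmul2r m0) -[X in (_ * X)%N](absz_nat m) -abszM e.
  rewrite -lez_nat abszE; apply: le_trans (ler_norm_sum _ _ _) _.
  have -> : (n * K * m)%:Z = \sum_(i < n) (K * m)%:Z :> int.
    by rewrite sumr_const card_ord -mulnA PoszM -[n%:Z]natz mulr_natl.
  apply: ler_sum => i _; rewrite -abszE lez_nat abszM leq_mul ?(hzz i).2 //.
  by have [] := hv i.
(* The same value for every k, so the ratios of eigenvalues satisfy the hypothesis psi^u = 1 of
   [height_bound]. *)
have pwu k : pw (chi^~ k) u = rho.
  rewrite (_ : pw _ u = pw (chi^~ k) (fun i => (a i)%:Z + (b i)%:Z * -1)); last first.
    by apply: eq_bigr => i _; congr (_ ^ _); rewrite /u; ring.
  rewrite pwD // pwZ !pw_nat eS exprN1 mulfK // mmap1_chi_neq0 //.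
have eigE k : eigval R w k = pw (chi^~ k) v.
  rewrite /eigval -!pw_nat (_ : pw _ (fun i => (w i)%:Z) = pw (chi^~ k) (fun i => v i + (ones n R i)%:Z)).
    by rewrite pwD // mulfK // pw_nat mmap1_chi_neq0.
  by apply: eq_bigr => i _; rewrite wE mnmE.
have hb k l : ((c ^ 2) ^ n)%:R * (eigval R w k / eigval R w l) \in Aint /\
    `|((c ^ 2) ^ n)%:R * (eigval R w k / eigval R w l)| <= (((d.+1 * K) ^ 2) ^ n)%:R.
  have [||i||] := @height_bound n (fun i => chi i k / chi i l) u (c ^ 2) ((d.+1 * K) ^ 2) R m _ m0.
  - by rewrite expn_gt0 c0.
  - by move=> i; rewrite mulf_neq0 ?invr_neq0.
  - have [h1 h2] := row_spectrum k spec (intS i).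
    have [h3 h4] := row_spectrum l spec (intS i).
    have [h1' h2'] := row_spectrum k spec' (intS' i).
    have [h3' h4'] := row_spectrum l spec' (intS' i).
    have e1 : (c ^ 2)%:R * (chi i k / chi i l) = (c%:R * chi i k) * (c%:R * (chi i l)^-1).
      by rewrite natrX; ring.
    have e2 : (c ^ 2)%:R * (chi i k / chi i l)^-1 = (c%:R * chi i l) * (c%:R * (chi i k)^-1).
      by rewrite natrX invf_div; ring.
    rewrite e1 e2; split; [exact: rpredM | exact: rpredM | |];
      by rewrite normrM natrX expr2; apply: ler_pM.
  - by rewrite pw_div !pwu divff.
  by rewrite pw_div -!eigE => h1 h2; split.
have tE : ratr (tau_value S S' c R j w) = \sum_k \sum_l (((c ^ 2) ^ n)%:R * (eigval R w k / eigval R w l)) ^+ j.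
  rewrite /tau_value rmorphM /= tau_eigval ratr_nat mulr_sumr; apply: eq_bigr => k _.
  by rewrite mulr_sumr; apply: eq_bigr => l _; rewrite [RHS]exprMn -natrX.
(* The value is rational because it is made of traces, and a rational algebraic integer is an
   integer. *)
have tA : ratr (tau_value S S' c R j w) \in Aint.
  rewrite tE; apply: rpred_sum => k _; apply: rpred_sum => l _; apply: rpredX; exact: (hb k l).1.
have /intrP[z zE] : (ratr (tau_value S S' c R j w) : algC) \is a Num.int.
  by apply: Cint_rat_Aint tA; apply: Crat_rat.
apply/smallintP; exists z.
  have e : ratr (tau_value S S' c R j w) = ratr z%:~R :> algC by rewrite zE ratr_int.
  exact: (fmorph_inj _ e).
rewrite -(ler_nat algC) -[(`|z|%N)%:R]/((`|z|%N)%:Z%:~R) abszE intr_norm -zE tE.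
apply: le_trans (ler_norm_sum _ _ _) _.
have -> : (tau_bound n d K j)%:R = \sum_(k < d.+1) \sum_(l < d.+1) (((d.+1 * K) ^ 2) ^ n)%:R ^+ j :> algC.
  by rewrite !sumr_const !card_ord /tau_bound -mulrnA mulnn -[RHS]mulr_natl natrM; congr (_ * _); rewrite natrX.
apply: ler_sum => k _; apply: le_trans (ler_norm_sum _ _ _) _; apply: ler_sum => l _.
by rewrite normrX; apply: lerXn2r; rewrite ?nnegrE ?ler0n // (hb k l).2.
Qed.

End Sound.
End PassingTheory.

(** * Existence of the radius by the pigeonhole principle *)

Definition unbounded (A : nat -> Prop) := forall N : nat, exists2 R, (N <= R)%N & A R.

Lemma unbounded_pigeonhole (X : eqType) (A : nat -> Prop) (f : nat -> X) (s : seq X) :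
  unbounded A -> (forall R, A R -> f R \in s) ->
  exists2 B : nat -> Prop, unbounded B & (forall R, B R -> A R) /\ exists x, forall R, B R -> f R = x.
Proof.
move=> uA; elim: s A uA => [|x s IH] A uA fs.
  by have [R _ /fs] := uA 0%N.
case: (classic (unbounded (fun R => A R /\ f R = x))) => [u|nu].
  by exists (fun R => A R /\ f R = x) => //; split=> [R []|] //; exists x => R [].
have [N hN] : exists N, forall R, (N <= R)%N -> A R -> f R <> x.
  apply: NNPP => no; apply: nu => N; apply: NNPP => n; apply: no; exists N => R NR AR e.
  by apply: n; exists R.
have [||B uB [BA hB]] := IH (fun R => A R /\ (N <= R)%N).
- move=> N'; have [R h AR] := uA (maxn N N').
  exists R; first exact: leq_trans (leq_maxr _ _) h.
  by split=> //; apply: leq_trans (leq_maxl _ _) h.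
- move=> R [AR NR]; have := fs R AR; rewrite inE => /orP[/eqP e|//].
  by case: (hN R NR AR).
by exists B => //; split=> // R /BA[].
Qed.

Lemma unbounded_pigeonhole_fam (I : eqType) (X : eqType) (A : nat -> Prop) (f : I -> nat -> X) (s : I -> seq X) (r : seq I) :
  unbounded A -> (forall i R, i \in r -> A R -> f i R \in s i) ->
  exists2 B : nat -> Prop, unbounded B & (forall R, B R -> A R) /\
    forall i R R', i \in r -> B R -> B R' -> f i R = f i R'.
Proof.
elim: r A => [|i r IH] A uA fs; first by exists A.
have [R AR|B uB [BA [x hx]]] := unbounded_pigeonhole (f := f i) (s := s i) uA.
  by apply: fs; rewrite ?mem_head.
have [j R jr BR|C uC [CB hC]] := IH B uB.
  by apply: fs; rewrite ?inE ?jr ?orbT //; apply: BA.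
exists C => //; split=> [R /CB /BA //|j R R'].
rewrite inE => /orP[/eqP-> /CB h /CB h'|]; last exact: hC.
by rewrite (hx _ h) (hx _ h').
Qed.

(** If z occurs in s but not in t, some p of degree at most J vanishes on t and on the elements of s
    other than z, but not at z. Equal power sums give equal sums of p over s and t, yet one is 0 and
    the other a positive multiple of p(z). *)
Lemma power_sums_mem (F : numFieldType) (s t : seq F) (J : nat) : (size s + size t <= J)%N ->
  (forall j, (j <= J)%N -> \sum_(x <- s) x ^+ j = \sum_(x <- t) x ^+ j) -> {subset s <= t}.
Proof.
move=> sJ ps z zs; apply/negPn/negP => zt.
pose p : {poly F} := \prod_(y <- rem z s | y != z) ('X - y%:P) * \prod_(y <- t) ('X - y%:P).
have sp : (size p <= J.+1)%N.
  apply: leq_trans (size_polyMleq _ _) _; rewrite -big_filter !size_prod_XsubC addSn addnS /= ltnS.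
  apply: leq_trans sJ; rewrite leq_add2r size_filter.
  by apply: leq_trans (count_size _ _) _; rewrite size_rem // leq_pred.
have e : \sum_(x <- s) p.[x] = \sum_(x <- t) p.[x].
  have E r : \sum_(x <- r) p.[x] = \sum_(i < J.+1) p`_i * \sum_(x <- r) x ^+ i.
    rewrite (eq_bigr (fun x => \sum_(i < J.+1) p`_i * x ^+ i)).
      by rewrite exchange_big; apply: eq_bigr => i _; rewrite mulr_sumr.
    by move=> x _; apply: horner_coef_wide.
  by rewrite !E; apply: eq_bigr => i _; rewrite ps // -ltnS.
have pt0 : \sum_(x <- t) p.[x] = 0.
  rewrite big_seq big1 // => x xt; rewrite hornerM !horner_prod.
  by rewrite [X in _ * X](big_rem x) //= hornerXsubC subrr mul0r mulr0.
have pz : p.[z] != 0.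
  rewrite hornerM mulf_neq0 // horner_prod prodf_seq_neq0; apply/allP => y yt; apply/implyP => yz.
    by rewrite hornerXsubC subr_eq0 eq_sym.
  by rewrite hornerXsubC subr_eq0; apply: contraNneq zt => ->.
have : \sum_(x <- s) p.[x] = p.[z] *+ count_mem z s.
  rewrite (bigID (pred1 z)) /= [X in _ + X]big_seq_cond [X in _ + X]big1 ?addr0 => [|x /andP[xs xz]].
    rewrite -big_filter (eq_big_seq (fun=> p.[z])) => [|x]; last by rewrite mem_filter => /andP[/eqP->].
    by rewrite big_const_seq iter_addr_0 count_predT size_filter.
  have xr : x \in rem z s.
    by have := perm_mem (perm_to_rem zs) x; rewrite xs inE (negbTE xz) /= => <-.
  rewrite hornerM horner_prod (big_rem x) //= xz hornerXsubC subrr mul0r mul0r //.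
rewrite e pt0 => /esym/eqP; rewrite mulrn_eq0 (negbTE pz) orbF.
by rewrite -leqn0 leqNgt -has_count has_pred1 zs.
Qed.

Section SphereExists.
Variables (n d : nat) (S S' T W : 'I_n -> 'M[rat]_d.+1) (g : 'I_n -> {poly rat}) (D c K : nat).
Hypothesis cert : cert_algebra S S' T W g D.
Variables (P : 'M[algC]_d.+1) (chi : 'I_n -> 'I_d.+1 -> algC).
Hypothesis spec : joint_spectrum S P chi.
Implicit Types (w a b : 'X_{1..n}).
Hypothesis c0 : (0 < c)%N.
Hypothesis inj : forall a b, wsum T a = wsum T b ->
  (exists rho, forall k, mmap1 (chi^~ k) a = rho * mmap1 (chi^~ k) b) -> a = b.

(** Suppose every sphere has a passing point. Infinitely many radii share the nilpotent values and
    the power sums; their eigenvalue ratios then lie in one finite list, and a second pigeonhole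
    makes the ratios themselves agree. Two such radii give a relation. *)
Lemma sphere_ex : exists R, forall w, on_sphere R w -> ~ passes S S' T c K R w.
Proof.
apply: NNPP => no.
have ex R : exists w, on_sphere R w /\ passes S S' T c K R w.
  apply: NNPP => nw; apply: no; exists R => w h1 h2; apply: nw; by exists w.
have [w hw] := choice_fun ex.
have uT : unbounded (fun=> True) by move=> N; exists N.
pose ints B : seq rat := [seq z%:~R | z <- [seq k%:Z | k <- iota 0 B.+1] ++ [seq - k%:Z | k <- iota 0 B.+1]].
have intsP B x : smallint B x -> x \in ints B.
  case/smallintP => z -> zB; apply: (map_f (fun z : int => z%:~R : rat)); rewrite mem_cat.
  case: z zB => k kB; apply/orP; [left|right].
    by apply: (map_f Posz); rewrite mem_iota add0n ltnS.
  by rewrite NegzE; apply/mapP; exists k.+1 => //; rewrite mem_iota add0n ltnS.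
have [|A1 uA1 [_ h1]] := @unbounded_pigeonhole_fam _ _ (fun=> True)
   (fun ij : 'I_d.+1 * 'I_d.+1 => fun R => nil_value T c R (w R) ij.1 ij.2) (fun=> ints (n * K)%N)
   (enum {: 'I_d.+1 * 'I_d.+1}) uT.
  by move=> i R _ _; apply: intsP; have [_ [h _]] := hw R; apply: h.
have [|A2 uA2 [A21 h2]] := @unbounded_pigeonhole_fam _ _ A1
   (fun j R => tau_value S S' c R j (w R)) (fun j => ints (tau_bound n d K j))
   (iota 0 (2 * d.+1 ^ 2).+1) uA1.
  move=> j R; rewrite mem_iota add0n ltnS => /andP[_ jJ] _.
  by apply: intsP; have [_ [_ h]] := hw R; apply: h.
have [R0 _ AR0] := uA2 0%N.
pose ratios R : seq algC := [seq eigval chi R (w R) kl.1 / eigval chi R (w R) kl.2 | kl <- enum {: 'I_d.+1 * 'I_d.+1}].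
have sz R : size (ratios R) = (d.+1 ^ 2)%N.
  by rewrite size_map -cardE card_prod card_ord mulnn.
have rat_tau R j : \sum_(x <- ratios R) x ^+ j = ratr (tau S S' R j (w R)) :> algC.
  rewrite (tau_eigval cert spec) big_map big_enum /= pair_big /=; by apply: eq_bigl => -[].
have sub R : A2 R -> {subset ratios R <= ratios R0}.
  move=> AR; apply: (@power_sums_mem _ _ _ (2 * d.+1 ^ 2)); first by rewrite !sz addnn mul2n.
  move=> j jJ; rewrite !rat_tau; congr ratr.
  have : tau_value S S' c R j (w R) = tau_value S S' c R0 j (w R0).
    by apply: h2 => //; rewrite mem_iota add0n ltnS jJ.
  by rewrite /tau_value; apply: mulfI; rewrite pnatr_eq0 -lt0n !expn_gt0 c0.
have [|A3 uA3 [A32 h3]] := @unbounded_pigeonhole_fam _ _ A2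
   (fun kl : 'I_d.+1 * 'I_d.+1 => fun R => eigval chi R (w R) kl.1 / eigval chi R (w R) kl.2) (fun=> ratios R0)
   (enum {: 'I_d.+1 * 'I_d.+1}) uA2.
  by move=> kl R _ AR; apply: (sub R AR); apply: map_f; rewrite mem_enum.
have [R1 _ AR1] := uA3 0%N.
have [R2 R12 AR2] := uA3 R1.+1.
(* The relation is the difference of the two rounded points w - (R, .., R), rewritten with natural
   exponents on both sides. *)
pose a := (w R1 + ones n R2)%MM; pose b := (w R2 + ones n R1)%MM.
have wsumD x y : wsum T (x + y)%MM = wsum T x + wsum T y.
  by rewrite -big_split; apply: eq_bigr => i _; rewrite mnmDE mulrnDr.
have ab : a = b.
  apply: inj.
    have e : nil_value T c R1 (w R1) = nil_value T c R2 (w R2).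
      apply/matrixP => i j; apply: (h1 (i, j)); rewrite ?mem_enum //; exact/A21/A32.
    have {}e : wsum T (w R1) - wsum T (ones n R1) = wsum T (w R2) - wsum T (ones n R2).
      by apply: (scalerI (_ : (c%:R : rat) != 0)) e; rewrite pnatr_eq0 -lt0n.
    by rewrite !wsumD -[wsum T (w R1)](subrK (wsum T (ones n R1))) e addrAC subrK.
  exists (eigval chi R1 (w R1) 0 / eigval chi R2 (w R2) 0) => k.
  have e := h3 (k, ord0) R1 R2; rewrite mem_enum /= in e; have {}e := e isT AR1 AR2.
  have hE R' (w' : 'X_{1..n}) k' : mmap1 (chi^~ k') w' = eigval chi R' w' k' * mmap1 (chi^~ k') (ones n R').
    by rewrite divfK // (mmap1_chi_neq0 cert spec).
  have mD (x y : 'X_{1..n}) k' : mmap1 (chi^~ k') (x + y)%MM = mmap1 (chi^~ k') x * mmap1 (chi^~ k') y.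
    by apply: comm_mmap1D => i j; apply: mulrC.
  rewrite /a /b !mD (hE R1 (w R1)) (hE R2 (w R2)).
  have n1 := eigval_neq0 cert spec R1 (w R1) 0; have n2 := eigval_neq0 cert spec R2 (w R2) 0.
  have -> : eigval chi R1 (w R1) k = eigval chi R2 (w R2) k / eigval chi R2 (w R2) 0 * eigval chi R1 (w R1) 0.
    by rewrite -e divfK.
  by ring.
(* The points differ: that of radius R2 has a coordinate of absolute value R2, while those of the
   other are at most R1 < R2. *)
have [[b1 _] _] := hw R1; have [[_ [i hi]] _] := hw R2.
have := congr1 (fun m : 'X_{1..n} => m i) ab; rewrite !mnmDE !mnmE.
by have := b1 i; move: hi R12; lia.
Qed.

End SphereExists.

Lemma comm_mmapM (K : fieldType) n d (M : 'I_n -> 'M[K]_d.+1) (p q : {mpoly K[n]}) :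
  (forall i j, GRing.comm (M i) (M j)) ->
  mmap (@scalar_mx K d.+1) M (p * q) = mmap (@scalar_mx K d.+1) M p * mmap (@scalar_mx K d.+1) M q.
Proof.
move=> cM; elim/mpolyind: p q => [|c m p _ _ IH] q; first by rewrite mul0r !raddf0 mul0r.
rewrite mulrDl !raddfD /= mulrDl IH; congr (_ + _).
rewrite -scalerAl !mmapZ mmapX -mulrA; congr (_ * _).
elim/mpolyind: q => [|c' m' q _ _ IHq]; first by rewrite mulr0 !raddf0 mulr0.
rewrite mulrDr !raddfD /= mulrDr IHq; congr (_ + _).
rewrite -scalerAr !mmapZ -mpolyXD !mmapX comm_mmap1D // !mulrA; congr (_ * _).
by rewrite -!mulmxE scalar_mxC.
Qed.

Lemma ideal_in_ideal n (F : seq {mpoly rat[n]}) : ideal (in_ideal F).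
Proof.
split.
- by exists (fun=> 0); rewrite big1 // => i _; rewrite mul0r.
- move=> _ _ [h ->] [h' ->]; exists (fun i => h i + h' i).
  by rewrite -big_split; apply: eq_bigr => i _; rewrite mulrDl.
- move=> r _ [h ->]; exists (fun i => r * h i).
  by rewrite mulr_sumr; apply: eq_bigr => i _; rewrite mulrA.
Qed.

Definition certificate n (F : seq {mpoly rat[n]}) d (S S' T W : 'I_n -> 'M[rat]_d.+1)
    (g : 'I_n -> {poly rat}) (D c K R : nat) :=
  [/\ cert_algebra S S' T W g D,
      forall f, f \in F -> mmap (@scalar_mx rat d.+1) (fun i => S i * exp_trunc D (T i)) f = 0,
      (0 < c)%N,
      forall i j k, [/\ smallint K ((c%:R *: S i) j k), smallint K ((c%:R *: S' i) j k) &
                        smallint K ((c%:R *: T i) j k)] &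
      forall w, on_sphere R w -> ~ passes S S' T c K R w].

(** The ideal vanishes at the M_i, while no monomial does. So a nonzero binomial in the ideal has
    two distinct exponents and two nonzero coefficients; it yields a relation, and [passes_ex] a
    passing point on the sphere of radius R. *)
Lemma certificate_sound n (F : seq {mpoly rat[n]}) d (S S' T W : 'I_n -> 'M[rat]_d.+1)
    (g : 'I_n -> {poly rat}) (D c K R : nat) :
  certificate F S S' T W g D c K R ->
  forall p, in_ideal F p -> is_binomial p -> p = 0.
Proof.
move=> [cert FM c0 ints sph] p [h pE] [mu [la [a [b pb]]]].
have [SS' comm TD gS Wg] := cert.
have [P [chi spec]] := joint_spectrum_ex (fun i j => let: And3 x _ _ := comm i j in x) gS Wg.
pose M i := S i * exp_trunc D (T i).
have cST i j : GRing.comm (S i) (T j) by have [] := comm i j.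
have cM i j : GRing.comm (M i) (M j).
  have [h1 h2 h3] := comm i j; have [h1' h2' h3'] := comm j i.
  apply: commrM; apply: commr_sym; apply: commrM.
  - exact: commr_sym.
  - by apply: comm_exp_trunc.
  - by apply/commr_sym/comm_exp_trunc.
  - by apply: comm_exp_trunc; apply/commr_sym/comm_exp_trunc.
have pM : mmap (@scalar_mx rat d.+1) M p = 0.
  rewrite pE raddf_sum big1 // => i _.
  have Fi : F`_i \in F by apply: mem_nth.
  by rewrite [LHS](comm_mmapM (h i) F`_i cM) (FM _ Fi) mulr0.
have nz x : mmap1 M x != 0.
  have [F' hF'] : exists F', is_exp (- wsum T x) F'.
    by apply: is_expN; have [N hN _] := is_exp_wsum cert x; exists N.
  have E1 := is_exp_mulV (is_exp_wsum cert x) hF'.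
  apply/eqP => z; have := congr1 (fun y => y * F') z.
  rewrite /M (cert_mmap1 cert) mul0r -mulrA E1 mulr1 => Sx.
  have := spectrum_mmap1 spec x; rewrite Sx map_mx0 mulmx0 => /esym z'.
  have {}z' : diag_mx (\row_k mmap1 (chi^~ k) x) = 0 by rewrite -[LHS](mulmxK spec.1) z' mul0mx.
  move/matrixP/(_ 0 0): z'; rewrite !mxE eqxx mulr1n => /eqP.
  by rewrite (negbTE (mmap1_chi_neq0 cert spec 0 x)).
have e : mu *: mmap1 M a = la *: mmap1 M b.
  move: pM; rewrite pb raddfB /= !mmapZ !mmapX -!mulmxE !mul_scalar_mx => /eqP.
  by rewrite subr_eq0 => /eqP.
rewrite pb.
have [mu0|mu0] := eqVneq mu 0.
  move: e; rewrite mu0 scale0r => /esym/eqP; rewrite scaler_eq0 (negbTE (nz b)) orbF.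
  by move=> /eqP->; rewrite !scale0r subr0.
have [la0|la0] := eqVneq la 0.
  by move: e; rewrite la0 scale0r => /eqP; rewrite scaler_eq0 (negbTE (nz a)) (negbTE mu0).
have [ab|ab] := eqVneq a b.
  move: e; rewrite ab => /eqP; rewrite -subr_eq0 -scalerBl scaler_eq0 (negbTE (nz b)) orbF subr_eq0.
  by move=> /eqP->; rewrite subrr.
have [eT eS] := cert_relation cert spec mu0 la0 e.
have [w [w1 w2]] := passes_ex cert spec c0 (fun i j k => let: And3 x _ _ := ints i j k in x)
  (fun i j k => let: And3 _ x _ := ints i j k in x) (fun i j k => let: And3 _ _ x := ints i j k in x) R ab eT eS.
by case: (sph w w1).
Qed.

Lemma comm_horner (d : nat) (A x : 'M[rat]_d.+1) p : GRing.comm x A -> GRing.comm x (horner_mx A p).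
Proof.
move=> cx; elim/poly_ind: p => [|p c IH]; first by rewrite rmorph0; apply: commr0.
rewrite rmorphD rmorphM /= horner_mx_X horner_mx_C; apply: commrD; first exact: commrM.
by rewrite /GRing.comm -!mulmxE scalar_mxC.
Qed.

Lemma comm_horner_alg (A : algType rat) (a x : A) p : GRing.comm x a -> GRing.comm x (horner_alg a p).
Proof.
move=> cx; elim/poly_ind: p => [|p c IH]; first by rewrite rmorph0; apply: commr0.
rewrite rmorphD rmorphM /= horner_algX horner_algC; apply: commrD; first exact: commrM.
by rewrite /GRing.comm mulr_algl mulr_algr.
Qed.

Lemma common_denominator (L : seq rat) : exists c K, (0 < c)%N /\ forall x, x \in L -> smallint K (c%:R * x).
Proof.
elim: L => [|x L [c [K [c0 h]]]]; first by exists 1%N, 0%N.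
exists (c * `|denq x|)%N, (maxn (K * `|denq x|) (c * `|numq x|))%N; split.
  by rewrite muln_gt0 c0 absz_gt0 denq_neq0.
have dE : (`|denq x|%N%:R : rat) = (denq x)%:~R by rewrite -[in RHS]absz_denq.
move=> y; rewrite inE => /orP[/eqP->|yL]; apply/smallintP.
  exists (c%:Z * numq x); last by rewrite abszM leq_maxr.
  by rewrite natrM dE rmorphM -mulrA /= [(denq x)%:~R * x]mulrC -numqE.
have /smallintP[z zE zK] := h y yL; exists (z * denq x).
  by rewrite natrM mulrAC zE dE rmorphM.
by rewrite abszM; apply: leq_trans (leq_maxl _ _); rewrite leq_mul.
Qed.

(** * From commuting invertible matrices to certificate data *)

Section Decomposition.
Variables (n d : nat) (M M' : 'I_n -> 'M[rat]_d.+1).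
Hypothesis cM : forall i j, GRing.comm (M i) (M j).
Hypothesis MM' : forall i, M i * M' i = 1.

Lemma certificate_of_matrices : exists S S' T W g D,
  cert_algebra S S' T W g D /\ forall i, M i = S i * exp_trunc D (T i).
Proof.
(* The bicommutant of the M_i. Any two of its elements commute, and everything constructed below
   belongs to it. *)
pose Z x := forall y, (forall i, GRing.comm y (M i)) -> GRing.comm y x.
have ZM i : Z (M i) by move=> y; apply.
have ZZ x y : Z x -> Z y -> GRing.comm x y.
  by move=> Zx Zy; apply: Zy => i; apply/commr_sym/Zx => j; apply: cM.
have M'M i : M' i * M i = 1 by apply: mulmx1C; apply: MM'.
have ZM' i : Z (M' i).
  move=> y h; rewrite /GRing.comm -[LHS]mul1r -(M'M i) -mulrA [M i * _]mulrA -h -[y * M i * _]mulrA MM'.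
  by rewrite mulr1.
have ex i : exists q : 'M[rat]_d.+1 * 'M[rat]_d.+1 * 'M[rat]_d.+1 * 'M[rat]_d.+1 * {poly rat},
  let: (A, A', B, C, f) := q in
  [/\ A * A' = 1, Z A, Z B, horner_mx A f = 0 & C * horner_mx A f^`() = 1] /\
  exists E, is_exp B E /\ M i = A * E.
  have [s [g [w [[N nilN] Sg Wg]]]] := jordan_chevalley (M i).
  set S := horner_mx (M i) s in nilN Sg Wg.
  have ZS : Z S by move=> y h; apply/comm_horner/h.
  (* S = M (1 - nu) with nu nilpotent, so the geometric series inverts S. *)
  pose nu := M' i * (M i - S).
  have Znu : Z nu by move=> y h; apply: commrM; [exact: ZM'|apply: commrB; [exact: ZM|exact: ZS]].
  have nunil : nu ^+ N = 0.
    rewrite /nu exprMn_comm ?nilN ?mulr0 //; apply: ZZ => // y h.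
    by apply: commrB; [exact: ZM|exact: ZS].
  pose S' := (\sum_(k < N) nu ^+ k) * M' i.
  have SE : S = M i * (1 - nu) by rewrite /nu mulrBr mulr1 mulrA MM' mul1r opprB addrC subrK.
  have SS' : S * S' = 1.
    rewrite SE /S' mulrA -[M i * _ * _]mulrA.
    have -> : (1 - nu) * (\sum_(k < N) nu ^+ k) = 1.
      by rewrite -opprB mulNr -subrX1 nunil sub0r opprK.
    by rewrite mulr1 MM'.
  have ZS' : Z S'.
    move=> y h; apply: commrM; last exact: ZM'.
    by elim/big_ind: _ => [|u v|k _]; [exact: commr0|exact: commrD|apply/commrX/Znu].
  (* M = S (1 + nu'), and T is the logarithm of the unipotent factor. *)
  pose nu' := S' * (M i - S).
  have nu'nil : nu' ^+ N = 0.
    rewrite /nu' exprMn_comm ?nilN ?mulr0 //; apply: ZZ => // y h.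
    by apply: commrB; [exact: ZM|exact: ZS].
  have [p hp] := log_ex (ex_intro _ N nu'nil).
  exists (S, S', horner_alg nu' p, horner_mx S w, g); split; [split=> // | ].
    move=> y h; apply: comm_horner_alg; apply: commrM; first exact: ZS'.
    by apply: commrB; [exact: ZM|exact: ZS].
  exists (1 + nu'); split=> //.
  by rewrite mulrDr mulr1 /nu' mulrA SS' mul1r addrC subrK.
have [q hq] := choice_fun ex.
pose S i := (q i).1.1.1.1; pose S' i := (q i).1.1.1.2; pose T i := (q i).1.1.2.
pose W i := (q i).1.2; pose g i := (q i).2.
have hq' i : [/\ S i * S' i = 1, Z (S i), Z (T i), horner_mx (S i) (g i) = 0 & W i * horner_mx (S i) (g i)^`() = 1] /\
  exists E, is_exp (T i) E /\ M i = S i * E.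
  by move: (hq i); rewrite /S /S' /T /W /g; case: (q i) => -[[[]]].
have exD i : exists D, T i ^+ D = 0 by have [_ [E [[D TD _] _]]] := hq' i; exists D.
have [D hD] := choice_fun exD.
pose D0 := \max_i D i.
have TD i : T i ^+ D0 = 0 by apply: expr_nil_ge (hD i) _; apply: leq_bigmax.
exists S, S', T, W, g, D0; split=> [|i]; last first.
  have [_ [E [hE ->]]] := hq' i; congr (_ * _).
  exact: is_exp_uniq hE (is_exp_trunc (TD i)).
split=> [i|i j|//|i|i]; try by have [[]] := hq' i.
have [[_ Zi Ti _ _] _] := hq' i; have [[_ Zj Tj _ _] _] := hq' j.
by split; apply: ZZ.
Qed.

End Decomposition.

(** * Laurent polynomials and completeness of the certificates *)

Lemma clear_denominator (K : fieldType) (x y z t : K) : z != 0 ->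
  x * (y - t * z) = z * (x * (y / z - t)).
Proof. by move=> z0; field. Qed.

Section Laurent.
Variables (n : nat) (F : seq {mpoly rat[n]}).
Local Notation P := {mpoly rat[n]}.
Local Notation Q := {mpoly rat[n + n]}.
Local Notation L := {fraction P}.
Let tof : {rmorphism P -> L} := @tofrac P.

(* Laurent polynomials are represented in n + n variables, the last n of which
   stand for the inverses of the first n. *)
Definition lvar (k : 'I_(n + n)) : L :=
  match split k with inl i => tof 'X_i | inr i => (tof 'X_i)^-1 end.

Definition laurent : {rmorphism Q -> L} := mmap (tof \o @mpolyC n rat) lvar.

Definition vars k : P := (\prod_i 'X_i) ^+ k.

Lemma tof_inj : injective tof. Proof. by move=> p q /eqP; rewrite tofrac_eq => /eqP. Qed.

Lemma tofX_neq0 i : tof 'X_i != 0.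
Proof.
rewrite -(rmorph0 tof) (inj_eq tof_inj); apply/eqP => /(congr1 (mcoeff U_(i)%MM)).
by rewrite mcoeffX eqxx mcoeff0 => /eqP; rewrite oner_eq0.
Qed.

Lemma laurent_denominator (g : Q) : exists k p, tof (vars k) * laurent g = tof p.
Proof.
have denM f f' : (exists k p, tof (vars k) * f = tof p) -> (exists k p, tof (vars k) * f' = tof p) ->
   exists k p, tof (vars k) * (f * f') = tof p.
  move=> [k [p e]] [k' [p' e']]; exists (k + k')%N, (p * p').
  by rewrite /vars exprD !rmorphM mulrACA -/(vars k) -/(vars k') e e'.
elim/mpolyind: g => [|c m g _ _ [k [p e]]].
  by exists 0%N, 0; rewrite !rmorph0 mulr0.
have [k' [p' e']] : exists k p, tof (vars k) * laurent (c *: 'X_[m]) = tof p.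
  have -> : laurent (c *: 'X_[m]) = tof c%:MP * mmap1 lvar m by rewrite [LHS]mmapZ mmapX.
  apply: (denM).
    by exists 0%N, c%:MP; rewrite /vars expr0 rmorph1 mul1r.
  rewrite /mmap1; elim/big_ind: _ => [|f f'|k' _]; [|exact: denM|].
    by exists 0%N, 1; rewrite /vars expr0 !rmorph1 mul1r.
  elim: (m k') => [|j IH]; first by exists 0%N, 1; rewrite /vars !expr0 !rmorph1 mul1r.
  rewrite exprS; apply: (denM) => //.
  rewrite /lvar; case: split => i; first by exists 0%N, 'X_i; rewrite /vars expr0 rmorph1 mul1r.
  exists 1%N, (\prod_(j < n | j != i) 'X_j); rewrite /vars expr1 (bigD1 i) //= rmorphM mulrAC mulfV ?mul1r //.
  exact: tofX_neq0.
exists (k + k')%N, (vars k' * p + vars k * p').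
rewrite rmorphD mulrDr /vars exprD !rmorphD !rmorphM -/(vars k) -/(vars k') -e -e'; ring.
Qed.

(** The preimage of the extension of I to Laurent polynomials: a power of x_1 ... x_n carries g into
    I. *)
Definition laurent_ideal (g : Q) := exists k p, in_ideal F p /\ tof (vars k) * laurent g = tof p.

Lemma ideal_laurent_ideal : ideal laurent_ideal.
Proof.
have idF := ideal_in_ideal F; split.
- by exists 0%N, 0; split; [apply: ideal0 | rewrite !rmorph0 mulr0].
- move=> a b [k [p [Fp e]]] [k' [p' [Fp' e']]]; exists (k + k')%N, (vars k' * p + vars k * p').
  split; first by apply: idealD => //; apply: idealMl.
  by rewrite rmorphD mulrDr /vars exprD !rmorphD !rmorphM -/(vars k) -/(vars k') -e -e'; ring.
- move=> r a [k [p [Fp e]]]; have [k' [p' e']] := laurent_denominator r.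
  exists (k' + k)%N, (p' * p); split; first exact: idealMl.
  by rewrite !rmorphM /vars exprD !rmorphM -/(vars k) -/(vars k') -e -e'; ring.
Qed.

Lemma laurent_eq0 g : laurent g = 0 -> laurent_ideal g.
Proof.
move=> g0; exists 0%N, 0; split; first exact: ideal0 (ideal_in_ideal F).
by rewrite g0 mulr0 rmorph0.
Qed.

Definition lmon (a b : 'X_{1..n}) : Q :=
  'X_[[multinom match split k with inl i => a i | inr i => b i end | k < n + n]].

Lemma mmap1_lmon (A : nzRingType) (f : 'I_(n + n) -> A) (a b : 'X_{1..n}) :
  mmap1 f [multinom match split k with inl i => a i | inr i => b i end | k < n + n] =
  mmap1 (fun i => f (lshift n i)) a * mmap1 (fun i => f (rshift n i)) b.
Proof.
rewrite /mmap1 big_split_ord; congr (_ * _); apply: eq_bigr => i _; rewrite mnmE.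
  by rewrite -[lshift n i]/(unsplit (inl i)) unsplitK.
by rewrite -[rshift n i]/(unsplit (inr i)) unsplitK.
Qed.

Lemma laurent_lmon a b : laurent (lmon a b) = mmap1 (fun i => tof 'X_i) a / mmap1 (fun i => tof 'X_i) b.
Proof.
rewrite [LHS]mmapX mmap1_lmon; congr (_ * _).
  by apply: mmap1_eq => i; rewrite /lvar -[lshift n i]/(unsplit (inl i)) unsplitK.
rewrite -mmap1V; apply: mmap1_eq => i.
by rewrite /lvar -[rshift n i]/(unsplit (inr i)) unsplitK.
Qed.

Lemma tof_mmap1 a : mmap1 (fun i => tof 'X_i) a = tof 'X_[a].
Proof. by rewrite mpolyXE_id rmorph_prod; apply: eq_bigr => i _; rewrite rmorphXn. Qed.

Definition pospart (z : int) : nat := if z is Posz k then k else 0.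

Lemma pospartE z : (pospart z)%:Z - (pospart (- z))%:Z = z.
Proof. by case: z => [[|k]|k] //=; rewrite ?subr0 ?sub0r. Qed.

Definition lpow (u : 'rV[int]_n) : Q :=
  lmon [multinom pospart (u ord0 i) | i < n] [multinom pospart (- u ord0 i)%R | i < n].

Lemma laurent_lpow u : laurent (lpow u) = \prod_i (tof 'X_i) ^ (u 0 i).
Proof.
rewrite laurent_lmon -prodf_div; apply: eq_bigr => i _; rewrite !mnmE.
by rewrite -[X in _ = _ ^ X]pospartE expfzDr ?tofX_neq0 // exprnP -invr_expz -exprnP.
Qed.

Lemma laurent_lmon_lpow a b : laurent (lmon a b) = laurent (lpow (\row_i ((a i)%:Z - (b i)%:Z))).
Proof.
rewrite laurent_lpow laurent_lmon -prodf_div; apply: eq_bigr => i _; rewrite !mxE.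
by rewrite expfzDr ?tofX_neq0 // exprnP -invr_expz -exprnP.
Qed.

Hypothesis no_binomial : forall p, in_ideal F p -> is_binomial p -> p = 0.

Lemma varsE k : vars k = 'X_[[multinom k | i < n]].
Proof. by rewrite /vars mpolyXE_id -prodrXl; apply: eq_bigr => i _; rewrite mnmE. Qed.

(** Otherwise a power of x_1 ... x_n would be in I, and monomials count as binomials. *)
Lemma laurent_proper : ~ laurent_ideal 1.
Proof.
move=> [k [p [Fp]]]; rewrite rmorph1 mulr1 => /tof_inj e.
have : vars k = 0.
  rewrite e; apply: no_binomial => //; exists 1, 0, [multinom k | i < n], 0%MM.
  by rewrite -e varsE scale1r scale0r subr0.
rewrite varsE => /(congr1 (mcoeff [multinom k | i < n])).
by rewrite mcoeffX eqxx mcoeff0 => /eqP; rewrite oner_eq0.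
Qed.

(** Clearing denominators makes x^u - l a binomial of I. It must be 0, so its two exponents
    coincide. *)
Lemma laurent_nonscalar u : scalar_mod laurent_ideal (lpow u) -> u = 0.
Proof.
move=> [l [k [p [Fp e]]]].
set a : 'X_{1..n} := [multinom pospart (u ord0 i) | i < n].
set b : 'X_{1..n} := [multinom pospart (- u ord0 i)%R | i < n].
have {}e : tof (vars k * ('X_[a] - l *: 'X_[b])) = tof ('X_[b] * p).
  have lE : laurent (lpow u - l%:A) = tof 'X_[a] / tof 'X_[b] - tof l%:MP.
    by rewrite [LHS]rmorphB laurent_lmon -/a -/b !tof_mmap1 [laurent l%:A]mmapZ [mmap _ _ 1]rmorph1 mulr1.
  have b0 : tof 'X_[b] != 0 by rewrite -tof_mmap1; apply/prodf_neq0 => i _; rewrite expf_neq0 ?tofX_neq0.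
  rewrite [RHS]rmorphM -e lE [LHS]rmorphM [tof ('X_[a] - _)]rmorphB -mul_mpolyC [tof (l%:MP * _)]rmorphM.
  exact: clear_denominator.
move/tof_inj: e => e.
have e0 : vars k * ('X_[a] - l *: 'X_[b]) = 0.
  apply: no_binomial; first by rewrite e; apply: idealMl => //; apply: ideal_in_ideal.
  exists 1, l, ([multinom k | i < n] + a)%MM, ([multinom k | i < n] + b)%MM.
  by rewrite mulrBr -scalerAr varsE !mpolyXD scale1r.
have ab : a = b.
  apply/eqP/negPn/negP => ab.
  have v0 : vars k != 0.
    rewrite varsE; apply/eqP => /(congr1 (mcoeff [multinom k | i < n])).
    by rewrite mcoeffX eqxx mcoeff0 => /eqP; rewrite oner_eq0.
  move/eqP: e0; rewrite mulf_eq0 (negbTE v0) /= => /eqP/(congr1 (mcoeff a)).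
  rewrite mcoeffB mcoeffZ !mcoeffX eqxx mcoeff0 eq_sym (negbTE ab) mulr0 subr0.
  by move/eqP; rewrite oner_eq0.
apply/rowP => i; rewrite mxE -(pospartE (u 0 i)).
by have := congr1 (fun m : 'X_{1..n} => m i) ab; rewrite !mnmE => ->; rewrite subrr.
Qed.

Theorem certificate_complete : exists d (S S' T W : 'I_n -> 'M[rat]_d.+1) (g : 'I_n -> {poly rat}) (D c K R : nat),
  certificate F S S' T W g D c K R.
Proof.
have idL := ideal_laurent_ideal.
have TD u v : laurent_ideal (lpow (u + v) - lpow u * lpow v).
  apply: laurent_eq0; rewrite rmorphB rmorphM /= !laurent_lpow -big_split /=; apply/eqP.
  rewrite subr_eq0; apply/eqP; apply: eq_bigr => i _.
  by rewrite mxE expfzDr ?tofX_neq0.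
have T0 : laurent_ideal (lpow 0 - 1).
  apply: laurent_eq0; rewrite rmorphB rmorph1 laurent_lpow big1 ?subrr // => i _.
  by rewrite mxE expr0z.
have [J [cJ sJ J1 hJ]] := rank_lowering idL laurent_proper TD T0 laurent_nonscalar.
have [d [M0 [cM0 JM]]] := matrix_representation cJ J1.
pose M i := M0 (lshift n i); pose M' i := M0 (rshift n i).
have idJ := cJ.1.
have MM' i : M i * M' i = 1.
  have : J ('X_(lshift n i) * 'X_(rshift n i) - 1).
    apply: sJ; apply: laurent_eq0; rewrite rmorphB rmorphM rmorph1 /= /laurent !mmapX !mmap1U.
    rewrite /lvar -[lshift n i]/(unsplit (inl i)) -[rshift n i]/(unsplit (inr i)) !unsplitK.
    by rewrite mulfV ?subrr ?tofX_neq0.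
  move/JM; rewrite raddfB /= [mmap _ _ (_ * _)](comm_mmapM _ _ cM0) !mmapX !mmap1U.
  by rewrite -mpolyC1 mmapC => /eqP; rewrite subr_eq0 => /eqP.
have [S [S' [T [W [g [D [cert ME]]]]]]] := certificate_of_matrices (fun i j => cM0 _ _) MM'.
have [SS' comm TDD gS Wg] := cert.
have [P0 [chi spec]] := joint_spectrum_ex (fun i j => let: And3 x _ _ := comm i j in x) gS Wg.
have [c [K [c0 hcK]]] := common_denominator
  ([seq S ijk.1.1 ijk.1.2 ijk.2 | ijk <- enum {: 'I_n * 'I_d.+1 * 'I_d.+1}] ++
   [seq S' ijk.1.1 ijk.1.2 ijk.2 | ijk <- enum {: 'I_n * 'I_d.+1 * 'I_d.+1}] ++
   [seq T ijk.1.1 ijk.1.2 ijk.2 | ijk <- enum {: 'I_n * 'I_d.+1 * 'I_d.+1}]).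
have lmonM a b : mmap (@scalar_mx rat d.+1) M0 (lmon a b) = mmap1 M a * mmap1 M' b.
  by rewrite mmapX mmap1_lmon.
have inj a b : wsum T a = wsum T b ->
    (exists rho, forall k, mmap1 (chi^~ k) a = rho * mmap1 (chi^~ k) b) -> a = b.
  move=> eT [rho eS]; have [l] := cert_relation_conv cert spec eT eS.
  have MEE x : mmap1 (fun i => S i * exp_trunc D (T i)) x = mmap1 M x by apply: mmap1_eq => i; rewrite -ME.
  rewrite !MEE => e.
  (* M^a = l M^b means that x^a - l x^b is in J. Multiplication by x^(-b) puts x^(a-b) - l into J,
     which forces a = b. *)
  have Jl : J (lmon a 0 - l *: lmon b 0).
    by apply/JM; rewrite raddfB /= mmapZ !lmonM mmap11 !mulr1 e -mulmxE mul_scalar_mx subrr.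
  have zero g' : laurent g' = 0 -> J g' by move=> h; apply/sJ/laurent_eq0.
  have Jab : J (lpow (\row_i ((a i)%:Z - (b i)%:Z)) - l%:A).
    have h1 : J (lmon a 0 * lmon 0 b - lpow (\row_i ((a i)%:Z - (b i)%:Z))).
      apply: zero; rewrite rmorphB rmorphM /= -laurent_lmon_lpow !laurent_lmon mmap11.
      by rewrite divr1 mul1r subrr.
    have h2 : J (lmon b 0 * lmon 0 b - 1).
      apply: zero; rewrite rmorphB rmorphM rmorph1 /= !laurent_lmon mmap11.
      rewrite divr1 mul1r mulfV ?subrr //.
      by apply/prodf_neq0 => i _; rewrite expf_neq0 ?tofX_neq0.
    have -> : lpow (\row_i ((a i)%:Z - (b i)%:Z)) - l%:A =
       (lmon a 0 - l *: lmon b 0) * lmon 0 b - (lmon a 0 * lmon 0 b - lpow (\row_i ((a i)%:Z - (b i)%:Z)))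
        + l%:A * (lmon b 0 * lmon 0 b - 1).
      by rewrite mulr_algl scalerBr mulrBl -scalerAl; ring.
    by apply: idealD => //; [apply: idealB => //; apply: idealMr | apply: idealMl].
  have /rowP u0 := hJ _ (ex_intro _ l Jab).
  apply/mnmP => i; have := u0 i; rewrite !mxE => /eqP; rewrite subr_eq0 => /eqP[] //.
have [R hR] := sphere_ex K cert spec c0 inj.
exists d, S, S', T, W, g, D, c, K, R; split=> //.
  (* Evaluating f at the M_i is evaluating its image in n + n variables at [M0], and that image lies
     in [laurent_ideal] with k = 0. *)
  move=> f Ff; have fJ : forall q : P, mmap (@scalar_mx rat d.+1) M q =
     mmap (@scalar_mx rat d.+1) M0 (mmap (@mpolyC (n + n) rat) (fun i => 'X_(lshift n i)) q).
    elim/mpolyind => [|x m q _ _ IH]; first by rewrite !raddf0.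
    rewrite !raddfD /= -IH; congr (_ + _); rewrite !mmapZ !mmapX mul_mpolyC mmapZ; congr (_ * _).
    have -> : mmap1 (fun i => 'X_(lshift n i)) m = lmon m 0.
      rewrite /lmon -mmap1_id mmap1_lmon [X in _ * X]big1 ?mulr1 // => i _.
      by rewrite mnm0E expr0.
    by rewrite lmonM mmap11 mulr1.
  have -> : mmap (@scalar_mx rat d.+1) (fun i => S i * exp_trunc D (T i)) f = mmap (@scalar_mx rat d.+1) M f.
    by apply: eq_bigr => m _; congr (_ * _); apply: mmap1_eq => i; rewrite -ME.
  rewrite fJ; apply/JM/sJ; exists 0%N, f; split.
    have fi : (index f F < size F)%N by rewrite index_mem.
    exists (fun i => if i == Ordinal fi then 1 else 0).
    rewrite (bigD1 (Ordinal fi)) //= eqxx mul1r nth_index // big1 ?addr0 // => i /negbTE->.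
    by rewrite mul0r.
  rewrite /vars expr0 rmorph1 mul1r.
  elim/mpolyind: f {Ff} => [|x m q _ _ IH]; first by rewrite !raddf0.
  rewrite !raddfD /= IH; congr (_ + _); rewrite mmapZ mmapX -mul_mpolyC !rmorphM /=; congr (_ * _).
    by rewrite /laurent mmapC.
  rewrite mpolyXE_id !rmorph_prod; apply: eq_bigr => i _; rewrite !rmorphXn /=; congr (_ ^+ _).
  by rewrite [LHS]mmapX mmap1U /lvar -[lshift n i]/(unsplit (inl i)) unsplitK.
move=> i j k; split; rewrite mxE; apply: hcK; rewrite !mem_cat.
- by apply/orP; left; apply: (map_f (fun ijk : 'I_n * 'I_d.+1 * 'I_d.+1 => S ijk.1.1 ijk.1.2 ijk.2) (x := (i, j, k))); rewrite mem_enum.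
- by apply/orP; right; apply/orP; left; apply: (map_f (fun ijk : 'I_n * 'I_d.+1 * 'I_d.+1 => S' ijk.1.1 ijk.1.2 ijk.2) (x := (i, j, k))); rewrite mem_enum.
- by apply/orP; right; apply/orP; right; apply: (map_f (fun ijk : 'I_n * 'I_d.+1 * 'I_d.+1 => T ijk.1.1 ijk.1.2 ijk.2) (x := (i, j, k))); rewrite mem_enum.
Qed.

End Laurent.

(** * Computability *)

Definition recursive k (f : k.-tuple nat -> nat) :=
  exists r : recf k, forall xs, recf_eval r xs (f xs).

Definition rec1 (f : nat -> nat) := recursive (fun xs : 1.-tuple nat => f (tnth xs 0)).
Definition rec2 (f : nat -> nat -> nat) :=
  recursive (fun xs : 2.-tuple nat => f (tnth xs 0) (tnth xs 1)).
Definition rec3 (f : nat -> nat -> nat -> nat) :=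
  recursive (fun xs : 3.-tuple nat => f (tnth xs 0) (tnth xs 1) (tnth xs 2%:R)).

Section Recursive.
Variable k : nat.
Implicit Types f g h : k.-tuple nat -> nat.

Lemma recursive_ext f g : f =1 g -> recursive f -> recursive g.
Proof. by move=> e [r hr]; exists r => xs; rewrite -e. Qed.

Lemma recursive_proj (i : 'I_k) : recursive (fun xs => tnth xs i).
Proof. by exists (Proj i). Qed.

Lemma recursive_comp m (F : m.-tuple nat -> nat) (G : 'I_m -> k.-tuple nat -> nat) :
  recursive F -> (forall i, recursive (G i)) -> recursive (fun xs => F [tuple G i xs | i < m]).
Proof.
move=> [r hr] hG; have [s hs] := choice_fun hG.
exists (Comp r s) => xs; exists [tuple G i xs | i < m] => [i|]; last exact: hr.
by rewrite tnth_mktuple.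
Qed.

Lemma recursive_op1 F f : rec1 F -> recursive f -> recursive (fun xs => F (f xs)).
Proof.
move=> hF hf; apply: (recursive_ext _ (recursive_comp hF (G := fun _ => f) (fun=> hf))).
by move=> xs; rewrite tnth_mktuple.
Qed.

Lemma recursive_op2 F f g : rec2 F -> recursive f -> recursive g ->
  recursive (fun xs => F (f xs) (g xs)).
Proof.
move=> hF hf hg; pose G (i : 'I_2) := if i == 0 then f else g.
apply: (recursive_ext _ (recursive_comp hF (G := G) _)) => [xs|i]; first by rewrite !tnth_mktuple.
by rewrite /G; case: ifP.
Qed.

Lemma recursive_succ f : recursive f -> recursive (fun xs => (f xs).+1).
Proof.
apply: recursive_op1; exists Succ => xs; rewrite /= /thead; congr (tnth _ _).+1.
Qed.

Lemma recursive_const c : recursive (fun _ : k.-tuple nat => c).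
Proof. by elim: c => [|c IH]; [exists (Zero k) | apply: recursive_succ]. Qed.

End Recursive.

Lemma rec2_prec f g : rec1 f -> rec3 g ->
  rec2 (fun k p => nat_rect (fun=> nat) (f p) (fun i z => g i z p) k).
Proof.
move=> [r hr] [s hs]; exists (Prec r s) => xs /=.
have -> : behead_tuple xs = [tuple tnth xs 1].
  by apply/val_inj; rewrite /= (tnth_nth 0%N); case: xs => -[|x [|y [|? ?]]].
rewrite /thead -[ord0]/(0 : 'I_2); move: (tnth xs 0) (tnth xs 1) => k p.
elim: k => [|k IH]; first exact: (hr [tuple p]).
eexists; first exact: IH.
exact: hs.
Qed.

Lemma rec1_mu F h : rec2 F -> (forall x, F (h x) x = 0%N /\ forall y, (y < h x)%N -> F y x != 0%N) ->
  rec1 h.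
Proof.
move=> [r hr] hh; exists (Mu r) => xs; have [h1 h2] := hh (tnth xs 0).
have e y : recf_eval r (cons_tuple y xs) (F y (tnth xs 0)).
  by have := hr (cons_tuple y xs); rewrite !(tnth_nth 0%N).
split; first by have := e (h (tnth xs 0)); rewrite h1.
move=> y /h2 Fy; exists (F y (tnth xs 0)).-1; have := e y.
by case: (F y _) Fy.
Qed.

Ltac rec_tac := rewrite /rec1 /rec2 /rec3;
  repeat first [exact: recursive_const | exact: recursive_proj | apply: recursive_succ].

Lemma rec1_comp f g : rec1 f -> rec1 g -> rec1 (fun x => f (g x)).
Proof. by move=> hf hg; apply: recursive_op1 hf hg. Qed.

Lemma rec2_swap f : rec2 f -> rec2 (fun x y => f y x).
Proof. by move=> hf; apply: recursive_op2 hf _ _; rec_tac. Qed.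

Lemma rec1_rec c g : rec2 g -> rec1 (fun k => nat_rect (fun=> nat) c g k).
Proof.
move=> hg.
have h : rec2 (fun k p => nat_rect (fun=> nat) c (fun i z => g i z) k).
  apply: (rec2_prec (f := fun=> c) (g := fun i z _ => g i z)); first by rec_tac.
  by apply: recursive_op2 hg _ _; rec_tac.
by apply: (recursive_op2 h (f := fun xs : 1.-tuple nat => tnth xs 0) (g := fun=> 0%N)); rec_tac.
Qed.

Lemma rec2_addn : rec2 addn.
Proof.
apply: (recursive_ext _ (rec2_prec (f := id) (g := fun _ z _ => z.+1) _ _)); rec_tac.
by move=> xs /=; elim: (tnth xs 0) => //= k ->; rewrite addSn.
Qed.

Lemma rec1_pred : rec1 predn.
Proof.
apply: (recursive_ext _ (rec1_rec 0 (g := fun i _ => i) _)); rec_tac.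
by move=> xs /=; case: (tnth xs 0).
Qed.

Lemma rec2_subn : rec2 subn.
Proof.
apply: rec2_swap; apply: (recursive_ext _ (rec2_prec (f := id) (g := fun _ z _ => z.-1) _ _)); rec_tac.
  move=> xs; rewrite -[RHS]/(subn (tnth xs 1) (tnth xs 0)).
  elim: (tnth xs 0) => [|k IH]; first by rewrite subn0.
  by rewrite subnS -IH.
by apply: recursive_op1 rec1_pred _; rec_tac.
Qed.

Lemma rec2_muln : rec2 muln.
Proof.
apply: (recursive_ext _ (rec2_prec (f := fun=> 0%N) (g := fun _ z p => (z + p)%N) _ _)); rec_tac.
  by move=> xs /=; elim: (tnth xs 0) => //= k ->; rewrite mulSn addnC.
by apply: recursive_op2 rec2_addn _ _; rec_tac.
Qed.

Lemma rec2_expn : rec2 expn.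
Proof.
apply: rec2_swap; apply: (recursive_ext _ (rec2_prec (f := fun=> 1%N) (g := fun _ z p => (p * z)%N) _ _)); rec_tac.
  move=> xs; rewrite -[RHS]/(expn (tnth xs 1) (tnth xs 0)).
  by elim: (tnth xs 0) => [|k IH] //; rewrite expnS -IH.
by apply: recursive_op2 rec2_muln _ _; rec_tac.
Qed.

Lemma rec1_odd : rec1 (fun x => odd x).
Proof.
apply: (recursive_ext _ (rec1_rec 0 (g := fun _ z => (1 - z)%N) _)); rec_tac.
  by move=> xs /=; elim: (tnth xs 0) => //= k ->; case: odd.
by apply: recursive_op2 rec2_subn _ _; rec_tac.
Qed.

Lemma rec1_half : rec1 half.
Proof.
apply: (recursive_ext _ (rec1_rec 0 (g := fun i z => (z + odd i)%N) _)); rec_tac.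
  by move=> xs /=; elim: (tnth xs 0) => //= k ->; rewrite uphalf_half addnC.
by apply: recursive_op2 rec2_addn _ _; [|apply: recursive_op1 rec1_odd _]; rec_tac.
Qed.

Lemma rec2_iter_half : rec2 (fun k z => iter k half z).
Proof.
apply: (recursive_ext _ (rec2_prec (f := id) (g := fun _ z _ => z./2) _ _)); rec_tac.
  by move=> xs /=; elim: (tnth xs 0) => //= k ->.
by apply: recursive_op1 rec1_half _; rec_tac.
Qed.

(* [CodeSeq.code (a :: s)] is [lcons a (CodeSeq.code s)]. *)
Definition lcons (a l : nat) : nat := 2 ^ a * l.*2.+1.
Definition lhead (z : nat) : nat := head 0%N (CodeSeq.decode z).
Definition ltail (z : nat) : nat := CodeSeq.code (behead (CodeSeq.decode z)).

Lemma lhead_cons a l : lhead (lcons a l) = a.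
Proof. by rewrite /lhead -(CodeSeq.decodeK l) -[lcons _ _]/(CodeSeq.code (a :: _)) CodeSeq.codeK. Qed.

Lemma ltail_cons a l : ltail (lcons a l) = l.
Proof.
rewrite /ltail -{1}(CodeSeq.decodeK l) -[lcons _ _]/(CodeSeq.code (a :: _)) CodeSeq.codeK /=.
exact: CodeSeq.decodeK.
Qed.

Lemma lcons_gt0 a l : (0 < lcons a l)%N.
Proof. by rewrite muln_gt0 expn_gt0. Qed.

Lemma lconsP z : (0 < z)%N -> z = lcons (lhead z) (ltail z).
Proof.
rewrite -{1 2}(CodeSeq.decodeK z) /lhead /ltail; case: (CodeSeq.decode z) => //= a l _.
Qed.

Lemma iter_half_lcons a l j : (j <= a)%N -> iter j half (lcons a l) = lcons (a - j) l.
Proof.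
elim: j => [|j IH] ja; first by rewrite subn0.
rewrite iterS IH 1?ltnW // /lcons.
have -> : (a - j = (a - j.+1).+1)%N by rewrite -subSn.
by rewrite expnS -mulnA mul2n doubleK.
Qed.

Lemma rec2_lcons : rec2 lcons.
Proof.
apply: (recursive_ext (f := fun xs : 2.-tuple nat => muln (expn 2 (tnth xs 0)) (addn (tnth xs 1) (tnth xs 1)).+1)).
  by move=> xs /=; rewrite /lcons addnn.
apply: recursive_op2 rec2_muln _ _; first by apply: recursive_op2 rec2_expn _ _; rec_tac.
by apply: recursive_succ; apply: recursive_op2 rec2_addn _ _; rec_tac.
Qed.

Lemma rec1_lhead : rec1 lhead.
Proof.
(* The head is the 2-adic valuation, the least y for which x / 2^y is odd. The factor x stops the
   search at once for x = 0, whose head is the default 0. *)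
apply: (rec1_mu (F := fun y x => ((1 - odd (iter y half x)) * x)%N)).
  apply: recursive_op2 rec2_muln _ _; rec_tac; apply: recursive_op2 rec2_subn _ _; rec_tac.
  apply: recursive_op1 rec1_odd _; apply: recursive_op2 rec2_iter_half _ _; rec_tac.
case=> [|x]; first by rewrite muln0.
have [a [l ->]] : exists a l, x.+1 = lcons a l.
  by exists (lhead x.+1), (ltail x.+1); apply: lconsP.
rewrite lhead_cons; split.
  by rewrite iter_half_lcons // subnn /lcons expn0 mul1n /= odd_double.
move=> y ya; rewrite iter_half_lcons 1?ltnW //.
have -> : odd (lcons (a - y) l) = false by rewrite /lcons oddM oddX /= orbF subn_eq0 leqNgt ya.
by rewrite mul1n -lt0n lcons_gt0.
Qed.

Lemma rec1_ltail : rec1 ltail.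
Proof.
apply: (recursive_ext (f := fun xs : 1.-tuple nat => (iter (lhead (tnth xs 0)) half (tnth xs 0))./2)).
  move=> xs /=; case: (tnth xs 0) => [//|x].
  have [a [l ->]] : exists a l, x.+1 = lcons a l.
    by exists (lhead x.+1), (ltail x.+1); apply: lconsP.
  rewrite ltail_cons lhead_cons iter_half_lcons //.
  by rewrite subnn /lcons expn0 mul1n /= uphalf_double.
apply: recursive_op1 rec1_half _; apply: recursive_op2 rec2_iter_half _ _; rec_tac.
by apply: recursive_op1 rec1_lhead _; rec_tac.
Qed.

(** * Pairing, and computable functions on coded types *)

(** [lcons] is a bijection from pairs onto the positive integers; the predecessor makes it a pairing
    function onto all of [nat]. *)
Definition pr a b := (lcons a b).-1.
Definition pfst z := lhead z.+1.
Definition psnd z := ltail z.+1.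

Lemma pfst_pr a b : pfst (pr a b) = a.
Proof. by rewrite /pfst /pr prednK ?lcons_gt0 // lhead_cons. Qed.
Lemma psnd_pr a b : psnd (pr a b) = b.
Proof. by rewrite /psnd /pr prednK ?lcons_gt0 // ltail_cons. Qed.

Lemma rec2_pr : rec2 pr.
Proof. exact: recursive_op1 rec1_pred rec2_lcons. Qed.
Lemma rec1_pfst : rec1 pfst.
Proof. by apply: recursive_op1 rec1_lhead _; rec_tac. Qed.
Lemma rec1_psnd : rec1 psnd.
Proof. by apply: recursive_op1 rec1_ltail _; rec_tac. Qed.

(* [dec] need not be injective: a rational number is coded by any fraction. *)
Class Rep (X : Type) := { dec : nat -> X; dec_surj : forall x, exists z, dec z = x }.

Program Instance rep_nat : Rep nat := {| dec := id |}.
Next Obligation. by exists x. Qed.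

Program Instance rep_bool : Rep bool := {| dec := fun z => z != 0%N |}.
Next Obligation. by exists x; case: x. Qed.

Program Instance rep_prod X Y (rX : Rep X) (rY : Rep Y) : Rep (X * Y) :=
  {| dec := fun z => (dec (pfst z), dec (psnd z)) |}.
Next Obligation.
have [a <-] := dec_surj x; have [b <-] := dec_surj y.
by exists (pr a b); rewrite pfst_pr psnd_pr.
Qed.

Program Instance rep_seq X (rX : Rep X) : Rep (seq X) :=
  {| dec := fun z => [seq dec a | a <- CodeSeq.decode z] |}.
Next Obligation.
elim: x => [|a s [z <-]]; first by exists 0%N.
by have [c <-] := dec_surj a; exists (CodeSeq.code (c :: CodeSeq.decode z)); rewrite CodeSeq.codeK.
Qed.

(** A difference of naturals over a successor: every triple is valid, and arithmetic involves
    neither signs nor reduction. *)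
Definition fracval (t : nat * nat * nat) : rat := (t.1.1%:R - t.1.2%:R) / t.2.+1%:R.

Program Instance rep_rat : Rep rat := {| dec := fun z => fracval (dec z) |}.
Next Obligation.
have [z hz] := dec_surj (match numq x with Posz k => k | Negz _ => 0%N end,
  match numq x with Posz k => 0%N | Negz k => k.+1 end, `|denq x|.-1).
exists z; apply: etrans (congr1 fracval hz) _; rewrite /fracval /= prednK ?absz_gt0 ?denq_neq0 //.
have -> : (`|denq x|%N%:R : rat) = (denq x)%:~R by rewrite -[in RHS]absz_denq.
rewrite -[RHS]divq_num_den; congr (_ / _).
by case: (numq x) => k; rewrite ?subr0 // sub0r NegzE rmorphN.
Qed.

Definition comp X Y (rX : Rep X) (rY : Rep Y) (f : X -> Y) :=
  exists2 g : nat -> nat, rec1 g & forall z, f (dec z) = dec (g z).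
Arguments comp {X Y rX rY} f.

Lemma rec1_op2 F f g : rec2 F -> rec1 f -> rec1 g -> rec1 (fun x => F (f x) (g x)).
Proof. by move=> h hf hg; apply: recursive_op2 h hf hg. Qed.

Lemma rec1_id : rec1 id. Proof. by rec_tac. Qed.
Lemma rec1_const c : rec1 (fun=> c). Proof. by rec_tac. Qed.
Lemma rec1_S f : rec1 f -> rec1 (fun x => (f x).+1). Proof. by move=> h; apply: recursive_succ. Qed.

Lemma rec1_natrec f g n : rec1 f -> rec1 g -> rec1 n ->
  rec1 (fun x => nat_rect (fun=> nat) (f x) (fun k a => g (pr (pr x k) a)) (n x)).
Proof.
move=> hf hg hn.
have h3 : rec3 (fun k a x => g (pr (pr x k) a)).
  apply: recursive_op1 hg _; apply: recursive_op2 rec2_pr _ _; rec_tac.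
  by apply: recursive_op2 rec2_pr _ _; rec_tac.
exact: (recursive_op2 (rec2_prec hf h3) hn rec1_id).
Qed.

Lemma rec1_if c f g : rec1 c -> rec1 f -> rec1 g ->
  rec1 (fun x => if c x == 0%N then g x else f x).
Proof.
move=> hc hf hg; apply: (recursive_ext (f := fun xs : 1.-tuple nat =>
   let x := tnth xs 0 in addn (muln (g x) (subn 1 (c x))) (muln (f x) (subn 1 (subn 1 (c x)))))).
  move=> xs /=; case: (c _) => [|k] /=; first by rewrite muln1 muln0 addn0.
  by rewrite !subSS sub0n muln0 muln1.
apply: recursive_op2 rec2_addn _ _; apply: recursive_op2 rec2_muln _ _; rewrite //.
  by apply: recursive_op2 rec2_subn _ _; rec_tac.
apply: recursive_op2 rec2_subn _ _; rec_tac.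
by apply: recursive_op2 rec2_subn _ _; rec_tac.
Qed.

Section Computable.
Variables (X : Type) (rX : Rep X).

Lemma comp_id : comp (fun x : X => x).
Proof. by exists id => //; apply: rec1_id. Qed.

Lemma comp_const Y (rY : Rep Y) (y : Y) : comp (fun _ : X => y).
Proof. by have [c hc] := dec_surj y; exists (fun=> c); [apply: rec1_const|]. Qed.

Lemma comp_app Y (rY : Rep Y) Z (rZ : Rep Z) (f : Y -> Z) (g : X -> Y) :
  comp f -> comp g -> comp (fun x => f (g x)).
Proof.
move=> [f' hf ef] [g' hg eg]; exists (fun x => f' (g' x)); first exact: rec1_comp.
by move=> z; rewrite eg ef.
Qed.

Lemma comp_pair Y (rY : Rep Y) Z (rZ : Rep Z) (f : X -> Y) (g : X -> Z) :
  comp f -> comp g -> comp (fun x => (f x, g x)).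
Proof.
move=> [f' hf ef] [g' hg eg]; exists (fun x => pr (f' x) (g' x)); first exact: rec1_op2 rec2_pr hf hg.
by move=> z; rewrite ef eg /= pfst_pr psnd_pr.
Qed.

Lemma comp_fst Y (rY : Rep Y) Z (rZ : Rep Z) (f : X -> Y * Z) : comp f -> comp (fun x => (f x).1).
Proof.
move=> [f' hf ef]; exists (fun x => pfst (f' x)); first exact: rec1_comp rec1_pfst hf.
by move=> z; rewrite ef.
Qed.

Lemma comp_snd Y (rY : Rep Y) Z (rZ : Rep Z) (f : X -> Y * Z) : comp f -> comp (fun x => (f x).2).
Proof.
move=> [f' hf ef]; exists (fun x => psnd (f' x)); first exact: rec1_comp rec1_psnd hf.
by move=> z; rewrite ef.
Qed.

Lemma comp_op2 A (rA : Rep A) B (rB : Rep B) C (rC : Rep C) (F : A -> B -> C) (f : X -> A) (g : X -> B) :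
  comp (fun p : A * B => F p.1 p.2) -> comp f -> comp g -> comp (fun x => F (f x) (g x)).
Proof. by move=> hF hf hg; apply: (comp_app hF (comp_pair hf hg)). Qed.

Lemma comp_nat2 (F : nat -> nat -> nat) f g : rec2 F -> comp f -> comp g -> comp (fun x : X => F (f x) (g x)).
Proof.
move=> hF [f' hf ef] [g' hg eg]; exists (fun x => F (f' x) (g' x)); first exact: rec1_op2.
by move=> z; rewrite ef eg.
Qed.

Lemma comp_nat1 (F : nat -> nat) f : rec1 F -> comp f -> comp (fun x : X => F (f x)).
Proof.
move=> hF [f' hf ef]; exists (fun x => F (f' x)); first exact: rec1_comp.
by move=> z; rewrite ef.
Qed.

Lemma comp_if Y (rY : Rep Y) (c : X -> bool) (f g : X -> Y) : comp c -> comp f -> comp g ->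
  comp (fun x => if c x then f x else g x).
Proof.
move=> [c' hc ec] [f' hf ef] [g' hg eg].
exists (fun x => if c' x == 0%N then g' x else f' x); first exact: rec1_if.
by move=> z; rewrite ec ef eg /=; case: eqP.
Qed.

Lemma comp_natrec Y (rY : Rep Y) (b : X -> Y) (F : X -> nat -> Y -> Y) n :
  comp b -> comp (fun q : X * nat * Y => F q.1.1 q.1.2 q.2) -> comp n ->
  comp (fun x => nat_rect (fun=> Y) (b x) (F x) (n x)).
Proof.
move=> [b' hb eb] [F' hF eF] [n' hn en].
exists (fun x => nat_rect (fun=> nat) (b' x) (fun k a => F' (pr (pr x k) a)) (n' x)).
  exact: rec1_natrec.
move=> z; rewrite en /=; elim: (n' z) => [|k IH] /=; first exact: eb.
by rewrite IH; have := eF (pr (pr z k) (nat_rect (fun=> nat) (b' z) (fun k a => F' (pr (pr z k) a)) k));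
   rewrite /= !pfst_pr !psnd_pr.
Qed.

(** The state consists of the remaining list and the accumulator. The code of a list is at least its
    length, so it serves as the number of iterations; those in excess leave the state unchanged. *)
Lemma comp_foldl Y (rY : Rep Y) A (rA : Rep A) (s : X -> seq A) (b : X -> Y) (F : X -> Y -> A -> Y) :
  comp s -> comp b -> comp (fun q : X * Y * A => F q.1.1 q.1.2 q.2) ->
  comp (fun x => foldl (F x) (b x) (s x)).
Proof.
move=> [s' hs es] [b' hb eb] [F' hF eF].
pose step x st := if pfst st == 0%N then st else
  pr (ltail (pfst st)) (F' (pr (pr x (psnd st)) (lhead (pfst st)))).
pose it x := nat_rect (fun=> nat) (pr (s' x) (b' x)) (fun k st => step x st) (s' x).
exists (fun x => psnd (it x)).
  apply: (rec1_comp rec1_psnd).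
  apply: (recursive_ext (f := fun xs : 1.-tuple nat => let x := tnth xs 0 in nat_rect (fun=> nat) (pr (s' x) (b' x))
    (fun k a => (fun y => step (pfst (pfst y)) (psnd y)) (pr (pr x k) a)) (s' x))).
    move=> xs /=; rewrite /it; move: {2 4}(s' _) => N; elim: N => //= N ->.
    by rewrite !pfst_pr psnd_pr.
  apply: (@rec1_natrec (fun x => pr (s' x) (b' x)) (fun y => step (pfst (pfst y)) (psnd y)) s') => //.
    exact: rec1_op2 rec2_pr hs hb.
  have r1 : rec1 (fun y => pfst (psnd y)) by apply: rec1_comp rec1_pfst rec1_psnd.
  apply: rec1_if; [exact: r1| |exact: rec1_psnd].
  apply: (rec1_op2 rec2_pr); first exact: rec1_comp rec1_ltail r1.
  apply: (rec1_comp hF); apply: (rec1_op2 rec2_pr); last exact: rec1_comp rec1_lhead r1.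
  apply: (rec1_op2 rec2_pr); first exact: rec1_comp rec1_pfst rec1_pfst.
  exact: rec1_comp rec1_psnd rec1_psnd.
move=> z; rewrite es eb /it.
have H N : forall l a, (size (CodeSeq.decode l) <= N)%N ->
    foldl (F (dec z)) (dec a) (dec l) = dec (psnd (iter N (step z) (pr l a))).
  elim: N => [|N IH] l a.
    by rewrite leqn0 size_eq0 /= psnd_pr => /eqP->.
  rewrite iterSr; case: l => [|l] sl.
    have -> : step z (pr 0 a) = pr 0 a by rewrite /step pfst_pr.
    by rewrite -(IH 0%N a).
  have lE := lconsP (ltn0Sn l); set h := lhead _ in lE *; set t := ltail _ in lE *.
  have dE : CodeSeq.decode l.+1 = h :: CodeSeq.decode t.
    by rewrite lE -{1}(CodeSeq.decodeK t) -[lcons _ _]/(CodeSeq.code (h :: _)) CodeSeq.codeK.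
  have -> : step z (pr l.+1 a) = pr t (F' (pr (pr z a) h)) by rewrite /step pfst_pr psnd_pr.
  rewrite -(IH t); last by move: sl; rewrite dE.
  rewrite -[dec l.+1]/([seq dec i | i <- CodeSeq.decode l.+1]) dE /=; congr foldl.
  by have := eF (pr (pr z a) h); rewrite /= !pfst_pr !psnd_pr.
rewrite (H (s' z)); last first.
  rewrite -{2}(CodeSeq.decodeK (s' z)); elim: (CodeSeq.decode _) => //= h t IH.
  apply: leq_ltn_trans IH _; apply: (@leq_trans (CodeSeq.code t).*2.+1).
    by rewrite ltnS -addnn leq_addr.
  by rewrite leq_pmull ?expn_gt0.
congr (dec (psnd _)); by elim: {1 4}(s' z) => //= N ->.
Qed.

End Computable.

Lemma comp_foldr X (rX : Rep X) Y (rY : Rep Y) A (rA : Rep A) (s : X -> seq A) (b : X -> Y) (F : X -> A -> Y -> Y) :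
  comp s -> comp b -> comp (fun q : X * Y * A => F q.1.1 q.2 q.1.2) ->
  comp (fun x => foldr (F x) (b x) (s x)).
Proof.
move=> hs hb hF.
have hrev : comp (fun x => rev (s x)).
  have [s' hs' es] := hs.
  have cc : comp (fun q : X * seq A * A => q.2 :: q.1.2).
    exists (fun z => lcons (psnd z) (psnd (pfst z))).
      by apply: (rec1_op2 rec2_lcons rec1_psnd); apply: rec1_comp rec1_psnd rec1_pfst.
    move=> z; rewrite /= -{2}(CodeSeq.decodeK (psnd (pfst z))).
    by rewrite -[lcons _ _]/(CodeSeq.code (_ :: _)) CodeSeq.codeK.
  have [g hg eg] := comp_foldl (F := fun _ acc a => a :: acc) hs (comp_const rX (rep_seq rA) [::]) cc.
  exists g => // z; rewrite -eg /rev; elim: (s _) [::] => [|a l IH] acc //=.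
have [g hg eg] := comp_foldl (F := fun x y a => F x a y) hrev hb hF.
by exists g => // z; rewrite -eg -foldl_rev.
Qed.

Section ComputableOps.
Variables (X : Type) (rX : Rep X).
Implicit Types (m n : X -> nat) (b c : X -> bool) (u v : X -> rat).

Lemma comp_addn m n : comp m -> comp n -> comp (fun x => (m x + n x)%N).
Proof. exact: comp_nat2 rec2_addn. Qed.
Lemma comp_subn m n : comp m -> comp n -> comp (fun x => (m x - n x)%N).
Proof. exact: comp_nat2 rec2_subn. Qed.
Lemma comp_muln m n : comp m -> comp n -> comp (fun x => (m x * n x)%N).
Proof. exact: comp_nat2 rec2_muln. Qed.
Lemma comp_expn m n : comp m -> comp n -> comp (fun x => (m x ^ n x)%N).
Proof. exact: comp_nat2 rec2_expn. Qed.
Lemma comp_S m : comp m -> comp (fun x => (m x).+1).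
Proof. by move=> [g hg e]; exists (fun z => (g z).+1); [exact: rec1_S | move=> z; rewrite e]. Qed.
Lemma comp_pred m : comp m -> comp (fun x => (m x).-1).
Proof. exact: comp_nat1 rec1_pred. Qed.

Lemma comp_pos m : comp m -> comp (fun x => m x != 0%N).
Proof. by move=> [g hg e]; exists g => // z; rewrite e. Qed.

Lemma comp_leq m n : comp m -> comp n -> comp (fun x => (m x <= n x)%N).
Proof.
move=> hm hn; have [g hg e] := comp_pos (comp_subn (comp_const rX rep_nat 1%N) (comp_subn hm hn)).
by exists g => // z; rewrite -e -subn_eq0; case: (_ - _)%N.
Qed.

Lemma comp_negb b : comp b -> comp (fun x => ~~ b x).
Proof. by move=> hb; apply: comp_if hb (comp_const _ _ false) (comp_const _ _ true). Qed.
Lemma comp_andb b c : comp b -> comp c -> comp (fun x => b x && c x).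
Proof. by move=> hb hc; apply: comp_if hb hc (comp_const _ _ false). Qed.
Lemma comp_orb b c : comp b -> comp c -> comp (fun x => b x || c x).
Proof. by move=> hb hc; apply: comp_if hb (comp_const _ _ true) hc. Qed.
Lemma comp_implyb b c : comp b -> comp c -> comp (fun x => b x ==> c x).
Proof. by move=> hb hc; apply: comp_if hb hc (comp_const _ _ true). Qed.

Lemma comp_eqn m n : comp m -> comp n -> comp (fun x => m x == n x).
Proof.
move=> hm hn; have [g hg e] := comp_andb (comp_leq hm hn) (comp_leq hn hm).
by exists g => // z; rewrite -e eqn_leq.
Qed.

Section Sequences.
Variables (A : Type) (rA : Rep A).
Implicit Types s t : X -> seq A.

Lemma comp_cons (a : X -> A) s : comp a -> comp s -> comp (fun x => a x :: s x).
Proof.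
move=> [a' ha ea] [s' hs es]; exists (fun z => lcons (a' z) (s' z)); first exact: rec1_op2 rec2_lcons ha hs.
move=> z; rewrite ea es /= -{2}(CodeSeq.decodeK (s' z)).
by rewrite -[lcons _ _]/(CodeSeq.code (_ :: _)) CodeSeq.codeK.
Qed.

End Sequences.
End ComputableOps.

Lemma comp_cat X (rX : Rep X) A (rA : Rep A) (s t : X -> seq A) : comp s -> comp t -> comp (fun x => s x ++ t x).
Proof.
move=> hs ht; have [g hg e] := comp_foldr (F := fun _ a acc => a :: acc) hs ht
  (comp_cons (comp_snd (comp_id _)) (comp_snd (comp_fst (comp_id _)))).
by exists g => // z; rewrite -e; elim: (s _) => //= a l ->.
Qed.
Ltac ct0 := repeat first [ exact: comp_id | exact: comp_const
  | eapply comp_fst | eapply comp_snd | eapply comp_pair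
  | eapply comp_if | eapply comp_S | eapply comp_addn | eapply comp_eqn | eapply comp_cons ].

Section ComputableSeq.
Variables (X : Type) (rX : Rep X) (A : Type) (rA : Rep A).
Implicit Types s t : X -> seq A.

Lemma comp_ctx2 B (rB : Rep B) C (rC : Rep C) (F : X -> B -> C) Y (rY : Rep Y) :
  comp (fun p : X * B => F p.1 p.2) -> comp (fun q : X * Y * B => F q.1.1 q.2).
Proof.
move=> hF; apply: (comp_app (g := fun q : X * Y * B => (q.1.1, q.2)) hF).
exact: comp_pair (comp_fst (comp_fst (comp_id _))) (comp_snd (comp_id _)).
Qed.

Lemma comp_map B (rB : Rep B) (F : X -> A -> B) s :
  comp (fun p : X * A => F p.1 p.2) -> comp s -> comp (fun x => [seq F x a | a <- s x]).
Proof.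
move=> hF hs; have [g hg e] := comp_foldr (F := fun x a acc => F x a :: acc) hs
  (comp_const _ _ [::]) (comp_cons (comp_ctx2 _ hF) (comp_snd (comp_fst (comp_id _)))).
by exists g => // z; rewrite -e; elim: (s _) => //= a l ->.
Qed.

Lemma comp_all (F : X -> A -> bool) s :
  comp (fun p : X * A => F p.1 p.2) -> comp s -> comp (fun x => all (F x) (s x)).
Proof.
move=> hF hs; have [g hg e] := comp_foldr (F := fun x a acc => F x a && acc) hs
  (comp_const _ _ true) (comp_andb (comp_ctx2 _ hF) (comp_snd (comp_fst (comp_id _)))).
by exists g => // z; rewrite -e; elim: (s _) => //= a l ->.
Qed.

Lemma comp_has (F : X -> A -> bool) s :
  comp (fun p : X * A => F p.1 p.2) -> comp s -> comp (fun x => has (F x) (s x)).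
Proof.
move=> hF hs; have [g hg e] := comp_foldr (F := fun x a acc => F x a || acc) hs
  (comp_const _ _ false) (comp_orb (comp_ctx2 _ hF) (comp_snd (comp_fst (comp_id _)))).
by exists g => // z; rewrite -e; elim: (s _) => //= a l ->.
Qed.

Lemma comp_size s : comp s -> comp (fun x => size (s x)).
Proof.
move=> hs; have [g hg e] := comp_foldr (F := fun x a acc => acc.+1) hs
  (comp_const _ _ 0%N) (comp_S (comp_snd (comp_fst (comp_id _)))).
by exists g => // z; rewrite -e; elim: (s _) => //= a l ->.
Qed.

Lemma comp_flatten (s : X -> seq (seq A)) : comp s -> comp (fun x => flatten (s x)).
Proof.
move=> hs; have [g hg e] := comp_foldr (F := fun x a acc => a ++ acc) hs
  (comp_const _ _ [::]) (comp_cat (comp_snd (comp_id _)) (comp_snd (comp_fst (comp_id _)))).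
by exists g => // z; rewrite -e; elim: (s _) => //= a l ->.
Qed.

(** A left fold that counts positions and keeps the element found at the wanted one, starting from
    the default. *)
Lemma comp_nth a0 s n : comp s -> comp n -> comp (fun x => nth a0 (s x) (n x)).
Proof.
move=> hs hn.
have hF : comp (fun q : X * (nat * A) * A =>
    if q.1.2.1 == n q.1.1 then (q.1.2.1.+1, q.2) else (q.1.2.1.+1, q.1.2.2)).
  by ct0; apply: (comp_app hn); ct0.
have [g hg e] := comp_snd (comp_foldl (F := fun x acc a => if acc.1 == n x then (acc.1.+1, a) else (acc.1.+1, acc.2))
  hs (comp_const _ (rep_prod rep_nat rA) (0%N, a0)) hF).
exists g => // z; rewrite -e.
have H (l : seq A) (k : nat) (a : A) (N : nat) :
    (foldl (fun acc b => if acc.1 == N then (acc.1.+1, b) else (acc.1.+1, acc.2)) (k, a) l).2 =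
    (if (k <= N)%N then nth a l (N - k)%N else a).
  elim: l k a => [|b l IH] k a /=; first by case: ifP => //; rewrite nth_nil.
  case: eqP => [->|/eqP kN]; rewrite IH ?leqnn ?subnn /=; first by rewrite ltnn.
  rewrite ltn_neqAle kN /=; case: ifP => // kN'.
  by rewrite -[(N - k)%N]prednK ?subnS // subn_gt0 ltn_neqAle kN.
by rewrite H leq0n subn0.
Qed.

Lemma comp_iota m n : comp m -> comp n -> comp (fun x : X => iota (m x) (n x)).
Proof.
move=> hm hn.
have hF : comp (fun q : X * nat * seq nat => q.2 ++ [:: (m q.1.1 + q.1.2)%N]).
  by apply: comp_cat; ct0; apply: (comp_app hm); ct0.
have [g hg e] := comp_natrec (F := fun x k acc => acc ++ [:: (m x + k)%N]) (comp_const _ (rep_seq rep_nat) [::]) hF hn.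
exists g => // z; rewrite -e; elim: (n _) => // k IH.
by rewrite -[in LHS]addn1 iotaD IH.
Qed.

End ComputableSeq.

Section ComputableRat.
Variables (X : Type) (rX : Rep X).
Implicit Types (u v : X -> rat).

Lemma comp_fracval (t : X -> nat * nat * nat) : comp t -> comp (fun x => fracval (t x)).
Proof. by move=> [g hg e]; exists g => // z; rewrite e. Qed.

Lemma rat_op1 (f : rat -> rat) (F : nat * nat * nat -> nat * nat * nat) u :
  comp F -> (forall t, f (fracval t) = fracval (F t)) -> comp u -> comp (fun x => f (u x)).
Proof.
move=> [F' hF eF] h [g hg e]; exists (fun z => F' (g z)); first exact: rec1_comp.
by move=> z; rewrite e /= h (eF (g z)).
Qed.

Lemma rat_op2 (Y : Type) (rY : Rep Y) (f : rat -> rat -> Y) (F : nat * nat * nat -> nat * nat * nat -> Y) u v :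
  comp (fun p => F p.1 p.2) -> (forall t t', f (fracval t) (fracval t') = F t t') ->
  comp u -> comp v -> comp (fun x => f (u x) (v x)).
Proof.
move=> [F' hF eF] h [g hg e] [g' hg' e'].
exists (fun z => F' (pr (g z) (g' z))); first exact: rec1_comp hF (rec1_op2 rec2_pr hg hg').
move=> z; rewrite e e' h; have := eF (pr (g z) (g' z)); rewrite /= !pfst_pr !psnd_pr => <- //.
Qed.

End ComputableRat.

(** A hook that is redefined whenever further operations are known to be computable; [ct] selects
    the closure lemma by the head symbol of the function body. *)
Ltac ct_more f := fail.
Ltac ct_step := lazymatch goal with |- @comp _ _ _ _ ?f => lazymatch f with
  | (fun _ => ?c) => exact: comp_const
  | (fun x => x) => exact: comp_id
  | @fst _ _ => exact: (comp_fst (comp_id _))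
  | @snd _ _ => exact: (comp_snd (comp_id _))
  | (fun _ => fst _) => eapply comp_fst
  | (fun _ => snd _) => eapply comp_snd
  | (fun _ => pair _ _) => eapply comp_pair
  | (fun _ => andb _ _) => eapply comp_andb
  | (fun _ => orb _ _) => eapply comp_orb
  | (fun _ => negb _) => eapply comp_negb
  | (fun _ => implb _ _) => eapply comp_implyb
  | (fun _ => if _ then _ else _) => eapply comp_if
  | (fun _ => S _) => eapply comp_S
  | (fun _ => predn _) => eapply comp_pred
  | (fun _ => addn _ _) => eapply comp_addn
  | (fun _ => subn _ _) => eapply comp_subn
  | (fun _ => muln _ _) => eapply comp_muln
  | (fun _ => expn _ _) => eapply comp_expn
  | (fun _ => leq _ _) => eapply comp_leq
  | (fun _ => eq_op _ _) => first [eapply comp_eqn | ct_more f]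
  | (fun _ => cons _ _) => eapply comp_cons
  | (fun _ => cat _ _) => eapply comp_cat
  | (fun _ => nth _ _ _) => eapply comp_nth
  | (fun _ => iota _ _) => eapply comp_iota
  | @size _ => exact: (comp_size (comp_id _))
  | (fun _ => size _) => eapply comp_size
  | (fun _ => map _ _) => eapply comp_map
  | (fun _ => all _ _) => eapply comp_all
  | (fun _ => has _ _) => eapply comp_has
  | (fun _ => flatten _) => eapply comp_flatten
  | (fun _ => foldr _ _ _) => eapply comp_foldr
  | (fun _ => nat_rect _ _ _ _) => eapply comp_natrec
  | (fun _ => fracval _) => eapply comp_fracval
  | _ => ct_more f
  end end.
Ltac ct := cbv beta; repeat (ct_step; cbv beta).

Section ComputableRatOps.
Variables (X : Type) (rX : Rep X).
Implicit Types (u v : X -> rat).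

Let denR (k : nat) : (k.+1%:R : rat) != 0. Proof. by rewrite pnatr_eq0. Qed.

Lemma comp_addr u v : comp u -> comp v -> comp (fun x => u x + v x).
Proof.
apply: (rat_op2 (F := fun t t' => fracval (t.1.1 * t'.2.+1 + t'.1.1 * t.2.+1, t.1.2 * t'.2.+1 + t'.1.2 * t.2.+1,
  t.2 * t'.2.+1 + t'.2)%N)); first by ct.
move=> [[a b] c] [[a' b'] c']; rewrite /fracval /=.
have -> : (c * c'.+1 + c').+1 = (c.+1 * c'.+1)%N by rewrite mulSn addnC.
rewrite !natrD !natrM.
by have := denR c; have := denR c'; move: (c.+1%:R) (c'.+1%:R) => x y x0 y0; field; rewrite x0 y0.
Qed.

Lemma comp_mulr u v : comp u -> comp v -> comp (fun x => u x * v x).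
Proof.
apply: (rat_op2 (F := fun t t' => fracval (t.1.1 * t'.1.1 + t.1.2 * t'.1.2, t.1.1 * t'.1.2 + t.1.2 * t'.1.1,
  t.2 * t'.2.+1 + t'.2)%N)); first by ct.
move=> [[a b] c] [[a' b'] c']; rewrite /fracval /=.
have -> : (c * c'.+1 + c').+1 = (c.+1 * c'.+1)%N by rewrite mulSn addnC.
rewrite !natrD !natrM.
by have := denR c; have := denR c'; move: (c.+1%:R) (c'.+1%:R) => x y x0 y0; field; rewrite x0 y0.
Qed.

Lemma comp_oppr u : comp u -> comp (fun x => - u x).
Proof.
apply: (rat_op1 (F := fun t => (t.1.2, t.1.1, t.2))); first by ct.
by move=> [[a b] c]; rewrite /fracval /= -mulNr opprB.
Qed.

Lemma comp_eqr u v : comp u -> comp v -> comp (fun x => u x == v x).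
Proof.
apply: (rat_op2 (f := fun a b => a == b) (F := fun t t' => t.1.1 * t'.2.+1 + t'.1.2 * t.2.+1 == t'.1.1 * t.2.+1 + t.1.2 * t'.2.+1)%N);
  first by ct.
move=> [[a b] c] [[a' b'] c']; rewrite /fracval /= eqr_div ?denR // !mulrBl.
by rewrite subr_eq addrAC eq_sym subr_eq eq_sym -!natrM -!natrD eqr_nat.
Qed.

Lemma comp_natr (m : X -> nat) : comp m -> comp (fun x => (m x)%:R : rat).
Proof.
move=> hm; have [|g hg e] := @comp_fracval _ _ (fun x => (m x, 0%N, 0%N)); first by ct.
by exists g => // z; rewrite -e /fracval subr0 divr1.
Qed.

(** Inverses of positive integers are the only divisions that the programs perform. *)
Definition invS (k : nat) : rat := k.+1%:R^-1.

Lemma comp_invS (m : X -> nat) : comp m -> comp (fun x => invS (m x)).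
Proof.
move=> hm; have [|g hg e] := @comp_fracval _ _ (fun x => (1%N, 0%N, m x)); first by ct.
by exists g => // z; rewrite -e /fracval subr0 div1r.
Qed.

End ComputableRatOps.

Lemma comp_op3 A (rA : Rep A) B (rB : Rep B) C (rC : Rep C) D (rD : Rep D) (F : A -> B -> C -> D)
    X (rX : Rep X) (f : X -> A) (g : X -> B) (h : X -> C) :
  comp (fun p : A * B * C => F p.1.1 p.1.2 p.2) -> comp f -> comp g -> comp h ->
  comp (fun x => F (f x) (g x) (h x)).
Proof. by move=> hF hf hg hh; apply: (comp_app hF (comp_pair (comp_pair hf hg) hh)). Qed.

(** * Programs on lists *)

(* Missing entries of a list matrix count as 0, and [d] stands for dimension
   d.+1; in particular [[::]] is the zero matrix. *)
Definition mat := seq (seq rat).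
Definition ent (A : mat) (i j : nat) : rat := nth 0 (nth [::] A i) j.
Definition mkL (d : nat) (F : nat -> nat -> rat) : mat :=
  [seq [seq F i j | j <- iota 0 d.+1] | i <- iota 0 d.+1].
Definition sumL (d : nat) (F : nat -> rat) : rat := foldr (fun k acc => F k + acc) 0 (iota 0 d.+1).
Definition addL d A B := mkL d (fun i j => ent A i j + ent B i j).
Definition scaleL d (a : rat) A := mkL d (fun i j => a * ent A i j).
Definition oneL d := mkL d (fun i j => if i == j then 1 else 0).
Definition mulL d A B := mkL d (fun i j => sumL d (fun k => ent A i k * ent B k j)).
Definition trL d A := sumL d (fun i => ent A i i).
Definition zeroL d A := all (fun i => all (fun j => ent A i j == 0) (iota 0 d.+1)) (iota 0 d.+1).
Definition eqL d A B := zeroL d (addL d A (scaleL d (-1) B)).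
Definition prodL d I (F : I -> mat) (r : seq I) : mat := foldr (fun i acc => mulL d (F i) acc) (oneL d) r.
Definition sumML d I (F : I -> mat) (r : seq I) : mat := foldr (fun i acc => addL d (F i) acc) [::] r.
Definition powL d A k := prodL d (fun=> A) (iota 0 k).
(** The term A^k / k! is computed as the product of the A / (i + 1) for i < k. *)
Definition expL d D A := sumML d (fun k => prodL d (fun i => scaleL d (invS i) A) (iota 0 k)) (iota 0 D).
Definition hornerL d (s : seq rat) A := foldr (fun c acc => addL d (mulL d acc A) (scaleL d c (oneL d))) [::] s.
Definition derivL (s : seq rat) := [seq (k.+1%:R : rat) * nth 0 s k.+1 | k <- iota 0 (size s)].
Definition monL d n (H : seq mat) (e : seq nat) := prodL d (fun i => powL d (nth [::] H i) (nth 0 e i)) (iota 0 n).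
Definition evalL d n H (p : seq (seq nat * rat)) := sumML d (fun t => scaleL d t.2 (monL d n H t.1)) p.

Section Comp.
Variables (X : Type) (rX : Rep X).
Implicit Types (d n k : X -> nat) (A B : X -> mat).

Lemma comp_ent A n k : comp A -> comp n -> comp k -> comp (fun x => ent (A x) (n x) (k x)).
Proof. by apply: comp_op3; rewrite /ent; ct. Qed.

Lemma comp_mkL d (F : X -> nat -> nat -> rat) :
  comp d -> comp (fun q : X * nat * nat => F q.1.1 q.1.2 q.2) -> comp (fun x => mkL (d x) (F x)).
Proof. 
move=> hd hF; rewrite /mkL; ct => //.
by apply: (comp_app hd); ct.
Qed.

Lemma comp_sumL d (F : X -> nat -> rat) :
  comp d -> comp (fun q : X * nat => F q.1 q.2) -> comp (fun x => sumL (d x) (F x)).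
Proof.
move=> hd hF; rewrite /sumL; ct => //.
apply: comp_addr; ct; apply: (comp_app (g := fun q : X * rat * nat => (q.1.1, q.2)) hF); ct.
Qed.
End Comp.

Ltac ct_rat f := lazymatch f with
  | (fun _ => ent _ _ _) => eapply comp_ent
  | (fun _ => mkL _ _) => eapply comp_mkL
  | (fun _ => sumL _ _) => eapply comp_sumL
  | (fun _ => GRing.add _ _) => eapply comp_addr
  | (fun _ => GRing.mul _ _) => eapply comp_mulr
  | (fun _ => GRing.opp _) => eapply comp_oppr
  | (fun _ => eq_op _ _) => eapply comp_eqr
  | (fun _ => GRing.natmul _ _) => eapply comp_natr
  | (fun _ => invS _) => eapply comp_invS
  end.
Ltac ct_more f ::= ct_rat f.

Section Comp2.
Variables (X : Type) (rX : Rep X).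
Implicit Types (d n k : X -> nat) (A B : X -> mat).

Lemma comp_addL d A B : comp d -> comp A -> comp B -> comp (fun x => addL (d x) (A x) (B x)).
Proof. by apply: comp_op3; rewrite /addL; ct. Qed.
Lemma comp_scaleL d (a : X -> rat) B : comp d -> comp a -> comp B -> comp (fun x => scaleL (d x) (a x) (B x)).
Proof. by apply: comp_op3; rewrite /scaleL; ct. Qed.
Lemma comp_oneL d : comp d -> comp (fun x => oneL (d x)).
Proof. by apply: comp_app; rewrite /oneL; ct. Qed.
Lemma comp_mulL d A B : comp d -> comp A -> comp B -> comp (fun x => mulL (d x) (A x) (B x)).
Proof. by apply: comp_op3; rewrite /mulL; ct. Qed.
Lemma comp_trL d A : comp d -> comp A -> comp (fun x => trL (d x) (A x)).
Proof. by apply: comp_op2; rewrite /trL; ct. Qed.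
Lemma comp_zeroL d A : comp d -> comp A -> comp (fun x => zeroL (d x) (A x)).
Proof. by apply: comp_op2; rewrite /zeroL; ct. Qed.
End Comp2.

Section CompBig.
Variables (X : Type) (rX : Rep X).
Implicit Types (d : X -> nat).

Lemma comp_prodL d I (rI : Rep I) (F : X -> I -> mat) (r : X -> seq I) :
  comp d -> comp (fun q : X * I => F q.1 q.2) -> comp r -> comp (fun x => prodL (d x) (F x) (r x)).
Proof.
move=> hd hF hr; rewrite /prodL; ct => //; first exact: comp_oneL.
apply: comp_mulL; ct; first by apply: (comp_app hd); ct.
exact: (comp_ctx2 _ hF).
Qed.

Lemma comp_sumML d I (rI : Rep I) (F : X -> I -> mat) (r : X -> seq I) :
  comp d -> comp (fun q : X * I => F q.1 q.2) -> comp r -> comp (fun x => sumML (d x) (F x) (r x)).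
Proof.
move=> hd hF hr; rewrite /sumML; ct => //.
apply: comp_addL; ct; first by apply: (comp_app hd); ct.
exact: (comp_ctx2 _ hF).
Qed.
End CompBig.

Ltac ct_mat f := lazymatch f with
  | (fun _ => addL _ _ _) => eapply comp_addL
  | (fun _ => scaleL _ _ _) => eapply comp_scaleL
  | (fun _ => oneL _) => eapply comp_oneL
  | (fun _ => mulL _ _ _) => eapply comp_mulL
  | (fun _ => trL _ _) => eapply comp_trL
  | (fun _ => zeroL _ _) => eapply comp_zeroL
  | (fun _ => prodL _ _ _) => eapply comp_prodL
  | (fun _ => sumML _ _ _) => eapply comp_sumML
  | _ => ct_rat f
  end.
Ltac ct_more f ::= ct_mat f.

Section Comp3.
Variables (X : Type) (rX : Rep X).
Implicit Types (d n k : X -> nat) (A B : X -> mat).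

Lemma comp_eqL d A B : comp d -> comp A -> comp B -> comp (fun x => eqL (d x) (A x) (B x)).
Proof. by apply: comp_op3; rewrite /eqL; ct. Qed.
Lemma comp_powL d A k : comp d -> comp A -> comp k -> comp (fun x => powL (d x) (A x) (k x)).
Proof. by apply: comp_op3; rewrite /powL; ct. Qed.
Lemma comp_expL d k A : comp d -> comp k -> comp A -> comp (fun x => expL (d x) (k x) (A x)).
Proof. by apply: comp_op3; rewrite /expL; ct. Qed.
Lemma comp_hornerL d (s : X -> seq rat) A :
  comp d -> comp s -> comp A -> comp (fun x => hornerL (d x) (s x) (A x)).
Proof. by apply: comp_op3; rewrite /hornerL; ct. Qed.
Lemma comp_derivL (s : X -> seq rat) : comp s -> comp (fun x => derivL (s x)).
Proof. by apply: comp_app; rewrite /derivL; ct. Qed.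
Lemma comp_monL d n (H : X -> seq mat) (e : X -> seq nat) :
  comp d -> comp n -> comp H -> comp e -> comp (fun x => monL (d x) (n x) (H x) (e x)).
Proof.
move=> hd hn hH he; apply: (comp_app (f := fun p : nat * nat * (seq mat * seq nat) => monL p.1.1 p.1.2 p.2.1 p.2.2)
  _ (comp_pair (comp_pair hd hn) (comp_pair hH he))).
rewrite /monL /powL; ct.
Qed.
Lemma comp_evalL d n (H : X -> seq mat) (p : X -> seq (seq nat * rat)) :
  comp d -> comp n -> comp H -> comp p -> comp (fun x => evalL (d x) (n x) (H x) (p x)).
Proof.
move=> hd hn hH he; apply: (comp_app (f := fun p : nat * nat * (seq mat * seq (seq nat * rat)) =>
  evalL p.1.1 p.1.2 p.2.1 p.2.2) _ (comp_pair (comp_pair hd hn) (comp_pair hH he))).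
rewrite /evalL /monL /powL; ct.
Qed.
End Comp3.

Definition toM d (A : mat) : 'M[rat]_d.+1 := \matrix_(i, j) ent A i j.
Definition ofM d (M : 'M[rat]_d.+1) : mat := mkL d (fun i j => M (inord i) (inord j)).
Definition mkE n (e : seq nat) : 'X_{1..n} := [multinom nth 0%N e i | i < n].
Definition polyL n (p : seq (seq nat * rat)) : {mpoly rat[n]} := \sum_(t <- p) t.2 *: 'X_[mkE n t.1].

Lemma all_iotaP n (P : nat -> bool) : reflect (forall i : 'I_n, P i) (all P (iota 0 n)).
Proof.
apply: (iffP allP) => h i; first by apply: h; rewrite mem_iota /=.
by rewrite mem_iota /= => id; apply: (h (Ordinal id)).
Qed.

Section MatrixPrograms.
Variable d : nat.
Implicit Types (A B : mat).

Lemma ent_mkL F (i j : 'I_d.+1) : ent (mkL d F) i j = F i j.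
Proof.
rewrite /ent /mkL (nth_map 0%N) ?size_iota // nth_iota // (nth_map 0%N) ?size_iota //.
by rewrite nth_iota.
Qed.

Lemma toM_mkL F : toM d (mkL d F) = \matrix_(i, j) F i j.
Proof. by apply/matrixP => i j; rewrite !mxE ent_mkL. Qed.

Lemma toM_ofM (M : 'M[rat]_d.+1) : toM d (ofM M) = M.
Proof. by apply/matrixP => i j; rewrite toM_mkL mxE !inord_val. Qed.

Lemma sumLE F : sumL d F = \sum_(i < d.+1) F i.
Proof. by rewrite /sumL -(big_mkord xpredT F) /index_iota subn0 unlock. Qed.

Lemma toM_nil : toM d [::] = 0.
Proof. by apply/matrixP => i j; rewrite !mxE /ent !nth_nil. Qed.

Lemma toM_add A B : toM d (addL d A B) = toM d A + toM d B.
Proof. by rewrite toM_mkL; apply/matrixP => i j; rewrite !mxE. Qed.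

Lemma toM_scale a A : toM d (scaleL d a A) = a *: toM d A.
Proof. by rewrite toM_mkL; apply/matrixP => i j; rewrite !mxE. Qed.

Lemma toM_one : toM d (oneL d) = 1.
Proof. by rewrite toM_mkL; apply/matrixP => i j; rewrite !mxE val_eqE; case: eqP. Qed.

Lemma toM_mul A B : toM d (mulL d A B) = toM d A * toM d B.
Proof.
rewrite toM_mkL; apply/matrixP => i j; rewrite !mxE sumLE.
by apply: eq_bigr => k _; rewrite !mxE.
Qed.

Lemma trLE A : trL d A = \tr (toM d A).
Proof. by rewrite /trL sumLE; apply: eq_bigr => i _; rewrite mxE. Qed.

Lemma zeroLP A : reflect (toM d A = 0) (zeroL d A).
Proof.
apply: (iffP (all_iotaP _ _)) => [h|/matrixP h i].
  by apply/matrixP => i j; move/all_iotaP: (h i) => /(_ j)/eqP; rewrite !mxE.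
by apply/all_iotaP => j; have := h i j; rewrite !mxE => ->.
Qed.

Lemma eqLP A B : reflect (toM d A = toM d B) (eqL d A B).
Proof.
apply: (iffP (zeroLP _)); rewrite toM_add toM_scale scaleN1r; first by move/subr0_eq.
by move=> ->; rewrite subrr.
Qed.

Lemma toM_prod I (F : I -> mat) r : toM d (prodL d F r) = \prod_(i <- r) toM d (F i).
Proof.
elim: r => [|i r IH]; first by rewrite big_nil toM_one.
by rewrite big_cons -IH -toM_mul.
Qed.

Lemma toM_sum I (F : I -> mat) r : toM d (sumML d F r) = \sum_(i <- r) toM d (F i).
Proof.
elim: r => [|i r IH]; first by rewrite big_nil toM_nil.
by rewrite big_cons -IH -toM_add.
Qed.

Lemma big_iota0 (V : Type) (idx : V) (op : V -> V -> V) n (F : nat -> V) :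
  \big[op/idx]_(i <- iota 0 n) F i = \big[op/idx]_(i < n) F i.
Proof. by rewrite -(big_mkord xpredT F) /index_iota subn0. Qed.

Lemma toM_pow A k : toM d (powL d A k) = toM d A ^+ k.
Proof. by rewrite toM_prod big_iota0 prodr_const card_ord. Qed.

Lemma toM_exp D A : toM d (expL d D A) = exp_trunc D (toM d A).
Proof.
rewrite toM_sum big_iota0; apply: eq_bigr => k _; rewrite toM_prod big_iota0.
elim: (k : nat) => [|m IH]; first by rewrite big_ord0 facV0 scale1r expr0.
rewrite big_ord_recr IH /= toM_scale -scalerAl -scalerAr -exprSr scalerA; congr (_ *: _).
by rewrite /facV /invS factS natrM invfM mulrC.
Qed.

Lemma toM_horner s A : toM d (hornerL d s A) = horner_mx (toM d A) (Poly s).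
Proof.
elim: s => [|c s IH]; first by rewrite toM_nil rmorph0.
rewrite /= toM_add toM_mul IH toM_scale toM_one cons_poly_def rmorphD rmorphM /= horner_mx_X horner_mx_C.
by rewrite -scalemx1.
Qed.

Lemma Poly_deriv (s : seq rat) : Poly (derivL s) = (Poly s)^`().
Proof.
apply/polyP => i; rewrite coef_deriv !coef_Poly /derivL.
case: (ltnP i (size s)) => si; last by rewrite !nth_default ?mul0rn ?size_map ?size_iota // (leq_trans si).
by rewrite (nth_map 0%N) ?size_iota // nth_iota // mulr_natl.
Qed.

Lemma toM_mon n H e : toM d (monL d n H e) = mmap1 (fun i => toM d (nth [::] H i)) (mkE n e).
Proof.
rewrite toM_prod big_iota0; apply: eq_bigr => i _.
by rewrite toM_pow mnmE.
Qed.

Lemma toM_eval n H p :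
  toM d (evalL d n H p) = mmap (@scalar_mx rat d.+1) (fun i => toM d (nth [::] H i)) (polyL n p).
Proof.
rewrite toM_sum raddf_sum; apply: eq_bigr => t _ /=.
by rewrite mmapZ mmapX toM_scale toM_mon /= -mulmxE mul_scalar_mx.
Qed.

End MatrixPrograms.

(** * Checking certificates of absence *)

Definition expsL (n m : nat) : seq (seq nat) :=
  nat_rect (fun=> seq (seq nat)) [:: [::]] (fun _ acc => flatten [seq [seq a :: e | e <- acc] | a <- iota 0 m.+1]) n.
Definition onesL n (R : nat) : seq nat := [seq R | _ <- iota 0 n].
Definition dilateL (e : seq nat) (j : nat) := [seq (a * j)%N | a <- e].
Definition smallM d B A := all (fun i => all (fun j => smallint B (ent A i j)) (iota 0 d.+1)) (iota 0 d.+1).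
Definition wsumL d n (T : seq mat) (e : seq nat) :=
  sumML d (fun i => scaleL d (nth 0%N e i)%:R (nth [::] T i)) (iota 0 n).
Definition tauL d n S S' R j e : rat :=
  trL d (mulL d (monL d n S (dilateL e j)) (monL d n S' (dilateL (onesL n R) j))) *
  trL d (mulL d (monL d n S' (dilateL e j)) (monL d n S (dilateL (onesL n R) j))).
Definition passesL d n S S' T c K R e :=
  smallM d (n * K) (scaleL d c%:R (addL d (wsumL d n T e) (scaleL d (-1) (wsumL d n T (onesL n R))))) &&
  all (fun j => smallint (tau_bound n d K j) ((((c ^ 2) ^ n) ^ j)%:R * tauL d n S S' R j e)) (iota 0 (2 * d.+1 ^ 2).+1).
Definition sphereL n R (e : seq nat) :=
  all (fun i => nth 0 e i <= 2 * R)%N (iota 0 n) &&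
  has (fun i => (nth 0 e i == 0) || (nth 0 e i == 2 * R))%N (iota 0 n).
Definition commL d A B := eqL d (mulL d A B) (mulL d B A).

Definition chk_neg n (P : seq (seq (seq nat * rat))) d D c K R (S S' T W : seq mat) (G : seq (seq rat)) :=
  [&& all (fun i => [&& eqL d (mulL d (nth [::] S i) (nth [::] S' i)) (oneL d),
        zeroL d (powL d (nth [::] T i) D),
        zeroL d (hornerL d (nth [::] G i) (nth [::] S i)),
        eqL d (mulL d (nth [::] W i) (hornerL d (derivL (nth [::] G i)) (nth [::] S i))) (oneL d),
        smallM d K (scaleL d c%:R (nth [::] S i)),
        smallM d K (scaleL d c%:R (nth [::] S' i)),
        smallM d K (scaleL d c%:R (nth [::] T i)) &
        all (fun j => [&& commL d (nth [::] S i) (nth [::] S j), commL d (nth [::] S i) (nth [::] T j) &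
                          commL d (nth [::] T i) (nth [::] T j)]) (iota 0 n)]) (iota 0 n),
      all (fun p => zeroL d (evalL d n [seq mulL d (nth [::] S i) (expL d D (nth [::] T i)) | i <- iota 0 n] p)) P,
      (0 < c)%N &
      all (fun e => sphereL n R e ==> ~~ passesL d n S S' T c K R e) (expsL n (2 * R))].

Lemma expsLP m (e : seq nat) : all (fun a => a <= m)%N e -> e \in expsL (size e) m.
Proof.
elim: e => // a e IH /andP[am em].
rewrite -[expsL _ _]/(flatten [seq [seq b :: e' | e' <- expsL (size e) m] | b <- iota 0 m.+1]); apply/flattenP.
exists [seq a :: e' | e' <- expsL (size e) m]; last by rewrite map_f ?IH.
by apply/mapP; exists a; rewrite // mem_iota.
Qed.

Lemma mkE_mnm n (w : 'X_{1..n}) : mkE n (w : seq nat) = w.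
Proof. by apply/mnmP => i; rewrite mnmE -tnth_nth. Qed.

Lemma mkE_ones n R : mkE n (onesL n R) = ones n R.
Proof. by apply/mnmP => i; rewrite !mnmE (nth_map 0%N) ?size_iota. Qed.

Lemma mkE_dilate n e j : mkE n (dilateL e j) = (mkE n e *+ j)%MM.
Proof.
apply/mnmP => i; rewrite mulmnE !mnmE /dilateL.
case: (ltnP i (size e)) => ie; first by rewrite (nth_map 0%N).
by rewrite !nth_default ?size_map.
Qed.

Lemma smallMP d B A : reflect (forall i j, smallint B (toM d A i j)) (smallM d B A).
Proof.
apply: (iffP (all_iotaP _ _)) => [h i j|h i]; first by move/all_iotaP: (h i) => /(_ j); rewrite mxE.
by apply/all_iotaP => j; have := h i j; rewrite mxE.
Qed.

Lemma toM_wsum d n T e : toM d (wsumL d n T e) = wsum (fun i => toM d (nth [::] T i)) (mkE n e).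
Proof. by rewrite toM_sum big_iota0; apply: eq_bigr => i _; rewrite toM_scale mnmE scaler_nat. Qed.

Lemma sphereP n R e : reflect (on_sphere R (mkE n e)) (sphereL n R e).
Proof.
apply: (iffP andP) => [[/all_iotaP le /hasP[i]]|[le [i ei]]].
  rewrite mem_iota => /= ilt h; split; first by move=> k; rewrite mnmE.
  by exists (Ordinal ilt); rewrite mnmE.
split; first by apply/all_iotaP => k; have := le k; rewrite mnmE.
by apply/hasP; exists (i : nat); [rewrite mem_iota /= | rewrite mnmE in ei].
Qed.

Lemma passesP d n S S' T c K R e :
  reflect (passes (fun i => toM d (nth [::] S i)) (fun i => toM d (nth [::] S' i))
             (fun i => toM d (nth [::] T i)) c K R (mkE n e))
          (passesL d n S S' T c K R e).
Proof.
have tE j : tauL d n S S' R j e = tau (fun i => toM d (nth [::] S i)) (fun i => toM d (nth [::] S' i)) R j (mkE n e).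
  by rewrite /tauL !trLE !toM_mul !toM_mon !mkE_dilate !mkE_ones.
apply: (iffP andP) => [[/smallMP nil /allP t]|[nil t]]; split.
- by move=> i j; have := nil i j; rewrite toM_scale toM_add toM_scale scaleN1r !toM_wsum mkE_ones.
- by move=> j jd; rewrite /tau_value -tE; apply: t; rewrite mem_iota.
- by apply/smallMP => i j; rewrite toM_scale toM_add toM_scale scaleN1r !toM_wsum mkE_ones; apply: nil.
- by apply/allP => j; rewrite mem_iota ltnS tE; apply: t.
Qed.

Lemma commLP d A B : reflect (GRing.comm (toM d A) (toM d B)) (commL d A B).
Proof. by apply: (iffP (eqLP _ _ _)); rewrite !toM_mul. Qed.

Lemma chk_negP n P d D c K R S S' T W G :
  reflect (certificate [seq polyL n p | p <- P] (fun i : 'I_n => toM d (nth [::] S i)) (fun i => toM d (nth [::] S' i))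
     (fun i => toM d (nth [::] T i)) (fun i => toM d (nth [::] W i)) (fun i => Poly (nth [::] G i)) D c K R)
   (chk_neg n P d D c K R S S' T W G).
Proof.
set H := [seq mulL d (nth [::] S i) (expL d D (nth [::] T i)) | i <- iota 0 n].
have HE p : toM d (evalL d n H p) = mmap (@scalar_mx rat d.+1)
    (fun i => toM d (nth [::] S i) * exp_trunc D (toM d (nth [::] T i))) (polyL n p).
  rewrite toM_eval; apply: eq_bigr => m _; congr (_ * _); apply: mmap1_eq => i.
  by rewrite (nth_map 0%N) ?size_iota // nth_iota // toM_mul toM_exp.
apply: (iffP and4P) => [[/all_iotaP alg /allP van c0 /allP sph]|[[SS' cc TD gS Wg] van c0 ints sph]].
  split=> //.
  - split.
    + by move=> i; have /and5P[/eqLP + _ _ _ _] := alg i; rewrite toM_mul toM_one.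
    + move=> i j; have /and5P[_ _ _ _ /and4P[_ _ _ /all_iotaP/(_ j)/and3P[]]] := alg i.
      by move=> /commLP + /commLP + /commLP.
    + by move=> i; have /and5P[_ /zeroLP + _ _ _] := alg i; rewrite toM_pow.
    + by move=> i; have /and5P[_ _ /zeroLP + _ _] := alg i; rewrite toM_horner.
    + by move=> i; have /and5P[_ _ _ /eqLP + _] := alg i; rewrite toM_mul toM_horner Poly_deriv toM_one.
  - by move=> _ /mapP[p pP ->]; rewrite -HE; apply/zeroLP/van.
  - move=> i j k; have /and5P[_ _ _ _ /and4P[/smallMP/(_ j k) + /smallMP/(_ j k) + /smallMP/(_ j k) + _]] := alg i.
    by rewrite !toM_scale.
  (* The program tests only the exponents in the cube [0, 2R]^n, which contains the sphere. *)
  - move=> w sw; have wR : (w : seq nat) \in expsL n (2 * R).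
      have := @expsLP (2 * R) (w : seq nat); rewrite size_tuple; apply; apply/all_tnthP => i.
      by case: sw => + _; apply.
    rewrite -(mkE_mnm w) in sw *; move=> /passesP pw.
    by have := sph _ wR; rewrite (introT (sphereP _ _ _) sw) pw.
split=> //.
- apply/all_iotaP => i; apply/and5P; split.
  + by apply/eqLP; rewrite toM_mul toM_one.
  + by apply/zeroLP; rewrite toM_pow.
  + by apply/zeroLP; rewrite toM_horner.
  + by apply/eqLP; rewrite toM_mul toM_horner Poly_deriv toM_one.
  apply/and4P; split; try by apply/smallMP => j k; rewrite toM_scale; have [] := ints i j k.
  by apply/all_iotaP => j; have [c1 c2 c3] := cc i j; apply/and3P; split; apply/commLP.
- by apply/allP => p pP; apply/zeroLP; rewrite HE; apply/van/map_f.
- apply/allP => e _; apply/implyP => /sphereP/sph h; apply/negP => /passesP; exact: h.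
Qed.

Definition input := (nat * seq (seq (seq nat * rat)))%type.
Definition neg_cert := (nat * nat * (nat * nat * nat) * (seq mat * seq mat) * (seq mat * seq mat) * seq (seq rat))%type.

Lemma comp_smallint X (rX : Rep X) (B : X -> nat) (x : X -> rat) :
  comp B -> comp x -> comp (fun z => smallint (B z) (x z)).
Proof. by apply: comp_op2; rewrite /smallint; ct. Qed.

Ltac ct_neg f := lazymatch f with
  | (fun _ => eqL _ _ _) => eapply comp_eqL
  | (fun _ => powL _ _ _) => eapply comp_powL
  | (fun _ => expL _ _ _) => eapply comp_expL
  | (fun _ => hornerL _ _ _) => eapply comp_hornerL
  | (fun _ => derivL _) => eapply comp_derivL
  | (fun _ => monL _ _ _ _) => eapply comp_monL
  | (fun _ => evalL _ _ _ _) => eapply comp_evalL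
  | (fun _ => smallint _ _) => eapply comp_smallint
  | _ => ct_mat f
  end.
Ltac ct_more f ::= ct_neg f.

Lemma comp_chk_neg : comp (fun p : input * neg_cert => chk_neg p.1.1 p.1.2
  p.2.1.1.1.1.1 p.2.1.1.1.1.2 p.2.1.1.1.2.1.1 p.2.1.1.1.2.1.2 p.2.1.1.1.2.2
  p.2.1.1.2.1 p.2.1.1.2.2 p.2.1.2.1 p.2.1.2.2 p.2.2).
Proof.
rewrite /chk_neg /passesL /tauL /wsumL /smallM /commL /sphereL /dilateL /onesL /expsL /tau_bound.
by ct.
Qed.

(** * Checking certificates of presence *)

Definition pos_cert := (seq nat * seq nat * (rat * rat) * seq (seq (seq nat * rat)))%type.

Definition eqE n (e e' : seq nat) := all (fun i => nth 0 e i == nth 0 e' i)%N (iota 0 n).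
Definition coefL n (p : seq (seq nat * rat)) (e : seq nat) : rat :=
  foldr (fun t acc => (if eqE n t.1 e then t.2 else 0) + acc) 0 p.
(** Terms may repeat, so total coefficients are compared with 0; only exponents that occur in the
    list need testing. *)
Definition is0 n p := all (fun t => coefL n p t.1 == 0) p.
Definition addE n (e e' : seq nat) := [seq (nth 0 e i + nth 0 e' i)%N | i <- iota 0 n].
Definition mulP n (p q : seq (seq nat * rat)) :=
  flatten [seq [seq (addE n t.1 s.1, t.2 * s.2) | s <- q] | t <- p].
Definition combL n (H F : seq (seq (seq nat * rat))) :=
  flatten [seq mulP n (nth [::] H i) (nth [::] F i) | i <- iota 0 (size F)].
(** First, the combination with cofactors [z.2] equals the binomial; second, the binomial is
    nonzero. The latter cannot be read off the two coefficients, as the exponents may coincide. *)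
Definition chk_pos n F (z : pos_cert) :=
  is0 n ([:: (z.1.1.1, - z.1.2.1); (z.1.1.2, z.1.2.2)] ++ combL n z.2 F) &&
  ~~ is0 n [:: (z.1.1.1, z.1.2.1); (z.1.1.2, - z.1.2.2)].

Lemma eqEP n e e' : reflect (mkE n e = mkE n e') (eqE n e e').
Proof.
apply: (iffP (all_iotaP _ _)) => [h|/mnmP h i]; last by have := h i; rewrite !mnmE => ->.
by apply/mnmP => i; rewrite !mnmE; apply/eqP/h.
Qed.

Lemma coefLE n p e : coefL n p e = (polyL n p)@_(mkE n e).
Proof.
rewrite /polyL raddf_sum /=; elim: p => [|t p IH]; first by rewrite big_nil.
rewrite big_cons -IH mcoeffZ mcoeffX /=; congr (_ + _).
by case: eqEP => [->|/eqP/negPf->]; rewrite ?eqxx ?mulr1 ?mulr0.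
Qed.

Lemma is0P n p : reflect (polyL n p = 0) (is0 n p).
Proof.
apply: (iffP allP) => [h|h t _]; last by rewrite coefLE h mcoeff0.
apply/mpolyP => m; rewrite mcoeff0.
have [/hasP[t tp /eqP<-]|no] := boolP (has (fun t => mkE n t.1 == m) p).
  by have /eqP := h _ tp; rewrite coefLE.
rewrite raddf_sum big_seq big1 //= => t tp; rewrite mcoeffZ mcoeffX.
by move/hasPn: no => /(_ t tp)/negPf->; rewrite mulr0.
Qed.

Lemma polyL_cat n p q : polyL n (p ++ q) = polyL n p + polyL n q.
Proof. exact: big_cat. Qed.

Lemma polyL_flatten n ps : polyL n (flatten ps) = \sum_(p <- ps) polyL n p.
Proof. by elim: ps => [|p ps IH]; rewrite ?big_nil ?big_cons -?IH ?polyL_cat // /polyL big_nil. Qed.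

Lemma polyL_mul n p q : polyL n (mulP n p q) = polyL n p * polyL n q.
Proof.
rewrite polyL_flatten big_map mulr_suml; apply: eq_bigr => t _.
rewrite /polyL big_map mulr_sumr; apply: eq_bigr => s _ /=.
rewrite -scalerAl -scalerAr scalerA -mpolyXD; congr (_ *: 'X_[_]).
by apply/mnmP => i; rewrite mnmDE !mnmE (nth_map 0%N) ?size_iota // nth_iota.
Qed.

Lemma polyL_comb n H F :
  polyL n (combL n H F) = \sum_(i < size F) polyL n (nth [::] H i) * polyL n (nth [::] F i).
Proof.
by rewrite polyL_flatten big_map big_iota0; apply: eq_bigr => i _; rewrite polyL_mul.
Qed.

Lemma polyL_surj n (p : {mpoly rat[n]}) : exists l, polyL n l = p.
Proof.
exists [seq (m : seq nat, p@_m) | m : 'X_{1..n} <- msupp p]; rewrite /polyL big_map [RHS]mpolyE.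
by apply: eq_bigr => m _; rewrite mkE_mnm.
Qed.

Lemma choice_seq n T (x0 : T) (R : 'I_n -> T -> Prop) :
  (forall i, exists x, R i x) -> exists s, forall i : 'I_n, R i (nth x0 s i).
Proof.
move=> /choice_fun[f hf]; exists [seq f i | i <- enum 'I_n] => i.
by rewrite (nth_map i) ?size_enum_ord // nth_ord_enum.
Qed.

Definition bad_ideal (I : input) :=
  exists p : {mpoly rat[I.1]}, [/\ in_ideal [seq polyL I.1 f | f <- I.2] p, is_binomial p & p != 0].

Lemma in_idealL n F p :
  in_ideal [seq polyL n f | f <- F] p <-> exists H, p = polyL n (combL n H F).
Proof.
have combE H : polyL n (combL n H F) = \sum_(i < size [seq polyL n f | f <- F])
    polyL n (nth [::] H i) * [seq polyL n f | f <- F]`_i.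
  rewrite polyL_comb -(big_mkord xpredT (fun i => polyL n (nth [::] H i) * polyL n (nth [::] F i))).
  rewrite -(size_map (polyL n)) big_mkord; apply: eq_bigr => i _.
  by rewrite (nth_map [::]) // -(size_map (polyL n)).
split=> [[h ->]|[H ->]]; last by exists (fun i => polyL n (nth [::] H i)); rewrite combE.
have [H HE] := choice_seq [::] (fun i => polyL_surj (h i)).
by exists H; rewrite combE; apply: eq_bigr => i _; rewrite HE.
Qed.

Lemma polyL_bin n u v (mu la : rat) :
  polyL n [:: (u, mu); (v, - la)] = mu *: 'X_[mkE n u] - la *: 'X_[mkE n v].
Proof. by rewrite /polyL !big_cons big_nil addr0 scaleNr. Qed.

Lemma polyL_binN n u v (mu la : rat) L :
  polyL n [:: (u, - mu), (v, la) & L] = polyL n L - polyL n [:: (u, mu); (v, - la)].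
Proof. by rewrite polyL_bin /polyL !big_cons scaleNr opprB addrCA [RHS]addrCA; congr (_ + _); apply: addrC. Qed.

Lemma chk_posP I : (exists z, chk_pos I.1 I.2 z) <-> bad_ideal I.
Proof.
case: I => n F; split=> /= [[[[[u v] [mu la]] H]]|[p [/in_idealL[H pH] [mu [la [u [v pb]]]] p0]]].
  move=> /andP[/is0P/= e0 /is0P ne]; exists (polyL n [:: (u, mu); (v, - la)]); split; last exact/eqP.
    by apply/in_idealL; exists H; apply/esym/eqP; rewrite -subr_eq0 -polyL_binN; apply/eqP.
  by exists mu, la, (mkE n u), (mkE n v); rewrite polyL_bin.
exists (u : seq nat, v : seq nat, (mu, la), H); apply/andP; split=> /=; apply/is0P.
  by rewrite polyL_binN polyL_bin !mkE_mnm -pb -pH subrr.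
by rewrite polyL_bin !mkE_mnm -pb; apply/eqP.
Qed.

Lemma chk_neg_complete n P : ~ bad_ideal (n, P) ->
  exists d D c K R S S' T W G, chk_neg n P d D c K R S S' T W G.
Proof.
move=> no.
have [p pI pB|d [S [S' [T [W [g [D [c [K [R h]]]]]]]]]] := @certificate_complete n [seq polyL n f | f <- P].
  by apply/eqP; case: eqP => // /eqP p0; case: no; exists p.
have lift (M : 'I_n -> 'M[rat]_d.+1) : exists s, (fun i : 'I_n => toM d (nth [::] s i)) = M.
  have [s hs] := choice_seq (R := fun i A => toM d A = M i) [::] (fun i => ex_intro _ _ (toM_ofM (M i))).
  by exists s; apply: functional_extensionality.
have [S1 e1] := lift S; have [S2 e2] := lift S'; have [T1 e3] := lift T; have [W1 e4] := lift W.
have [G e5] : exists s, (fun i : 'I_n => Poly (nth [::] s i)) = g.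
  have [s hs] := choice_seq (R := fun i A => Poly A = g i) [::] (fun i => ex_intro _ _ (polyseqK (g i))).
  by exists s; apply: functional_extensionality.
exists d, D, c, K, R, S1, S2, T1, W1, G; apply/chk_negP.
by rewrite e1 e2 e3 e4 e5.
Qed.

Lemma comp_coefL X (rX : Rep X) n (p : X -> seq (seq nat * rat)) (e : X -> seq nat) :
  comp n -> comp p -> comp e -> comp (fun x => coefL (n x) (p x) (e x)).
Proof. by apply: comp_op3; rewrite /coefL /eqE; ct. Qed.

Lemma comp_mulP X (rX : Rep X) n (p q : X -> seq (seq nat * rat)) :
  comp n -> comp p -> comp q -> comp (fun x => mulP (n x) (p x) (q x)).
Proof. by apply: comp_op3; rewrite /mulP /addE; ct. Qed.

Lemma comp_decode X (rX : Rep X) (z : X -> nat) : comp z -> comp (fun x => CodeSeq.decode (z x)).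
Proof. by apply: comp_app; exists id => [|z0 /=]; [exact: rec1_id | rewrite map_id]. Qed.

Ltac ct_pos f := lazymatch f with
  | (fun _ => coefL _ _ _) => eapply comp_coefL
  | (fun _ => mulP _ _ _) => eapply comp_mulP
  | CodeSeq.decode => exact: (comp_decode (comp_id _))
  | (fun _ => CodeSeq.decode _) => eapply comp_decode
  | _ => ct_rat f
  end.
Ltac ct_more f ::= ct_pos f.

Lemma comp_chk_pos : comp (fun p : input * pos_cert => chk_pos p.1.1 p.1.2 p.2).
Proof. by rewrite /chk_pos /is0 /combL; ct. Qed.

(** * The search, and the decoding of the input *)

(** Post's theorem. One unbounded search runs over pairs of candidates until the first is a positive
    or the second a negative certificate; the answer is then whether the first one is valid. *)
Lemma decidable_semi (P : nat -> Prop) Y (rY : Rep Y) Z (rZ : Rep Z) (pos : nat -> Y -> bool) (neg : nat -> Z -> bool) :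
  comp (fun q : nat * Y => pos q.1 q.2) -> comp (fun q : nat * Z => neg q.1 q.2) ->
  (forall x, (exists y, pos x y) <-> P x) -> (forall x, (exists z, neg x z) <-> ~ P x) ->
  exists r : recf 1, forall x, exists b : bool, recf_eval r [tuple x] b /\ (b <-> P x).
Proof.
move=> [f rf ef] [g rg eg] pos_ex neg_ex.
have fE x y : (f (pr x y) != 0)%N = pos x (dec y) by have := ef (pr x y); rewrite /= pfst_pr psnd_pr.
have gE x z : (g (pr x z) != 0)%N = neg x (dec z) by have := eg (pr x z); rewrite /= pfst_pr psnd_pr.
pose h x c := ((1 - f (pr x (pfst c))) * (1 - g (pr x (psnd c))))%N.
have hE x c : (h x c == 0)%N = pos x (dec (pfst c)) || neg x (dec (psnd c)).
  by rewrite -fE -gE muln_eq0 !subn_eq0 !lt0n.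
have rpr (k : nat -> nat) : rec1 k -> rec2 (fun x c => pr x (k c)).
  by move=> rk; apply: recursive_op2 rec2_pr _ _; rec_tac; apply: recursive_op1 rk _; rec_tac.
have rh : rec2 h.
  apply: recursive_op2 rec2_muln _ _; apply: recursive_op2 rec2_subn _ _; rec_tac.
    exact: recursive_op1 rf (rpr _ rec1_pfst).
  exact: recursive_op1 rg (rpr _ rec1_psnd).
have ex x : exists c, (h x c == 0)%N.
  have [/pos_ex[y py]|/neg_ex[z nz]] := classic (P x).
    by have [c ec] := dec_surj y; exists (pr c 0); rewrite hE pfst_pr ec py.
  by have [c ec] := dec_surj z; exists (pr 0 c); rewrite hE psnd_pr ec nz orbT.
have rmin : rec1 (fun x => ex_minn (ex x)).
  apply: (rec1_mu (rec2_swap rh)) => x; case: ex_minnP => m /eqP hm min; split=> // c.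
  by apply: contraTneq => hc; rewrite -leqNgt min ?hc.
have [r hr] : rec1 (fun x => if f (pr x (pfst (ex_minn (ex x)))) == 0%N then 0%N else 1%N).
  by exact: rec1_if (rec1_comp rf (rec1_op2 rec2_pr rec1_id (rec1_comp rec1_pfst rmin))) (rec1_const 1) (rec1_const 0).
exists r => x; exists (pos x (dec (pfst (ex_minn (ex x))))); split.
  by have := hr [tuple x]; rewrite -fE /= (tnth_nth 0%N) /=; case: (f _ =P 0%N).
case: ex_minnP => c; rewrite hE => ok _; split=> [py|Px]; first by apply/pos_ex; exists (dec (pfst c)).
by case/orP: ok => // nz; case: (proj1 (neg_ex x) _ Px); exists (dec (psnd c)).
Qed.

(** The entries are the sign bit, the absolute numerator and the denominator; the latter is at least
    1, and [invS] adds back the 1 taken off by the predecessor. *)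
Definition read_rat (z : nat) : rat :=
  (if nth 0%N (CodeSeq.decode z) 0 == 0%N then 1 else -1) *
  (nth 0%N (CodeSeq.decode z) 1)%:R * invS (nth 0%N (CodeSeq.decode z) 2).-1.
Definition read_term (z : nat) : seq nat * rat :=
  (CodeSeq.decode (nth 0%N (CodeSeq.decode z) 0), read_rat (nth 0%N (CodeSeq.decode z) 1)).
Definition read_input (z : nat) : input :=
  (nth 0%N (CodeSeq.decode z) 0,
   [seq [seq read_term t | t <- CodeSeq.decode p] | p <- CodeSeq.decode (nth 0%N (CodeSeq.decode z) 1)]).

Lemma comp_read_input : comp read_input.
Proof. by rewrite /read_input /read_term /read_rat; ct. Qed.

Lemma read_rat_code q : read_rat (rat_code q) = q.
Proof.
rewrite /read_rat /rat_code !CodeSeq.codeK; cbn [nth]; rewrite /invS prednK ?absz_gt0 ?denq_neq0 //.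
have -> : (`|denq q|%N%:R : rat) = (denq q)%:~R by rewrite -[in RHS]absz_denq.
rewrite -[RHS]divq_num_den; congr (_ / _).
rewrite -numq_lt0; case: (numq q) => k /=; first by rewrite mul1r.
by rewrite NegzE rmorphN mulN1r.
Qed.

Lemma read_ideal_code (I : ideal_data) : read_input (ideal_code I) =
  (projT1 I, [seq [seq (t.1 : seq nat, t.2) | t : 'X_{1..projT1 I} * rat <- p] | p : poly_data _ <- projT2 I]).
Proof.
rewrite /read_input /ideal_code !CodeSeq.codeK; rewrite -map_comp; congr (_, _).
apply: eq_map => p /=; rewrite /poly_code CodeSeq.codeK -map_comp; apply: eq_map => t /=.
by rewrite /read_term /term_code !CodeSeq.codeK; cbn [nth]; rewrite read_rat_code.
Qed.

Definition chk_neg_cert (I : input) (z : neg_cert) :=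
  chk_neg I.1 I.2 z.1.1.1.1.1 z.1.1.1.1.2 z.1.1.1.2.1.1 z.1.1.1.2.1.2 z.1.1.1.2.2
    z.1.1.2.1 z.1.1.2.2 z.1.2.1 z.1.2.2 z.2.

Lemma chk_neg_certP I : (exists z, chk_neg_cert I z) <-> ~ bad_ideal I.
Proof.
case: I => n P; split=> [[z /chk_negP h] [p [pI pB /eqP]]|]; first by apply; apply: certificate_sound h p pI pB.
move=> /chk_neg_complete[d [D [c [K [R [S1 [S2 [T [W [G h]]]]]]]]]].
by exists (d, D, (c, K, R), (S1, S2), (T, W), G).
Qed.

Theorem theorem1 : algorithmically_decidable ideal_code contains_nonzero_binomial.
Proof.
have cpos : comp (fun q : nat * pos_cert => chk_pos (read_input q.1).1 (read_input q.1).2 q.2).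
  apply: (comp_app (g := fun q : nat * pos_cert => (read_input q.1, q.2)) comp_chk_pos); ct.
  by apply: (comp_app comp_read_input); ct.
have cneg : comp (fun q : nat * neg_cert => chk_neg_cert (read_input q.1) q.2).
  apply: (comp_app (g := fun q : nat * neg_cert => (read_input q.1, q.2)) comp_chk_neg); ct.
  by apply: (comp_app comp_read_input); ct.
(* Every natural number reads as some input, so the search halts on all of them; codes of ideals are
   singled out only afterwards. *)
have [r hr] := decidable_semi cpos cneg (fun x => chk_posP (read_input x)) (fun x => chk_neg_certP (read_input x)).
exists r => I; have [b [rb bP]] := hr (ideal_code I); exists b; split=> //.
apply: iff_trans bP _; rewrite read_ideal_code /bad_ideal /contains_nonzero_binomial /=.
suff -> : [seq polyL (projT1 I) f | f <- [seq [seq (t.1 : seq nat, t.2) | t : 'X_{1..projT1 I} * rat <- p] | p : poly_data _ <- projT2 I]] =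
  [seq poly_of_data f | f <- projT2 I] by [].
rewrite -map_comp; apply: eq_map => p; rewrite /= /polyL big_map.
by apply: eq_bigr => t _; rewrite mkE_mnm.
Qed.
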